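(* Let $G$ be a group presented by an inverse-closed finite convergent length-reducing rewriting system $(\Sigma,T)$, and let $l_T=\max\{|\ell|_\Sigma : (\ell,r)\in T\}$. Define a relation $\sim$ on the set of non-trivial finite-order elements of $G$ by $a\sim b$ if and only if the product $ab$ has finite order. Then the following are equivalent: (1) $G$ is plain; (2) any non-trivial finite-order element in $G$ is contained in a unique maximal finite subgroup of $G$; (3) the relation $\sim$ is transitive on the set of non-trivial finite-order elements in $G$; (4) the relation $\sim$ is transitive on the set of non-trivial finite-order elements in $G$ of geodesic length (with respect to $\Sigma$) at most $11\,l_T$.
   Context: A group is plain if it is isomorphic to a free product of finitely many finite groups and finitely many copies of $\mathbb{Z}$. A length-reducing rewriting system is a pair $(\Sigma,T)$ with $\Sigma$ a non-empty finite alphabet and $T\subseteq \Sigma^*\times\Sigma^*$ such that $|\ell|_\Sigma>|r|_\Sigma$ for all $(\ell,r)\in T$, where $|\cdot|_\Sigma$ is word length and $\lambda$ is the empty word. Write $u\ell v\to urv$ for $u,v\in\Sigma^*$, $(\ell,r)\in T$; $\overset{*}{\to}$ is the reflexive transitive closure and $\overset{*}{\leftrightarrow}$ the reflexive, transitive and symmetric closure. The system is finite if $T$ is finite, convergent if it is terminating (automatic here) and confluent (whenever $w\overset{*}{\to}x$ and $w\overset{*}{\to}y$ there is $z$ with $x\overset{*}{\to}z$ and $y\overset{*}{\to}z$), and inverse-closed if for every $a\in\Sigma$ there is $b\in\Sigma$ with $ab\overset{*}{\to}\lambda$. $G$ is presented by $(\Sigma,T)$ if $G$ is (identified with) the monoid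 $M(\Sigma,T)=\Sigma^*/\overset{*}{\leftrightarrow}$, which is a group when the system is inverse-closed. The geodesic length $|g|_{G,\Sigma}$ of $g\in G$ is the length of a shortest word over $\Sigma\cup\Sigma^{-1}$ evaluating to $g$. *)

(* Defs.v *)
From HB Require Import structures.
From Stdlib Require Import Relation_Operators.
From mathcomp Require Import all_boot ssralg ssrint fingroup generic_quotient.
From mathcomp Require Import finmap boolp classical_sets cardinality.
Set Implicit Arguments.
Unset Strict Implicit.
Unset Printing Implicit Defensive.

Local Open Scope group_scope.
Local Open Scope classical_set_scope.

(** * Rewriting systems *)

(* The alphabet is not required to be finite here: the same notions are used
   for the (in general infinite) defining presentation of a free product. *)
Section Rewriting.
Variable A : choiceType.
Variable T : set (seq A * seq A).

Definition rw_step (x y : seq A) : Prop :=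
  exists u v l r, [/\ T (l, r), x = u ++ l ++ v & y = u ++ r ++ v].

Definition rw_star : seq A -> seq A -> Prop := clos_refl_trans _ rw_step.

Definition rw_equiv : seq A -> seq A -> Prop := clos_refl_sym_trans _ rw_step.

Definition length_reducing : Prop :=
  forall l r, T (l, r) -> (size r < size l)%N.

Definition terminating : Prop := well_founded (fun y x => rw_step x y).

Definition confluent : Prop :=
  forall w x y, rw_star w x -> rw_star w y ->
    exists2 z, rw_star x z & rw_star y z.

Definition convergent : Prop := terminating /\ confluent.

Definition inverse_closed : Prop :=
  forall a : A, exists b : A, rw_star [:: a; b] [::].

(* Meaningful for finite [T] only: [fset_set T] is empty if [T] is infinite. *)
Definition max_lhs : nat := \max_(p <- fset_set T) size p.1.

(** ** The quotient monoid of words modulo [rw_equiv] *)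

Definition rw_eqb (x y : seq A) : bool := `[< rw_equiv x y >].

Lemma rw_eqb_is_equiv : equiv_class_of rw_eqb.
Proof.
split=> [x|x y|y x z].
- by apply/asboolP; exact: rst_refl.
- by apply/asboolP/asboolP => ?; exact: rst_sym.
- by move=> /asboolP xy /asboolP yz; apply/asboolP; exact: rst_trans xy yz.
Qed.

Canonical rw_eqb_equiv := EquivRelPack rw_eqb_is_equiv.

Definition presented : Type := {eq_quot rw_eqb}%qT.

HB.instance Definition _ := Choice.on presented.
HB.instance Definition _ := Quotient.on presented.

Definition word_class (w : seq A) : presented := \pi_presented%qT w.

Lemma word_classP x y : word_class x = word_class y <-> rw_equiv x y.
Proof.
rewrite /word_class; split=> [/eqquotP/asboolP //|xy].
by apply/eqquotP/asboolP.
Qed.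

Lemma word_class_repr (x : presented) : word_class (repr x) = x.
Proof. exact: reprK. Qed.

Lemma repr_word_class w : rw_equiv (repr (word_class w)) w.
Proof. by apply/word_classP; rewrite word_class_repr. Qed.

Lemma rw_equiv_ctx a b x y : rw_equiv x y -> rw_equiv (a ++ x ++ b) (a ++ y ++ b).
Proof.
elim=> {x y} [x y [u [v [l [r [Tlr -> ->]]]]]|x|x y _|x y z _ + _].
- by apply: rst_step; exists (a ++ u), (v ++ b), l, r; rewrite -!catA.
- exact: rst_refl.
- exact: rst_sym.
- exact: rst_trans.
Qed.

Lemma rw_equiv_cat x x' y y' :
  rw_equiv x x' -> rw_equiv y y' -> rw_equiv (x ++ y) (x' ++ y').
Proof.
move=> xx' yy'; apply: (@rst_trans _ _ _ (x' ++ y)).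
  exact: (@rw_equiv_ctx [::] y).
by have := @rw_equiv_ctx x' [::] _ _ yy'; rewrite !cats0.
Qed.

Definition presented_one : presented := word_class [::].

Definition presented_mul (x y : presented) : presented :=
  word_class (repr x ++ repr y).

Lemma presented_mulE x y :
  presented_mul (word_class x) (word_class y) = word_class (x ++ y).
Proof. by apply/word_classP/rw_equiv_cat; exact: repr_word_class. Qed.

Fact presented_mulA : associative presented_mul.
Proof.
move=> x y z.
rewrite -(word_class_repr x) -(word_class_repr y) -(word_class_repr z).
by rewrite !presented_mulE catA.
Qed.

Fact presented_mul1 : left_id presented_one presented_mul.
Proof. by move=> x; rewrite -(word_class_repr x) presented_mulE. Qed.

Fact presented_mulr1 : right_id presented_one presented_mul.
Proof. by move=> x; rewrite -(word_class_repr x) presented_mulE cats0. Qed.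

HB.instance Definition _ := isMonoid.Build presented
  presented_mulA presented_mul1 presented_mulr1.

End Rewriting.

(** * Free products *)

Section FreeProduct.
Variables (I : choiceType) (H : I -> groupType).

Definition fp_letter : choiceType := {i : I & H i}.

Definition fp_relations : set (seq fp_letter * seq fp_letter) :=
  [set p | (exists i, p = ([:: Tagged H (1 : H i)], [::])) \/
           (exists i (x y : H i),
              p = ([:: Tagged H x; Tagged H y], [:: Tagged H (x * y)]))].

Definition free_product : Type := presented fp_relations.

HB.instance Definition _ := Monoid.on free_product.

Definition fp_inv_letter (a : fp_letter) : fp_letter :=
  Tagged H (tagged a)^-1.

Definition fp_inv_word (w : seq fp_letter) : seq fp_letter :=
  rev (map fp_inv_letter w).

Definition fp_inv (x : free_product) : free_product :=
  word_class fp_relations (fp_inv_word (repr x)).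

Lemma fp_inv_wordK : involutive fp_inv_word.
Proof.
move=> w; rewrite /fp_inv_word map_rev revK -map_comp -[RHS]map_id.
by apply: eq_map => -[i x]; rewrite /fp_inv_letter /= invgK.
Qed.

Lemma fp_inv_word_mul w : rw_equiv fp_relations (fp_inv_word w ++ w) [::].
Proof.
elim: w => [|[i x] w IHw]; first exact: rst_refl.
rewrite /fp_inv_word /= rev_cons cat_rcons -/(fp_inv_word w).
apply: rst_trans IHw.
apply: (@rst_trans _ _ _ (fp_inv_word w ++ [:: Tagged H (1 : H i)] ++ w)).
  apply: rst_step; exists (fp_inv_word w), w, [:: Tagged H x^-1; Tagged H x].
  exists [:: Tagged H (x^-1 * x)]; split=> //; last by rewrite mulVg.
  by right; exists i, x^-1, x.
apply: rst_step; exists (fp_inv_word w), w, [:: Tagged H (1 : H i)], [::].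
by split=> //; left; exists i.
Qed.

Fact fp_mulVg : left_inverse 1 fp_inv (@mul free_product).
Proof.
move=> x; rewrite -{2}(word_class_repr x) /fp_inv.
by rewrite [LHS]presented_mulE; apply/word_classP/fp_inv_word_mul.
Qed.

Fact fp_mulgV : right_inverse 1 fp_inv (@mul free_product).
Proof.
move=> x; rewrite -{1}(word_class_repr x) /fp_inv.
rewrite [LHS]presented_mulE; apply/word_classP.
by rewrite -{1}(fp_inv_wordK (repr x)); exact: fp_inv_word_mul.
Qed.

HB.instance Definition _ := hasInv.Build free_product fp_inv.
HB.instance Definition _ :=
  Monoid_isGroup.Build free_product fp_mulVg fp_mulgV.

End FreeProduct.

Arguments fp_relations {I} H.

(** * Plain groups *)

(* The additive group of the integers, in multiplicative notation. *)
Definition int_group : Type := int.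
HB.instance Definition _ := Choice.on int_group.
HB.instance Definition _ := isGroup.Build int_group
  (@GRing.addrA int) (@GRing.add0r int) (@GRing.addr0 int)
  (@GRing.addNr int) (@GRing.addrN int).

Definition plain_factor (m n : nat) (F : 'I_m -> finGroupType)
    (i : 'I_m + 'I_n) : groupType :=
  match i with inl j => F j | inr _ => int_group end.

Definition plain (G : groupType) : Prop :=
  exists (m n : nat) (F : 'I_m -> finGroupType)
         (f : {multiplicative G -> free_product (plain_factor (n := n) F)}),
    bijective f.

(** * Torsion elements and finite subgroups *)

Section GroupNotions.
Variable G : groupType.

Definition finite_order (g : G) : Prop :=
  exists2 n, (0 < n)%N & g ^+ n = 1.

Definition nontrivial_torsion : set G := [set g | g <> 1 /\ finite_order g].

Definition torsion_rel (a b : G) : Prop := finite_order (a * b).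

Definition transitive_on (S : set G) (R : G -> G -> Prop) : Prop :=
  forall a b c, S a -> S b -> S c -> R a b -> R b c -> R a c.

Definition finite_subgroup (K : set G) : Prop :=
  finite_set K /\ group_closed [in K].

Definition maximal_finite_subgroup (M : set G) : Prop :=
  finite_subgroup M /\ forall K, finite_subgroup K -> M `<=` K -> K = M.

Variables (A : Type) (ev : A -> G).

(* [inl a] stands for the letter [a] and [inr a] for its formal inverse. *)
Definition signed_letter_value (s : A + A) : G :=
  match s with inl a => ev a | inr a => (ev a)^-1 end.

Definition signed_word_value (w : seq (A + A)) : G :=
  \prod_(s <- w) signed_letter_value s.

Definition is_geodesic_length (g : G) (n : nat) : Prop :=
  (exists2 w, size w = n & signed_word_value w = g) /\
  (forall w, signed_word_value w = g -> (n <= size w)%N).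

(* The default value 0 is only taken at elements outside the subgroup
   generated by the image of [ev]. *)
Definition geodesic_length (g : G) : nat := xget 0%N (is_geodesic_length g).

End GroupNotions.

(* Main.v *)
(* Geodesics in the Cayley graph of [G] with respect to [Sigma] are unique (they
   are the irreducible words) and nearby geodesics agree except near their ends,
   so the Cayley graph is tree-like.

   (1) => (3): a torsion element of a free product is conjugate into a factor,
   and if two torsion elements have a torsion product they lie in the same
   conjugate.

   (4) => (2): a finite set of torsion elements with torsion quotients has an
   almost fixed point, and the almost fixed points of a given nontrivial torsion
   element are close together. Hence two finite subgroups with a common
   nontrivial element consist of short elements after a conjugation, and (4)
   makes the subgroup they generate torsion. Torsion subgroups are finite.

   (2) => (1): every element [h] of infinite order is split by a subset of [G]
   (a cut) with finite boundary. Among the cuts splitting [h] choose one of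
   lexicographically minimal weights; by submodularity all these cuts are nested,
   so they are the edges of a tree on which [G] acts with finitely many orbits
   and finite edge stabilizers. By (2), if all cuts along the axis of [h] had
   nontrivial stabilizers, these would lie in one maximal finite subgroup,
   normalized by [h], and a power of [h] would centralize a nontrivial torsion
   element; so cuts with trivial stabilizer suffice. Splitting along one orbit of
   these gives a free product decomposition into groups with fewer orbits, and a
   group without such cuts is torsion, hence finite. *)
From HB Require Import structures.
Require Import Defs.
From Stdlib Require Import Relation_Operators Operators_Properties.
From mathcomp Require Import all_boot fingroup ssralg ssrnum ssrint.
From mathcomp Require Import boolp classical_sets cardinality finmap.
From mathcomp Require Import zify.
Set Implicit Arguments.
Unset Strict Implicit.
Unset Printing Implicit Defensive.

(** The geometric part uses the rewriting system only through [nf_system], with [L] = l_T. The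
    constant 11 l_T has to cover the following: a finite set of torsion elements with torsion
    quotients has a base point where displacements are about 2L; two such base points for one
    nontrivial torsion element are at distance at most about 7L; so at the midpoint both subgroups
    have displacements at most about 9L.

    The dual tree is never built as an object. Its oriented edges are the cuts, a vertex is named by
    any edge that ends there, and finite intervals replace paths. The lexicographic order on weight
    sequences is not well founded; minimal cuts exist because tight cuts have finitely many orbits.

    Trivial edge stabilizers turn each splitting into a free product of two vertex groups, or of a
    vertex group and a cyclic group. The induction ends because a vertex group has fewer orbits of
    cuts that split one of its own elements: the edges of the tree split none of them, and such cuts
    that are equivalent under the whole group are already equivalent under the vertex group. *)

Local Open Scope group_scope.
Local Open Scope classical_set_scope.

(* The Cayley graph of [G] has unique geodesics, given by [nf], which are
   recognized by windows of length [L]; an edge between elements of the same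
   length joins geodesics that differ only in their last [L - 1] letters. *)
Record nf_system (G : groupType) (Sigma : finType) (L : nat)
    (ev : seq Sigma -> G) (nf : G -> seq Sigma) : Prop := NfSystem {
  nfs_pos : (0 < L)%N;
  nfs_nil : ev [::] = 1;
  nfs_cat : forall u v, ev (u ++ v) = ev u * ev v;
  nfs_K : forall g, ev (nf g) = g;
  nfs_min : forall w, (size (nf (ev w)) <= size w)%N;
  nfs_uniq : forall w, (size w <= size (nf (ev w)))%N -> nf (ev w) = w;
  nfs_inv : forall a, exists b, ev [:: a] * ev [:: b] = 1;
  nfs_local : forall w,
    (forall u l v, w = u ++ l ++ v -> (size l <= L)%N -> nf (ev l) = l) ->
    nf (ev w) = w;
  nfs_edge : forall g a, size (nf (g * ev [:: a])) = size (nf g) ->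
    take (size (nf g) - L.-1) (nf (g * ev [:: a]))
    = take (size (nf g) - L.-1) (nf g)
}.

(** * Irreducible words are the unique geodesics *)

Section RewritingNormalForms.
Variables (G : groupType) (Sigma : finType) (T : set (seq Sigma * seq Sigma)).
Hypothesis T_length_reducing : length_reducing T.
Hypothesis T_finite : finite_set T.
Hypothesis T_convergent : convergent T.
Hypothesis T_inverse_closed : inverse_closed T.
Hypothesis Sigma_nonempty : (0 < #|Sigma|)%N.
Variable phi : {multiplicative presented T -> G}.
Hypothesis phi_bij : bijective phi.

Definition rw_eval (w : seq Sigma) : G := phi (word_class T w).
Local Notation ev := rw_eval.

Definition irreducible (w : seq Sigma) := ~ exists w', rw_step T w w'.

(** The default value is never taken, by [rw_nfP]. *)
Definition rw_nf (g : G) : seq Sigma :=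
  xget [::] [set w | irreducible w /\ ev w = g]%classic.
Local Notation nf := rw_nf.

(* Destructing [rw_step] directly yields words over the [choiceType] underlying
   [Sigma], whose sizes [lia] does not identify with those over [Sigma]. *)
Lemma rw_stepP (x y : seq Sigma) : rw_step T x y ->
  exists u v l r : seq Sigma, [/\ T (l, r), x = u ++ l ++ v & y = u ++ r ++ v].
Proof. by []. Qed.

Lemma rule_lt (l r : seq Sigma) : T (l, r) -> (size r < size l)%N.
Proof. exact: T_length_reducing. Qed.

Lemma rw_step_size (x y : seq Sigma) : rw_step T x y -> (size y < size x)%N.
Proof.
move=> /rw_stepP[u [v [l [r [/rule_lt rl -> ->]]]]]; rewrite !size_cat.
by move: rl; lia.
Qed.

Lemma rw_star_size (x y : seq Sigma) : rw_star T x y -> x = y \/ (size y < size x)%N.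
Proof.
elim=> {x y} [x y /rw_step_size|x|x y z _ [->|h1] _ [<-|h2]]; auto.
by right; lia.
Qed.

Lemma rw_star_equiv x y : rw_star T x y -> rw_equiv T x y.
Proof.
elim=> {x y} [x y ?|x|x y z _ h1 _ h2]; first exact: rst_step.
  exact: rst_refl.
exact: rst_trans h1 h2.
Qed.

Lemma church_rosser x y : rw_equiv T x y ->
  exists2 z, rw_star T x z & rw_star T y z.
Proof.
elim=> {x y} [x y xy|x|x y _ [z ? ?]|x y z _ [u xu yu] _ [v yv zv]].
- by exists y; [exact: rt_step|exact: rt_refl].
- by exists x; exact: rt_refl.
- by exists z.
have [w uw vw] := T_convergent.2 _ _ _ yu yv.
by exists w; [exact: rt_trans xu uw|exact: rt_trans zv vw].
Qed.

Lemma rw_star_irreducible (w : seq Sigma) :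
  exists2 w' : seq Sigma, rw_star T w w' & irreducible w'.
Proof.
have [n] := ubnP (size w); elim: n w => // n IH w wn.
have [[w' ww']|irr] := pselect (exists w' : seq Sigma, rw_step T w w').
  have [|w'' h1 h2] := IH w'; first by have := rw_step_size ww'; lia.
  by exists w'' => //; apply: rt_trans h1; exact: rt_step.
by exists w => //; exact: rt_refl.
Qed.

Lemma irreducible_star w w' : irreducible w -> rw_star T w w' -> w = w'.
Proof.
move=> irr h; have {h} := clos_rt_rt1n _ _ _ _ h.
by case=> // y z wy _; case: irr; exists y.
Qed.

Lemma rw_eval_eqP x y : ev x = ev y <-> rw_equiv T x y.
Proof.
by rewrite -word_classP /rw_eval; split=> [/(bij_inj phi_bij)|->].
Qed.

Lemma rw_eval_cat u v : ev (u ++ v) = ev u * ev v.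
Proof. by rewrite /rw_eval -gmulfM -presented_mulE. Qed.

Lemma rw_eval_nil : ev [::] = 1.
Proof. by apply: (mulgI (ev [::])); rewrite -rw_eval_cat mulg1. Qed.

Lemma rw_eval_surj g : exists w, ev w = g.
Proof.
have [psi phiK psiK] := phi_bij; exists (generic_quotient.repr (psi g)).
by rewrite /rw_eval word_class_repr psiK.
Qed.

Lemma rw_nfP g : irreducible (nf g) /\ ev (nf g) = g.
Proof.
rewrite /rw_nf; case: xgetP => [w _ //|no].
have [w ew] := rw_eval_surj g; have [w' ww' irr] := rw_star_irreducible w.
case: (no w'); split=> //; rewrite -ew; apply/rw_eval_eqP.
by apply: rst_sym; exact: rw_star_equiv.
Qed.

Lemma rw_nf_irreducible w : irreducible w -> nf (ev w) = w.
Proof.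
move=> irr; have [irr' /rw_eval_eqP/church_rosser[z h1 h2]] := rw_nfP (ev w).
by rewrite (irreducible_star irr' h1) (irreducible_star irr h2).
Qed.

Lemma rw_star_nf w : rw_star T w (nf (ev w)).
Proof.
have [w' ww' irr] := rw_star_irreducible w.
rewrite (_ : ev w = ev w') ?rw_nf_irreducible //.
by apply/rw_eval_eqP; exact: rw_star_equiv.
Qed.

Lemma rw_nf_min w : (size (nf (ev w)) <= size w)%N.
Proof. by have [<-|/ltnW] := rw_star_size (rw_star_nf w). Qed.

Lemma rw_nf_uniq w : (size w <= size (nf (ev w)))%N -> nf (ev w) = w.
Proof. by have [<-//|] := rw_star_size (rw_star_nf w); rewrite ltnNge => /negP. Qed.

Lemma rule_size (l r : seq Sigma) : T (l, r) -> (size l <= max_lhs T)%N.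
Proof.
move=> Tlr; apply: (leq_bigmax_seq (F := fun p => size p.1) (l, r)) => //.
by rewrite in_fset_set //; exact: mem_set.
Qed.

(** Some word [[:: a; b]] reduces to the empty word, so there is a rule, and its left side is
    nonempty because it is longer than the right side. *)
Lemma max_lhs_gt0 : (0 < max_lhs T)%N.
Proof.
have /card_gt0P[a _] := Sigma_nonempty.
have [b h] := T_inverse_closed a.
have [[w [u [v [l [r [Tlr _ _]]]]]]|/irreducible_star/(_ h)//] :=
  pselect (exists w, rw_step T [:: a; b] w).
apply: leq_trans (rule_size Tlr).
by apply: leq_ltn_trans (T_length_reducing Tlr).
Qed.

Lemma rw_eval_inv a : exists b, ev [:: a] * ev [:: b] = 1.
Proof.
have [b h] := T_inverse_closed a; exists b.
by rewrite -rw_eval_cat -rw_eval_nil; apply/rw_eval_eqP/rw_star_equiv.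
Qed.

(** A reducible word contains the left side of a rule, which is a window of length at most l_T that
    is not in normal form. *)
Lemma irreducible_local w :
  (forall u l v, w = u ++ l ++ v -> (size l <= max_lhs T)%N -> nf (ev l) = l) ->
  nf (ev w) = w.
Proof.
move=> loc; apply: rw_nf_irreducible => -[w' [u [v [l [r [Tlr def_w _]]]]]].
have [irr _] := rw_nfP (ev l); apply: irr; exists r.
rewrite (loc _ _ _ def_w (rule_size Tlr)).
by exists [::], [::], l, r; rewrite !cats0.
Qed.

(** Equal lengths leave room for the loss of a single letter, so one rule brings [nf g ++ [:: a]] to
    normal form. Its left side ends in the new letter and thus meets only the last l_T - 1 letters
    of [nf g]. *)
Lemma rw_nf_edge g a : size (nf (g * ev [:: a])) = size (nf g) ->
  take (size (nf g) - (max_lhs T).-1) (nf (g * ev [:: a]))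
  = take (size (nf g) - (max_lhs T).-1) (nf g).
Proof.
have [irr ev_g] := rw_nfP g.
have -> : g * ev [:: a] = ev (nf g ++ [:: a]) by rewrite rw_eval_cat ev_g.
move=> eq_sz.
have [[w /rw_stepP[u [v [l [r [Tlr def_w w_def]]]]]]|irr'] :=
  pselect (exists w : seq Sigma, rw_step T (nf g ++ [:: a]) w); last first.
  move/eqP: eq_sz; rewrite rw_nf_irreducible // size_cat.
  by rewrite addn1 eqn_leq ltnn.
have rl := rule_lt Tlr; have lL := rule_size Tlr.
have step : rw_step T (nf g ++ [:: a]) w by exists u, v, l, r.
have ev_w : ev (nf g ++ [:: a]) = ev w.
  by apply/rw_eval_eqP; exact: rst_step.
(* Otherwise the rule would already apply inside [nf g]. *)
have v0 : v = [::].
  case/lastP: v def_w w_def => // v b; rewrite -!rcons_cat cats1 => eq_w _.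
  have [eq_g _] := rcons_inj eq_w; case: irr; exists (u ++ r ++ v).
  by exists u, v, l, r.
have ws := rw_step_size step.
have eq_w : nf (ev w) = w.
  by apply: rw_nf_uniq; rewrite -ev_w eq_sz -ltnS; move: ws; rewrite size_cat addn1.
move: def_w w_def; rewrite v0 !cats0 => def_w w_def.
have szw : (size (nf g)).+1 = (size u + size l)%N.
  by rewrite -addn1 -size_cat -(size_cat _ [:: a]) def_w.
have l_gt0 : (0 < size l)%N by exact: leq_ltn_trans rl.
have su : (size (nf g) - (max_lhs T).-1 <= size u)%N.
  move: lL szw; lia.
have sg : (size u <= size (nf g))%N.
  move: l_gt0 szw; lia.
rewrite ev_w eq_w w_def.
have := congr1 (take (size u)) def_w.
rewrite [in RHS]take_size_cat // takel_cat // => eq_u.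
by rewrite takel_cat // -{1}eq_u take_takel.
Qed.

Lemma rw_nf_system : nf_system (max_lhs T) ev nf.
Proof.
split.
- exact: max_lhs_gt0.
- exact: rw_eval_nil.
- exact: rw_eval_cat.
- by move=> g; exact: (rw_nfP g).2.
- exact: rw_nf_min.
- exact: rw_nf_uniq.
- exact: rw_eval_inv.
- exact: irreducible_local.
- exact: rw_nf_edge.
Qed.

End RewritingNormalForms.

(** * Straight elements and torsion *)

Section Torsion.
Variable G : groupType.

Lemma finite_orderV (x : G) : finite_order x -> finite_order x^-1.
Proof. by move=> [n n0 xn]; exists n => //; rewrite expVgn xn invg1. Qed.

Lemma finite_orderJ (x p : G) : finite_order x -> finite_order (x ^ p).
Proof. by move=> [n n0 xn]; exists n => //; rewrite -conjXg xn conj1g. Qed.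

Lemma finite_orderJV (x p : G) : finite_order (x ^ p) -> finite_order x.
Proof. by move=> /(finite_orderJ p^-1); rewrite conjgK. Qed.

Lemma finite_orderX (x : G) n : finite_order x -> finite_order (x ^+ n).
Proof.
by move=> [m m0 xm]; exists m => //; rewrite -expgnA mulnC expgnA xm expg1n.
Qed.

Lemma finite_order_root (x : G) n : (0 < n)%N ->
  finite_order (x ^+ n) -> finite_order x.
Proof.
move=> n0 [m m0 xm]; exists (n * m)%N; first by rewrite muln_gt0 n0.
by rewrite expgnA.
Qed.

Lemma finite_order_mulC (x y : G) : finite_order (x * y) -> finite_order (y * x).
Proof. by move=> /(finite_orderJ x); rewrite conjgE mulgA mulKg. Qed.

Lemma infinite_order_inj (x : G) : ~ finite_order x -> injective (natexp x).
Proof.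
move=> xinf m n; wlog le_mn : m n / (m <= n)%N.
  by move=> W eq_mn; have [/W->|/ltnW/W->] := leqP m n.
move=> eq_mn; apply/eqP; rewrite eqn_leq le_mn leqNgt.
apply/negP => lt_mn; apply: xinf; exists (n - m)%N; first by rewrite subn_gt0.
by rewrite expgnFr // eq_mn mulgV.
Qed.

End Torsion.

(** * Geodesics and displacements in the Cayley graph *)

Section Geometry.
Variables (G : groupType) (Sigma : finType) (L : nat).
Variables (ev : seq Sigma -> G) (nf : G -> seq Sigma).
Hypothesis N : nf_system L ev nf.

Definition irr w := nf (ev w) = w.
Definition len g := size (nf g).

(* The group operations can be reached through several coercion paths, and
   [lia] does not identify the resulting convertible atoms. *)
Ltac lens := repeat match goal with
  | |- context [len ?x] => match goal with
    | |- context [len ?y] =>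
        assert_fails (constr_eq x y); unify x y; change (len y) with (len x)
    end
  end; lia.

(** The value comes from the edges between elements of equal length n in [nf_edge]: prefixes of
    length k can differ only if k is at least n - L + 2. *)
Definition gap := (2 * L - 3)%N.

Let ev0 : ev [::] = 1 := nfs_nil N.
Let evM u v : ev (u ++ v) = ev u * ev v := nfs_cat N u v.
Let nfK g : ev (nf g) = g := nfs_K N g.
Let nf_min w : (len (ev w) <= size w)%N := nfs_min N w.
Let nf_uniq w : (size w <= len (ev w))%N -> irr w := @nfs_uniq _ _ _ _ _ N w.

Lemma nf_irr g : irr (nf g). Proof. by rewrite /irr nfK. Qed.

Lemma len_irr w : irr w -> len (ev w) = size w. Proof. by rewrite /len => ->. Qed.

(** A shorter representative of the subword would shorten the whole word. *)
Lemma irr_sub u l v : irr (u ++ l ++ v) -> irr l.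
Proof.
move=> /len_irr ulv; apply: nf_uniq; rewrite leqNgt; apply/negP => lt_l.
have : (len (ev (u ++ nf (ev l) ++ v)) <= size (u ++ nf (ev l) ++ v))%N by [].
rewrite !evM nfK -!evM ulv !size_cat; move: lt_l; rewrite /len; lia.
Qed.

Lemma irr_take w i : irr w -> irr (take i w).
Proof.
by move=> iw; apply: (@irr_sub [::] _ (drop i w)); rewrite cat_take_drop.
Qed.

Lemma irr_drop w i : irr w -> irr (drop i w).
Proof.
move=> iw; apply: (@irr_sub (take i w) _ [::]).
by rewrite cats0 cat_take_drop.
Qed.

Lemma len1 : len 1 = 0%N.
Proof. by apply/eqP; rewrite -leqn0 -ev0. Qed.

Lemma lenM g h : (len (g * h) <= len g + len h)%N.
Proof. by rewrite -{1}(nfK g) -{1}(nfK h) -evM -size_cat. Qed.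

Lemma letter_inv a : {b | ev [:: a] * ev [:: b] = 1}.
Proof. by apply: cid; exact: (nfs_inv N). Qed.

Lemma len_word_inv w : (len (ev w)^-1 <= size w)%N.
Proof.
elim: w => [|a w IH]; first by rewrite ev0 invg1 len1.
have [b ab] := letter_inv a.
rewrite -cat1s evM invgM (mulg1_eq ab).
apply: leq_trans (lenM _ _) _; rewrite /= -addn1; exact: leq_add.
Qed.

Lemma lenV g : len g^-1 = len g.
Proof.
apply/eqP; rewrite eqn_leq -{1}(nfK g) len_word_inv /=.
by rewrite -{1}[g]invgK -{1}(nfK g^-1) len_word_inv.
Qed.

Lemma len_conj (g p : G) : (len (g ^ p) <= len g + 2 * len p)%N.
Proof.
apply: leq_trans (lenM p^-1 (g * p)) _; rewrite lenV.
apply: leq_trans (leq_add (leqnn _) (lenM g p)) _; lia.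
Qed.

Lemma nf_snoc g a : len (g * ev [:: a]) = (len g).+1 ->
  nf (g * ev [:: a]) = nf g ++ [:: a].
Proof.
have -> : g * ev [:: a] = ev (nf g ++ [:: a]) by rewrite evM nfK.
by move=> e; apply: nf_uniq; rewrite e size_cat addn1.
Qed.

(** If the lengths differ, the longer geodesic extends the shorter one by a letter, so only prefixes
    longer than the shorter one can differ. Equal lengths are the case [nfs_edge]. *)
Lemma nf_edge k g a : take k (nf g) <> take k (nf (g * ev [:: a])) ->
  (len g + len (g * ev [:: a]) + 1 <= gap + 2 * k)%N.
Proof.
have [b ab] := letter_inv a; have L0 := nfs_pos N.
set h := g * ev [:: a]; have gE : g = h * ev [:: b] by rewrite -mulgA ab mulg1.
have l1 c : (len (ev [:: c]) <= 1)%N := nf_min _.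
have hg : (len h <= len g + 1)%N.
  by apply: leq_trans (lenM _ _) _; rewrite leq_add2l.
have gh : (len g <= len h + 1)%N.
  by rewrite {1}gE; apply: leq_trans (lenM _ _) _; rewrite leq_add2l.
move=> neq_k.
have [e|[e|e]] : len h = (len g).+1 \/ len g = (len h).+1 \/ len h = len g.
- by move: hg gh; lia.
- have kg : (len g < k)%N.
    rewrite ltnNge; apply/negP => kg; apply: neq_k.
    by rewrite /h (nf_snoc e) takel_cat.
  by move: e kg; lia.
- have kg : (len h < k)%N.
    rewrite ltnNge; apply/negP => kg; apply: neq_k.
    by rewrite gE nf_snoc -?gE // takel_cat.
  by move: e kg; lia.
have /(congr1 (take k)) := nfs_edge N e.
have [kg|kg] := leqP k (size (nf g) - L.-1).
  by rewrite !take_takel // => /esym.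
move: kg; rewrite /gap -/(len g); lia.
Qed.

(* Along a geodesic from g to g' some edge (v, v') separates the prefixes of
   length k; by [nf_edge] both of its ends are within k + L of 1. *)
Lemma prefix_gap k g g' : take k (nf g) <> take k (nf g') ->
  (len g + len g' + 2 <= len (g^-1 * g') + gap + 2 * k)%N.
Proof.
suff H w h : take k (nf h) <> take k (nf (h * ev w)) ->
    (len h + len (h * ev w) + 2 <= size w + gap + 2 * k)%N.
  by have := H (nf (g^-1 * g')) g; rewrite nfK mulKVg.
elim: w h => [|a w IH] h; first by rewrite ev0 mulg1.
pose h1 := h * ev [:: a].
have -> : h * ev (a :: w) = h1 * ev w by rewrite -cat1s evM mulgA.
move=> neq_k.
have h1w : (len (h1 * ev w) <= len h1 + size w)%N.
  by apply: leq_trans (lenM _ _) _; rewrite leq_add2l.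
have hh1 : (len h <= len h1 + 1)%N.
  rewrite -[h](mulgK (ev [:: a])) -/h1; apply: leq_trans (lenM _ _) _.
  by rewrite leq_add2l lenV; exact: nf_min.
have [eq1|neq1] := pselect (take k (nf h) = take k (nf h1)).
  by have := IH h1; rewrite -eq1 => /(_ neq_k); move: hh1 => /=; lens.
by have := nf_edge neq1; rewrite -/h1; move: h1w => /=; lens.
Qed.

Definition hd g := take 1 (nf g).

(** Two geodesics that leave 1 by different letters form a path that is geodesic up to [gap]. *)
Lemma hd_gap g g' : hd g <> hd g' ->
  (len g + len g' <= len (g^-1 * g') + gap)%N.
Proof. by move=> /prefix_gap; lens. Qed.

(* The powers of such an [x] run along a quasigeodesic. *)
Definition straight x := (gap < len x)%N /\ hd x <> hd x^-1.

Lemma straightV x : straight x -> straight x^-1.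
Proof. by rewrite /straight lenV invgK => -[? /nesym]. Qed.

(** By induction x^(n+1) starts like x, hence unlike x^-1, so by [hd_gap] another factor x adds more
    than it can cancel. A different first letter of the new power would, again by [hd_gap], make it
    too short. *)
Lemma straight_pow x n : straight x ->
  hd (x ^+ n.+1) = hd x /\ (len (x ^+ n) < len (x ^+ n.+1))%N.
Proof.
move=> [xl xh]; elim: n => [|n [IHh IHl]].
  by split=> //; rewrite expg0 len1; apply: leq_trans xl.
have h1 : (len x + len (x ^+ n.+1) <= len (x ^+ n.+2) + gap)%N.
  have := @hd_gap x^-1 (x ^+ n.+1); rewrite IHh lenV invgK -expgS.
  by apply; exact: nesym.
split; last by move: xl h1; lens.
apply/esym; apply: contrapT => /hd_gap; rewrite {2}expgS mulKg.
by move: xl h1; lens.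
Qed.

Lemma straight_infinite x : straight x -> ~ finite_order x.
Proof.
move=> sx [[//|n] _ xn]; have [_] := straight_pow n sx.
by rewrite xn len1.
Qed.

(** Two long elements that each leave and return in one direction, but in different directions,
    behave like rotations about distant points; their quotient is a translation. *)
Lemma straight_quotient x y : (gap < len x)%N -> (gap < len y)%N ->
  hd x = hd x^-1 -> hd y = hd y^-1 -> hd x <> hd y -> straight (x^-1 * y).
Proof.
have aux u v : (gap < len u)%N -> (gap < len v)%N -> hd u <> hd v ->
    (gap < len (u^-1 * v))%N /\ hd (u^-1 * v) = hd u^-1.
  move=> lu lv huv; have lw := hd_gap huv; split; first by move: lw; lens.
  apply/esym; apply: contrapT => /hd_gap; rewrite invgK mulVKg lenV.
  by move: lw lu lv; lens.
move=> lx ly hx hy hxy; have [l1 h1] := aux _ _ lx ly hxy.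
have [_ h2] := aux _ _ ly lx (nesym hxy).
by split=> //; rewrite h1 invgM invgK h2 -hx -hy.
Qed.

(** By uniqueness of geodesics, [nf x] both starts with y and ends with the inverse letter of y, so
    the conjugation cancels one letter at each end. *)
Lemma conj_letter_shorter x y : hd x = [:: y] -> hd x^-1 = [:: y] ->
  (2 <= len x)%N -> (len (x ^ ev [:: y]) + 2 <= len x)%N.
Proof.
have hdE z : hd z = [:: y] -> exists w, nf z = y :: w.
  by rewrite /hd; case: (nf z) => //= a w [->]; exists w.
move=> /hdE[w xw] /hdE[v xv] l2.
have [b yb] := letter_inv y.
have sv : (size v).+1 = len x by rewrite -lenV /len xv.
have xy : x * ev [:: y] = (ev v)^-1.
  by rewrite -(invgK x) -(nfK x^-1) xv -cat1s evM invgM mulgVK.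
have xE : x = ev (nf (ev v)^-1 ++ [:: b]).
  by rewrite evM nfK -xy -mulgA yb mulg1.
have lv : (len (ev v)^-1 <= size v)%N by rewrite lenV.
have : nf (ev v)^-1 ++ [:: b] = y :: w.
  rewrite -xw xE; apply/esym/nf_uniq; rewrite -xE size_cat addn1 -sv.
  by rewrite ltnS.
move=> e; rewrite conjgE xy -(nfK (ev v)^-1).
move: e (lv : (size (nf (ev v)^-1) <= size v)%N).
case: (nf (ev v)^-1) => [[_ w0] _|c u [-> _] lu].
  by move: l2; rewrite /len xw -w0.
have -> : (ev [:: y])^-1 * ev (y :: u) = ev u by rewrite (evM [:: y] u) mulKg.
by rewrite -sv; have := nf_min u; move: lu => /=; lia.
Qed.

(** This replaces torsion in [common_center], so that the latter also applies to the powers in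
    [infinite_order_straight]. *)
Definition never_straight x := forall p, ~ straight (x ^ p).

Lemma finite_never_straight x : finite_order x -> never_straight x.
Proof. by move=> fx p /straight_infinite; apply; exact: finite_orderJ. Qed.

(* Moving the base point along the common first letter of the long elements
   decreases the largest displacement. *)
Lemma common_center (S : seq G) :
  {in S, forall x, never_straight x} ->
  {in S &, forall x y, never_straight (x^-1 * y)} ->
  exists p, {in S, forall x, (len (x ^ p) <= gap + 2)%N}.
Proof.
move=> S1 S2.
suff H n p : {in S, forall x, (len (x ^ p) <= n)%N} ->
    exists q, {in S, forall x, (len (x ^ q) <= gap + 2)%N}.
  apply: (H (\max_(x <- S) len (x ^ 1)) 1) => x xS.
  exact: (leq_bigmax_seq (F := fun x => len (x ^ 1))).
elim: n p => [|n IH] p pn; first by exists p => x /pn; lens.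
have [n2|n2] := leqP n.+1 (gap + 2).
  by exists p => x /pn /leq_trans; apply.
have [/IH//|/existsNP[x0 /not_implyP[x0S]]] :=
  pselect {in S, forall x, (len (x ^ p) <= n)%N}.
move=> /negP; rewrite -ltnNge => x0n.
have [y hy] : exists y, hd (x0 ^ p) = [:: y].
  move: x0n; rewrite /hd /len; case: (nf _) => //= a l _; exists a.
  by rewrite take0.
have common x : x \in S -> (gap < len (x ^ p))%N ->
    hd (x ^ p) = [:: y] /\ hd (x ^ p)^-1 = [:: y].
  have hV z : z \in S -> (gap < len (z ^ p))%N -> hd (z ^ p) = hd (z ^ p)^-1.
    move=> zS zl; apply: contrapT => hz; exact: (S1 _ zS p).
  move=> xS xl; have x0l : (gap < len (x0 ^ p))%N by move: x0n n2; lens.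
  suff e : hd (x ^ p) = [:: y] by rewrite -hV.
  rewrite -hy; apply/esym; apply: contrapT => hx; apply: (S2 _ _ x0S xS p).
  by rewrite conjMg conjVg; apply: straight_quotient => //; exact: hV.
apply: (IH (p * ev [:: y])) => x xS; rewrite conjgM.
(* Short elements may grow by 2 under the move, whence the bound [gap + 2]. *)
have [xl|xl] := leqP (len (x ^ p)) gap.
  have := len_conj (x ^ p) (ev [:: y]); have := nf_min [:: y] => /=.
  by move: xl n2; lens.
have [h1 h2] := common _ xS xl.
have [x2|x2] := leqP 2 (len (x ^ p)).
  by have := conj_letter_shorter h1 h2 x2; move: (pn _ xS); lens.
(* A long element of length 1 is the letter y itself, which the move fixes. *)
have {h2} xy : x ^ p = ev [:: y].
  by rewrite -h1 /hd take_oversize ?nfK.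
by rewrite -xy conjgE mulKg; move: x2 n2; lens.
Qed.

Fixpoint words n : seq (seq Sigma) :=
  if n is n'.+1 then [::] :: [seq a :: w | a <- enum Sigma, w <- words n']
  else [:: [::]].

Lemma mem_words n w : (size w <= n)%N -> w \in words n.
Proof.
elim: n w => [|n IH] [|a w] //= wn; rewrite inE /=.
by apply: allpairs_f; [rewrite mem_enum|exact: IH].
Qed.

Definition ball n : seq G := [seq ev w | w <- words n].

Lemma mem_ball n g : (len g <= n)%N -> g \in ball n.
Proof. by move=> gn; rewrite -(nfK g); apply: map_f; exact: mem_words. Qed.

Lemma never_straight_size (S : seq G) : uniq S ->
  {in S, forall x, never_straight x} ->
  {in S &, forall x y, never_straight (x^-1 * y)} ->
  (size S <= size (ball (gap + 2)))%N.
Proof.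
move=> uS S1 S2; have [p hp] := common_center S1 S2.
rewrite -(size_map (fun x => x ^ p)); apply: uniq_leq_size.
  by rewrite map_inj_uniq //; exact: conjg_inj.
by move=> _ /mapP[x xS ->]; apply: mem_ball; exact: hp.
Qed.

(** Otherwise arbitrarily many distinct powers of h could be conjugated simultaneously into one
    fixed ball. *)
Lemma infinite_order_straight h : ~ finite_order h ->
  exists i p, (0 < i)%N /\ straight (h ^+ i ^ p).
Proof.
move=> hinf; apply: contrapT => no.
have nsX i : never_straight (h ^+ i).
  move=> p; case: i => [|i] sp; last by apply: no; exists i.+1, p.
  by case: sp; rewrite expg0 conj1g len1.
have nsV x : never_straight x -> never_straight x^-1.
  by move=> nx p; rewrite conjVg => /straightV; rewrite invgK; exact: nx.
pose S := [seq h ^+ i | i <- iota 0 (size (ball (gap + 2))).+1].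
suff : (size S <= size (ball (gap + 2)))%N by rewrite size_map size_iota ltnn.
apply: never_straight_size.
- by rewrite map_inj_uniq ?iota_uniq //; exact: infinite_order_inj.
- by move=> _ /mapP[i _ ->].
move=> _ _ /mapP[i _ ->] /mapP[j _ ->].
wlog ij : i j / (i <= j)%N.
  move=> W; have [/W//|/ltnW/W/nsV] := leqP i j.
  by rewrite invgM invgK.
have -> : h ^- i * h ^+ j = h ^+ (j - i); last exact: nsX.
by rewrite -{1}(subnKC ij) expgnDr mulKg.
Qed.

Lemma irr_nil : irr [::].
Proof. by apply/size0nil/eqP; rewrite -leqn0 nf_min. Qed.

(** A window of length at most L that starts inside a copy of u ends inside the next copy, and
    geodesics are recognized by such windows. *)
Lemma irr_power u n : irr (u ++ u) -> (L <= (size u).+1)%N ->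
  irr (flatten (nseq n u)).
Proof.
move=> uu uL; elim: n => [|[|n] IH]; first exact: irr_nil.
  by rewrite /= cats0; apply: (@irr_sub [::] _ u).
apply: (nfs_local N) => a l b e lL; change (irr l).
have [ua|au] := leqP (size u) (size a).
  apply: (@irr_sub (drop (size u) a) _ b).
  have := congr1 (drop (size u)) e; rewrite [in LHS]/= drop_size_cat //.
  rewrite drop_cat ltn_neqAle ua andbT; case: eqP => /= [ua'|_ <- //].
  by rewrite ua' subnn drop0 drop_size => <-.
apply: (@irr_sub a _ (drop (size a + size l) (u ++ u))).
rewrite catA (_ : a ++ l = take (size a + size l) (u ++ u)) ?cat_take_drop //.
have := congr1 (take (size a + size l)) e.
rewrite /= !catA takel_cat; last by rewrite size_cat; move: au lL uL; lia.
by move=> ->; rewrite take_size_cat ?size_cat.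
Qed.

(** By uniqueness, the geodesic from q back to 1 visits the vertices of the geodesic from 1 to q in
    reverse order. *)
Lemma nf_rev q i : q * ev (take i (nf q^-1)) = ev (take (len q - i) (nf q)).
Proof.
set j := (len q - i)%N; have q_nf : irr (nf q) := nf_irr q.
have qE : q = ev (take j (nf q)) * ev (drop j (nf q)).
  by rewrite -evM cat_take_drop nfK.
set a := ev (take j _) in qE *; set b := ev (drop j _) in qE *.
have la : len a = j.
  by rewrite len_irr ?size_takel ?leq_subr //; exact: irr_take.
have lb : len b = (len q - j)%N by rewrite len_irr ?size_drop //; exact: irr_drop.
have e : nf q^-1 = nf b^-1 ++ nf a^-1.
  rewrite qE invgM -{1}(nfK b^-1) -{1}(nfK a^-1) -evM; apply: nf_uniq.
  rewrite evM !nfK -invgM -qE lenV size_cat -!/(len _) !lenV la lb.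
  by rewrite subnK // leq_subr.
have [iq|qi] := leqP i (len q).
  have i_b : i = size (nf b^-1).
    by rewrite -/(len _) lenV lb /j subKn.
  by rewrite e {1}i_b take_size_cat // nfK {1}qE mulgK.
rewrite take_oversize; last by rewrite -/(len _) lenV ltnW.
by rewrite nfK mulgV /a /j (eqP (ltnW qi : (_ - _)%N == 0%N)) take0 ev0.
Qed.

Lemma ev_take_drop w i j : ev (take (i + j) w) = ev (take i w) * ev (take j (drop i w)).
Proof. by rewrite takeD evM. Qed.

(* If [0 < t], the geodesic [w] is periodic along the window, and by [irr_power]
   it can be continued to an infinite geodesic translated by [g]. *)
Lemma shift_trivial g w i0 m t : finite_order g -> irr w ->
  (i0 + m + t <= size w)%N -> (3 * L <= m)%N -> (t <= m)%N ->
  (forall i, (i0 <= i <= i0 + m)%N ->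
     g * ev (take i w) = ev (take (i + t) w)) ->
  g = 1.
Proof.
move=> fg iw wt Lm tm shift; have L0 := nfs_pos N.
case: (posnP t) => [t0|t0].
  have /shift : (i0 <= i0 <= i0 + m)%N by lia.
  by rewrite t0 addn0 -{2}(mul1g (ev _)) => /mulIg.
pose r := (L.-1 %/ t).+1; pose R := (r * t)%N.
have rE := divn_eq L.-1 t; have rlt := ltn_pmod L.-1 t0.
have RL : (L <= R)%N by rewrite /R /r mulSn; lia.
have R2 : (2 * R <= m + t)%N.
  rewrite /R /r mulSn; have [tL|tL] := ltnP L.-1 t; last by lia.
  by rewrite divn_small //; lia.
have powz j : (j <= 2 * r)%N ->
    g ^+ j * ev (take i0 w) = ev (take (i0 + j * t) w).
  elim: j => [|j IH] jr; first by rewrite mul1g mul0n addn0.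
  rewrite expgS -mulgA IH ?shift ?(ltnW jr) //.
    by rewrite mulSn -addnA [(t + _)%N]addnC addnA.
  have : (j.+1 * t <= 2 * r * t)%N by rewrite leq_mul2r jr orbT.
  by rewrite -mulnA -/R mulSn; lia.
pose z := ev (take i0 w).
pose u := take R (drop i0 w); pose v := take R (drop (i0 + R) w).
have zu : z * ev u = g ^+ r * z by rewrite powz ?ev_take_drop //; lia.
have zuv : z * ev u * ev v = g ^+ (2 * r) * z.
  by rewrite powz // -mulnA -/R mul2n -addnn addnA -!ev_take_drop.
have iu : irr u by exact/irr_take/irr_drop.
have iv : irr v by exact/irr_take/irr_drop.
(* Both geodesics evaluate to the conjugate of g^r by z. *)
have euv : u = v.
  rewrite -iu -iv; congr nf; apply: (mulgI (z * ev u)).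
  by rewrite zuv {1}zu -mulgA zu mulgA -expgnDr addnn mul2n.
have su : size u = R by rewrite size_takel // size_drop; lia.
have iuu : irr (u ++ u).
  rewrite {2}euv /u /v addnC -drop_drop -takeD.
  by apply: irr_take; exact: irr_drop.
have evu n : ev (flatten (nseq n u)) = ev u ^+ n.
  by elim: n => [|n IH] //=; rewrite evM IH expgS.
have [n n0 un] : finite_order (ev u).
  have -> : ev u = (g ^+ r) ^ z by rewrite conjgE -zu mulKg.
  exact/finite_orderJ/finite_orderX.
have /len_irr : irr (flatten (nseq n u)) by apply: irr_power => //; lia.
rewrite evu un len1 => /esym/eqP; rewrite size_eq0 => /eqP fl.
case: n n0 fl {un} => //= n _; case: (u) su => //= /esym; lia.
Qed.

(** The hypotheses say that g moves both 1 and q by at most r. If q is far away, the geodesic from 1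
    to q and its translate by g run together in the middle, where g acts as a shift; this is
    excluded by [shift_trivial]. *)
Lemma torsion_overlap g q r : g <> 1 -> finite_order g ->
  (len g <= r)%N -> (len (g ^ q) <= r)%N -> (len q < r + gap + maxn r (3 * L))%N.
Proof.
move=> g1 fg gr gqr; rewrite ltnNge; apply/negP => big_q.
pose D := len q; pose E := len (g * q); pose m := maxn r (3 * L).
have ED : (E <= r + D)%N by apply: leq_trans (lenM _ _) _; rewrite leq_add2r.
have DE : (D <= r + E)%N.
  by rewrite -[D]/(len q) -(mulKg g q); apply: leq_trans (lenM _ _) _; rewrite lenV leq_add2r.
(* The largest k for which [prefix_gap] forces agreement of the prefixes of length k, both from 1
   and backwards from the far ends. *)
pose k := (D + E + 1 - r - gap)./2.
have k1 : (2 * k + r + gap <= D + E + 1)%N by rewrite /k; lia.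
have k2 : (D + E <= 2 * k + r + gap)%N by rewrite /k; lia.
have kD : (k <= D)%N by lia.
have kE : (k <= E)%N by lia.
have e1 : take k (nf q) = take k (nf (g * q)).
  apply: contrapT => /prefix_gap.
  have -> : q^-1 * (g * q) = g ^ q by [].
  by rewrite -/D -/E; move: gqr k1; lens.
have e2 : take k (nf (g * q)^-1) = take k (nf q^-1).
  apply: contrapT => /prefix_gap; rewrite invgK mulgK !lenV -/D -/E.
  by move: gr k1; lens.
(* The geodesic of g q starts like that of q and ends like the translate of that of q; where both
   descriptions apply, positions differ by D - E. *)
have coincide i : (E - k <= i <= k)%N ->
    ev (take i (nf q)) = g * ev (take (D - (E - i)) (nf q)).
  move=> ik; have -> : take i (nf q) = take i (nf (g * q)).
    by rewrite -(@take_takel _ i k) ?e1 ?take_takel //; lia.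
  have -> : i = (E - (E - i))%N by lia.
  have jk : (E - i <= k)%N by lia.
  rewrite -nf_rev -(@take_takel _ (E - i) k) // e2 take_takel //.
  by rewrite -mulgA nf_rev; congr (g * ev (take _ _)); lia.
have [le_ED|le_DE] := leqP E D.
  apply: g1; apply: invg_inj; rewrite invg1.
  apply: (@shift_trivial g^-1 (nf q) (E - k) m (D - E)).
  - exact: finite_orderV.
  - exact: nf_irr.
  - by rewrite -/(len q) -/D; lia.
  - by rewrite leq_maxr.
  - by rewrite leq_max; apply/orP; left; lia.
  move=> i ik; rewrite coincide ?mulKg; last by lia.
  by congr (ev (take _ _)); lia.
apply: g1; apply: (@shift_trivial g (nf q) (D - k) m (E - D)) => //.
- exact: nf_irr.
- by rewrite -/(len q) -/D; lia.
- by rewrite leq_maxr.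
- by rewrite leq_max; apply/orP; left; lia.
move=> i ik; rewrite (@coincide (i + (E - D))%N); last by lia.
by congr (g * ev (take _ _)); lia.
Qed.

(** Otherwise g would move every power of h by the same distance [len g], and [torsion_overlap]
    would confine these powers to a ball. *)
Lemma torsion_not_commute (h g : G) : ~ finite_order h -> finite_order g -> g <> 1 ->
  ~ commute h g.
Proof.
move=> hinf fg g1 hg.
pose B := (len g + gap + maxn (len g) (3 * L))%N.
have hB n : h ^+ n \in ball B.
  apply/mem_ball/ltnW/(torsion_overlap g1 fg) => //.
  by rewrite conjgE (commuteX n (commute_sym hg)) mulKg.
pose S := [seq h ^+ i | i <- iota 0 (size (ball B)).+1].
suff : (size S <= size (ball B))%N by rewrite size_map size_iota ltnn.
apply: uniq_leq_size; last by move=> _ /mapP[i _ ->].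
by rewrite map_inj_uniq ?iota_uniq //; exact: infinite_order_inj.
Qed.

End Geometry.

Lemma finite_set_not_inj (U : Type) (K : set U) (f : nat -> U) :
  finite_set K -> (forall n, K (f n)) -> ~ injective f.
Proof.
move=> fK fn inj_f; apply: infinite_nat.
rewrite (_ : setT = f @^-1` K); last by apply/seteqP; split=> // n _; exact: fn.
by apply: finite_preimage => // x y _ _; exact: inj_f.
Qed.

(** * Finite subgroups *)

Section Subgroups.
Variable G : groupType.

Definition subgroup (K : set G) := K 1 /\ forall x y, K x -> K y -> K (x * y^-1).

Lemma subgroupP (K : set G) : group_closed [in K] <-> subgroup K.
Proof.
have inK x : x \in [in K] <-> K x by rewrite unfold_in /= in_setE.
split=> -[K1 KF]; split; try exact/inK.
  by move=> x y Kx Ky; apply/inK/KF; apply/inK.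
by move=> x y /inK Kx /inK Ky; apply/inK/KF.
Qed.

Lemma subgroupV K x : subgroup K -> K x -> K x^-1.
Proof. by move=> [K1 KF] /(KF _ _ K1); rewrite mul1g. Qed.

Lemma subgroupM K x y : subgroup K -> K x -> K y -> K (x * y).
Proof.
by move=> sK Kx /(subgroupV sK) Ky; rewrite -[y]invgK; apply: sK.2.
Qed.

Lemma subgroupX K x n : subgroup K -> K x -> K (x ^+ n).
Proof.
move=> sK Kx; elim: n => [|n IH]; first exact: sK.1.
by rewrite expgS; exact: subgroupM.
Qed.

Lemma subgroupJ K x y : subgroup K -> K x -> K y -> K (x ^ y).
Proof.
move=> sK Kx Ky; apply: (subgroupM sK (subgroupV sK Ky)).
exact: (subgroupM sK Kx Ky).
Qed.

Definition conj_subgroup (K : set G) h : set G := [set x | K (x ^ h)].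

Lemma subgroup_conj K h : subgroup K -> subgroup (conj_subgroup K h).
Proof.
move=> sK; split; first by rewrite /conj_subgroup /= conj1g; exact: sK.1.
by move=> x y /= Kx Ky; rewrite /conj_subgroup /= conjMg conjVg; exact: sK.2.
Qed.

Lemma finite_conj K h : finite_set K -> finite_set (conj_subgroup K h).
Proof.
move=> fK; apply: (@sub_finite_set _ _ ((fun x => x ^ h^-1) @` K)).
  by move=> x Kx; exists (x ^ h) => //; rewrite conjgK.
exact: finite_image.
Qed.

Lemma finite_subgroupP (K : set G) : finite_subgroup K <-> finite_set K /\ subgroup K.
Proof. by rewrite /finite_subgroup subgroupP. Qed.

Lemma finite_subgroup_torsion K x : finite_set K -> subgroup K -> K x -> finite_order x.
Proof.
move=> fK sK Kx; apply: contrapT => /infinite_order_inj.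
by apply: (finite_set_not_inj fK) => n; exact: subgroupX.
Qed.

End Subgroups.

(** * Finiteness of torsion subgroups and merging of finite subgroups *)

Section TorsionSubgroups.
Variables (G : groupType) (Sigma : finType) (L : nat).
Variables (ev : seq Sigma -> G) (nf : G -> seq Sigma).
Hypothesis N : nf_system L ev nf.
Local Notation len := (len nf).
Local Notation gap := (gap L).
Let nfK g : ev (nf g) = g := nfs_K N g.

Lemma torsion_subset_center (S : set G) : finite_set S ->
  (forall x, S x -> finite_order x) ->
  (forall x y, S x -> S y -> finite_order (x^-1 * y)) ->
  exists p, forall x, S x -> (len (x ^ p) <= gap + 2)%N.
Proof.
move=> /finite_seqP[s ->] S1 S2.
have [||p hp] := common_center N (S := s).
- by move=> x xs; apply: (finite_never_straight N); exact: S1.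
- by move=> x y xs ys; apply: (finite_never_straight N); exact: S2.
by exists p.
Qed.

Lemma torsion_subgroup_size (K : set G) (s : seq G) : subgroup K ->
  (forall x, K x -> finite_order x) -> uniq s -> [set` s] `<=` K ->
  (size s <= size (ball ev (gap + 2)))%N.
Proof.
move=> sK tK us sub_s; apply: (never_straight_size N us).
  by move=> x /sub_s Kx; apply: (finite_never_straight N); exact: tK.
move=> x y /sub_s Kx /sub_s Ky; apply: (finite_never_straight N); apply: tK.
by apply: (subgroupM _ _ Ky) => //; exact: subgroupV.
Qed.

Lemma torsion_subgroup_finite (K : set G) : subgroup K ->
  (forall x, K x -> finite_order x) -> finite_set K.
Proof.
move=> sK tK; apply: contrapT.
move=> /(infinite_set_fset (size (ball ev (gap + 2))).+1)[B BK].
by rewrite ltnNge (torsion_subgroup_size sK tK (fset_uniq B) BK).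
Qed.

(** The size of a ball bounds the order of every finite subgroup, so one of largest order above K
    exists. *)
Lemma maximal_finite_exists (K : set G) : finite_subgroup K ->
  exists2 M, maximal_finite_subgroup M & K `<=` M.
Proof.
move=> /finite_subgroupP[fK sK].
pose P n := `[< exists M, [/\ finite_subgroup M, K `<=` M & #|` fset_set M| = n] >].
have exP : exists n, P n.
  exists #|` fset_set K|; apply/asboolP; exists K; split=> //.
  exact/finite_subgroupP.
have ubP n : P n -> (n <= size (ball ev (gap + 2)))%N.
  move=> /asboolP[M [/finite_subgroupP[fM sM] _ <-]].
  apply: (torsion_subgroup_size sM _ (fset_uniq _)).
    by move=> x; exact: finite_subgroup_torsion.
  by move=> x; rewrite /= in_fset_set // in_setE.
have [n /asboolP[M [MF KM Mn]] maxn] := ex_maxnP exP ubP.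
exists M => //; split=> // M' M'F MM'; apply/esym.
have [fM sM] := (finite_subgroupP _).1 MF.
have [fM' sM'] := (finite_subgroupP _).1 M'F.
apply: fset_set_inj => //; apply/eqP; rewrite eqEfcard.
apply/andP; split; first by rewrite -fset_set_sub.
rewrite Mn; apply: maxn; apply/asboolP.
by exists M'; split=> //; exact: subset_trans MM'.
Qed.

Hypothesis short_transitive :
  transitive_on [set g | nontrivial_torsion g /\ (len g <= 11 * L)%N]
    (@torsion_rel G).

Lemma short_transitive_at z x g y :
  x <> 1 -> g <> 1 -> y <> 1 -> finite_order x -> finite_order g -> finite_order y ->
  (len (x ^ z) <= 11 * L)%N -> (len (g ^ z) <= 11 * L)%N ->
  (len (y ^ z) <= 11 * L)%N ->
  finite_order (x * g) -> finite_order (g * y) -> finite_order (x * y).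
Proof.
move=> x1 g1 y1 fx fg fy lx lg ly xg gy.
have nt u : u <> 1 -> finite_order u -> nontrivial_torsion (u ^ z).
  by move=> u1 fu; split; [move/eqP; rewrite conjg_eq1 => /eqP|exact: finite_orderJ].
apply: (@finite_orderJV _ _ z); rewrite conjMg.
apply: (short_transitive (a := x ^ z) (b := g ^ z)).
- by split=> //; exact: nt.
- by split=> //; exact: nt.
- by split=> //; exact: nt.
- by rewrite /torsion_rel -conjMg; exact: finite_orderJ.
- by rewrite /torsion_rel -conjMg; exact: finite_orderJ.
Qed.

(* Squaring preserves this property, so that the union of the iterated squares
   of [S] is a torsion subgroup, hence finite. *)
Definition mergeable (g : G) (S : set G) := [/\ finite_set S, S 1, S g,
  forall x, S x -> S x^-1 & forall x y, S x -> S y -> finite_order (x * y)].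

Definition square (S : set G) : set G := [set x * y | x in S & y in S].

(** At an almost fixed point of S the products of two elements are still short enough for (4). A
    product x y is related to g through y^-1, and two products are related through g. *)
Lemma mergeable_square g S : g <> 1 -> mergeable g S -> mergeable g (square S).
Proof.
move=> g1 [fS S1 Sg SV SM].
have St x : S x -> finite_order x by move=> Sx; rewrite -[x]mulg1; exact: SM.
have [x y Sx Sy|p hp] := torsion_subset_center fS St.
  by apply: SM => //; exact: SV.
have short x : S x -> (len (x ^ p) <= 11 * L)%N.
  by move=> /hp; have := nfs_pos N; rewrite /gap; lia.
have short2 x y : S x -> S y -> (len ((x * y) ^ p) <= 11 * L)%N.
  move=> /hp hx /hp hy; rewrite conjMg; apply: leq_trans (lenM N _ _) _.
  by have := nfs_pos N; move: hx hy; rewrite /gap; lia.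
have rel_g z : square S z -> z <> 1 -> finite_order (z * g).
  move=> [x Sx [y Sy <-]] xy1.
  have [->|/eqP y1] := eqVneq y 1; first by rewrite mulg1; exact: SM.
  apply: (@short_transitive_at p _ y^-1) => //.
  - by move=> /(congr1 inv); rewrite invgK invg1.
  - exact: SM.
  - exact/St/SV.
  - exact: St.
  - exact: short2.
  - exact/short/SV.
  - exact: short.
  - by rewrite mulgK; exact: St.
  - by apply: SM => //; exact: SV.
split.
- exact: finite_image2.
- by exists 1 => //; exists 1 => //; rewrite mulg1.
- by exists 1 => //; exists g => //; rewrite mul1g.
- move=> _ [x Sx [y Sy <-]]; rewrite invgM; exists y^-1; first exact: SV.
  by exists x^-1 => //; exact: SV.
move=> u v Su Sv; have [x Sx [y Sy xyu]] := Su; have [x' Sx' [y' Sy' xyv]] := Sv.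
have [u1|/eqP u1] := eqVneq u 1.
  by rewrite u1 mul1g -xyv; exact: SM.
have [v1|/eqP v1] := eqVneq v 1.
  by rewrite v1 mulg1 -xyu; exact: SM.
apply: (@short_transitive_at p _ g) => //.
- by rewrite -xyu; exact: SM.
- exact: St.
- by rewrite -xyv; exact: SM.
- by rewrite -xyu; exact: short2.
- exact: short.
- by rewrite -xyv; exact: short2.
- exact: rel_g.
- by apply: finite_order_mulC; exact: rel_g.
Qed.

Lemma mergeable_subgroup g S : g <> 1 -> mergeable g S ->
  exists K, finite_subgroup K /\ S `<=` K.
Proof.
move=> g1 mS; pose Sn n := iter n square S.
have mSn n : mergeable g (Sn n).
  by elim: n => //= n IH; exact: mergeable_square.
have sub1 n : Sn n `<=` Sn n.+1.
  move=> x Sx; exists x => //; exists 1; last by rewrite mulg1.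
  by have [] := mSn n.
have subn m n : (m <= n)%N -> Sn m `<=` Sn n.
  move=> /subnK <-; elim: (n - m)%N => [|k IH] //.
  exact: subset_trans (sub1 _).
pose K : set G := [set x | exists n, Sn n x].
have sK : subgroup K.
  split; first by exists 0%N; have [] := mS.
  move=> x y [m Sx] [n Sy]; exists (maxn m n).+1.
  exists x; first exact: subn (leq_maxl _ _) _ Sx.
  exists y^-1 => //; have [_ _ _ SV _] := mSn (maxn m n); apply: SV.
  exact: subn (leq_maxr _ _) _ Sy.
exists K; split; last by move=> x Sx; exists 0%N.
apply/finite_subgroupP; split=> //; apply: torsion_subgroup_finite => // x [n Sx].
by have [_ S1 _ _ SM] := mSn n; rewrite -[x]mulg1; exact: SM.
Qed.

(* Both subgroups have almost fixed points; by [torsion_overlap] these are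
   close together, so that both subgroups are short at the midpoint. *)
Lemma merge_finite_subgroups (M M' : set G) g : finite_subgroup M -> finite_subgroup M' ->
  M g -> M' g -> g <> 1 ->
  exists K, [/\ finite_subgroup K, M `<=` K & M' `<=` K].
Proof.
move=> /finite_subgroupP[fM sM] /finite_subgroupP[fM' sM'] Mg M'g g1.
have center K : finite_set K -> subgroup K ->
    exists p, forall x, K x -> (len (x ^ p) <= gap + 2)%N.
  move=> fK sK; apply: torsion_subset_center => // [x|x y Kx Ky].
    exact: finite_subgroup_torsion.
  apply: (finite_subgroup_torsion fK sK).
  by apply: (subgroupM _ _ Ky) => //; exact: subgroupV.
have [p hp] := center _ fM sM; have [q hq] := center _ fM' sM'.
have fg : finite_order g := finite_subgroup_torsion fM sM Mg.
pose d := p^-1 * q; have L0 := nfs_pos N.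
have ld : (len d < gap + 2 + gap + maxn (gap + 2) (3 * L))%N.
  apply: (torsion_overlap N (g := g ^ p)).
  - by move/eqP; rewrite conjg_eq1 => /eqP.
  - exact: finite_orderJ.
  - exact: hp.
  - by rewrite -conjgM mulVKg; exact: hq.
pose i := (len d)./2; pose a := ev (take i (nf d)); pose b := ev (drop i (nf d)).
have dE : d = a * b by rewrite -(nfs_cat N) cat_take_drop nfK.
have la : (len a <= i)%N.
  by apply: leq_trans (nfs_min N _) _; rewrite size_take; case: ltnP.
have lb : (len b <= len d - i)%N.
  by apply: leq_trans (nfs_min N _) _; rewrite size_drop.
pose z := p * a; have zE : z = q * b^-1.
  by apply: (mulIg b); rewrite mulgVK -mulgA -dE mulVKg.
(* Moving the base point by half of d costs at most [len d + 1], in addition to [gap + 2]. *)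
have sh x : M x \/ M' x -> (len (x ^ z) <= 11 * L)%N.
  case=> [/hp|/hq] h.
    rewrite conjgM; apply: leq_trans (len_conj N _ _) _.
    by move: h la ld; rewrite /i /gap; lia.
  rewrite zE conjgM; apply: leq_trans (len_conj N _ _) _; rewrite (lenV N).
  by move: h lb ld; rewrite /i /gap; lia.
have tor x : M x \/ M' x -> finite_order x.
  by case; exact: finite_subgroup_torsion.
have mixed x y : M x -> M' y -> finite_order (x * y).
  move=> Mx M'y.
  have [->|/eqP x1] := eqVneq x 1; first by rewrite mul1g; apply: tor; right.
  have [->|/eqP y1] := eqVneq y 1; first by rewrite mulg1; apply: tor; left.
  apply: (@short_transitive_at z _ g) => //.
  - by apply: tor; left.
  - by apply: tor; right.
  - by apply: sh; left.
  - by apply: sh; left.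
  - by apply: sh; right.
  - by apply: tor; left; exact: subgroupM.
  - by apply: tor; right; exact: subgroupM.
have [|K [KF MK]] := @mergeable_subgroup g (M `|` M') g1.
  split.
  - by rewrite finite_setU.
  - by left; exact: sM.1.
  - by left.
  - by move=> x [Mx|Mx]; [left|right]; exact: subgroupV.
  move=> x y [Mx|Mx] [My|My].
  - by apply: tor; left; exact: subgroupM.
  - exact: mixed.
  - by apply: finite_order_mulC; exact: mixed.
  - by apply: tor; right; exact: subgroupM.
by exists K; split=> // x Mx; apply: MK; [left|right].
Qed.

(** Two maximal finite subgroups through g lie in a common finite subgroup, hence both equal it. *)
Lemma unique_maximal_finite g : nontrivial_torsion g ->
  exists! M : set G, maximal_finite_subgroup M /\ M g.
Proof.
move=> [g1 fg]; have [n n0 gn] := fg.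
pose C : set G := [set x | exists k, x = g ^+ k].
have gV k : exists j, (g ^+ k)^-1 = g ^+ j.
  exists (k * n.-1)%N; apply: mulg1_eq; rewrite -expgnDr -mulnS prednK //.
  by rewrite mulnC expgnA gn expg1n.
have sC : subgroup C.
  split; first by exists 0%N.
  move=> _ _ [i ->] [j ->]; have [k ->] := gV j.
  by exists (i + k)%N; rewrite expgnDr.
have tC x : C x -> finite_order x by move=> [k ->]; exact: finite_orderX.
have CF : finite_subgroup C.
  by apply/finite_subgroupP; split=> //; exact: torsion_subgroup_finite.
have Cg : C g by exists 1%N; rewrite expg1.
have [M Mmax CM] := maximal_finite_exists CF.
exists M; split; first by split=> //; exact: CM.
move=> M' [[M'F M'max] M'g]; have [MF maxM] := Mmax.
have [K [KF MK M'K]] := merge_finite_subgroups MF M'F (CM _ Cg) M'g g1.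
by rewrite -(maxM K KF MK); exact: M'max.
Qed.

End TorsionSubgroups.

(** * Almost invariant cuts *)

Lemma card_fset_set_seq (U : choiceType) (X : set U) (s : seq U) : finite_set X ->
  uniq s -> (forall x, x \in s <-> X x) -> #|` fset_set X| = size s.
Proof.
move=> fX us sX; apply/perm_size/uniq_perm => // x.
by apply/idP/idP; rewrite in_fset_set // in_setE; [move/sX|move/(sX _).1].
Qed.

(* [f] is lexicographically at most [g]. *)
Definition lexle (f g : nat -> nat) :=
  forall i, (forall j, (j < i)%N -> f j = g j) -> (f i <= g i)%N.

Lemma lexle_refl f : lexle f f. Proof. by []. Qed.

Lemma lexle_trans f g h : lexle f g -> lexle g h -> lexle f h.
Proof.
move=> fg gh i fh.
have fgi j : (j < i)%N -> f j = g j.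
  have [n] := ubnP j; elim: n j => // n IH j jn ji.
  have fgj : (f j <= g j)%N by apply: fg => l lj; apply: IH; lia.
  have ghj : (g j <= h j)%N.
    by apply: gh => l lj; rewrite -IH ?fh //; lia.
  by apply/eqP; rewrite eqn_leq fgj (fh _ ji).
apply: (leq_trans (fg i fgi)); apply: gh => j ji.
by rewrite -fgi // fh.
Qed.

Lemma lexle_total f g : lexle f g \/ lexle g f.
Proof.
have [|/existsNP[i /not_implyP[eq_i /negP]]] := pselect (lexle f g); first by left.
rewrite -ltnNge => gf; right => j eq_j.
have [ij|ji|<-] := ltngtP i j; [|by rewrite eq_i|exact: ltnW].
by rewrite (eq_j _ ij) ltnn in gf.
Qed.

(** Minima are taken over finite lists because infinite sequences can descend forever
    lexicographically. *)
Lemma lexle_min (U : eqType) (w : U -> nat -> nat) (P : U -> Prop) (s : seq U) :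
  (exists2 x, x \in s & P x) ->
  exists x, P x /\ forall y, y \in s -> P y -> lexle (w x) (w y).
Proof.
suff [no|[x [xs Px xmin]] _] : (forall x, x \in s -> ~ P x) \/
    exists x, [/\ x \in s, P x & forall y, y \in s -> P y -> lexle (w x) (w y)].
- by move=> [x xs /(no _ xs)].
- by exists x.
elim: s => [|a s IH]; first by left.
have [Pa|nPa] := pselect (P a); last first.
  case: IH => [no|[x [xs Px xmin]]].
    by left=> x; rewrite inE => /orP[/eqP->|/no].
  by right; exists x; split=> // [|y]; rewrite inE ?xs ?orbT // => /orP[/eqP->|/xmin].
right; case: IH => [no|[x [xs Px xmin]]].
  exists a; split=> // [|y]; rewrite inE ?eqxx // => /orP[/eqP->|/no//].
  by move=> _; exact: lexle_refl.
have [ax|xa] := lexle_total (w a) (w x).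
  exists a; split=> // [|y]; rewrite inE ?eqxx // => /orP[/eqP-> _|ys Py].
    exact: lexle_refl.
  by apply: lexle_trans ax _; exact: xmin.
exists x; split=> // [|y]; rewrite inE ?xs ?orbT // => /orP[/eqP->//|].
exact: xmin.
Qed.

(** At the first index where a and p or b and q differ, the sum of p and q would be too large. This
    turns optimality into equality in the submodular inequality. *)
Lemma lexle_sum_eq (p q a b : nat -> nat) : lexle a p -> lexle b q ->
  (forall i, (p i + q i <= a i + b i)%N) -> forall i, (p i + q i = a i + b i)%N.
Proof.
move=> ap bq le_sum.
suff H i : a i = p i /\ b i = q i by move=> i; have [-> ->] := H i.
have [n] := ubnP i; elim: n i => // n IH i iN.
have ai : (a i <= p i)%N by apply: ap => j ji; apply: (IH j _).1; lia.
have bi : (b i <= q i)%N by apply: bq => j ji; apply: (IH j _).2; lia.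
by have := le_sum i; lia.
Qed.

(** * Finitely many connected cuts of bounded size separate two vertices *)

Section TightCuts.
Variable V : choiceType.
Implicit Types (C D : V -> bool) (E : V -> V -> bool).

(* Connectedness in the graph [E], expressed without paths. *)
Definition conn E C := forall D u, C u -> D u ->
  (forall a b, E a b -> C a -> C b -> D a -> D b) -> forall v, C v -> D v.

Definition tight E k u v C := [/\ conn E C, conn E (predC C),
  exists s : seq (V * V), (size s <= k)%N /\
    (forall a b, E a b -> C a -> ~~ C b -> (a, b) \in s), C u & ~~ C v].

Lemma path_crossing E C u p : path E u p -> C u -> ~~ C (last u p) ->
  exists2 e, e \in zip (u :: p) p & [&& E e.1 e.2, C e.1 & ~~ C e.2].
Proof.
elim: p u => [u _ /= ->//|w p IH u /= /andP[uw wp] Cu Cl].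
have [Cw|nCw] := boolP (C w).
  have [e ep eC] := IH w wp Cw Cl.
  by exists e => //; rewrite inE ep orbT.
by exists (u, w); rewrite ?inE ?eqxx //= uw Cu.
Qed.

Definition reach E u w := exists2 p, path E u p & last u p = w.

Lemma reach_step E u a b : E a b -> reach E u a -> reach E u b.
Proof.
by move=> ab [p up pa]; exists (rcons p b); rewrite ?rcons_path ?last_rcons ?up ?pa.
Qed.

(** The cut must be the set reachable from u: connectedness puts C inside this set, and a reachable
    vertex outside C would make v reachable through the connected complement. *)
Lemma finite_tight_unreachable E k u v : ~ reach E u v ->
  finite_set [set C | tight E k u v C].
Proof.
move=> no_uv; pose R w := `[< reach E u w >].
have Rcl C a b : E a b -> C a -> C b -> R a -> R b.
  by move=> ab _ _ /asboolP Ra; apply/asboolP; exact: reach_step ab Ra.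
apply: (@sub_finite_set _ _ [set R]); last exact: finite_set1.
move=> C [Cc Cc' _ Cu Cv]; apply/funext => w; apply/idP/idP => [Cw|Rw].
  by apply: (Cc R u) => //; [apply/asboolP; exists [::]|exact: Rcl].
apply: contrapT => /negP nCw; apply: no_uv; apply/asboolP.
by apply: (Cc' R w) => //; exact: Rcl.
Qed.

(* Induction on [k]: a cut separating the ends of a fixed path contains an edge
   of that path; remove this edge from the graph. *)
Lemma finite_tight E k u v : finite_set [set C | tight E k u v C].
Proof.
elim: k E u v => [|k IH] E u v;
  (have [[p up pv]|/finite_tight_unreachable//] := pselect (reach E u v)).
  rewrite (_ : [set C | _] = set0) //; apply/seteqP; split=> // C.
  move=> [_ _ [s [s0 sC]] Cu Cv].
  have [|[a b] _ /and3P[ab Ca Cb]] := path_crossing up Cu; first by rewrite pv.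
  by have := sC _ _ ab Ca Cb; case: (s) s0.
pose E' (e : V * V) a b := E a b && ((a, b) != e).
apply: (@sub_finite_set _ _
  (\bigcup_(e in [set` zip (u :: p) p]) [set C | tight (E' e) k e.1 e.2 C])).
  move=> C [Cc Cc' [s [sk sC]] Cu Cv].
  have [|e ep /and3P[ab Ca Cb]] := path_crossing up Cu; first by rewrite pv.
  exists e => //; split=> //.
  (* The removed edge joins C to its complement, so both sides stay connected without it. *)
  - move=> D x Cx Dx Dcl; apply: (Cc D x) => // a b Eab Ca' Cb' Da.
    apply: (Dcl a b) => //; rewrite /E' Eab /=; apply/eqP => abe.
    by move: Cb; rewrite -abe /= Cb'.
  - move=> D x Cx Dx Dcl; apply: (Cc' D x) => // a b Eab Ca' Cb' Da.
    apply: (Dcl a b) => //; rewrite /E' Eab /=; apply/eqP => abe.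
    by move: Ca; rewrite -abe /=; apply/negP.
  exists (rem e s); split.
    rewrite size_rem; last by case: (e) ab Ca Cb => a b /=; exact: sC.
    by rewrite -subn1 leq_subLR add1n.
  by move=> a b /andP[Eab abe] Ca' Cb'; apply: rem_mem => //; exact: sC.
by apply: bigcup_finite => // e _; exact: IH.
Qed.
End TightCuts.

(** * Coboundaries, weights and limits at the ends of an element *)

Section Translates.
Variable G : groupType.
Implicit Types (C D : G -> bool) (g h x : G).

Definition trans g C : G -> bool := fun u => C (g^-1 * u).
Definition compl C : G -> bool := fun u => ~~ C u.

Lemma trans1 C : trans 1 C = C.
Proof. by apply/funext => u; rewrite /trans invg1 mul1g. Qed.

Lemma transM g h C : trans (g * h) C = trans g (trans h C).
Proof. by apply/funext => u; rewrite /trans invgM mulgA. Qed.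

Lemma transK g C : trans g^-1 (trans g C) = C.
Proof. by rewrite -transM mulVg trans1. Qed.

Lemma transVK g C : trans g (trans g^-1 C) = C.
Proof. by rewrite -transM mulgV trans1. Qed.

Lemma complK C : compl (compl C) = C.
Proof. by apply/funext => u; rewrite /compl negbK. Qed.

Lemma trans_compl g C : trans g (compl C) = compl (trans g C).
Proof. by []. Qed.

Definition cobd C x : set G := [set u | C u != C (u * x)].
Definition almost_inv C := forall x, finite_set (cobd C x).
Definition weight C x := #|` fset_set (cobd C x)|.

Lemma cobd_compl C x : cobd (compl C) x = cobd C x.
Proof. by apply/seteqP; split=> u; rewrite /cobd /compl /= (inj_eq negb_inj). Qed.

Lemma weight_compl C x : weight (compl C) x = weight C x.
Proof. by rewrite /weight cobd_compl. Qed.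

Lemma almost_inv_compl C : almost_inv C -> almost_inv (compl C).
Proof. by move=> fC x; rewrite cobd_compl. Qed.

Lemma cobd_trans g C x u : cobd (trans g C) x u <-> cobd C x (g^-1 * u).
Proof. by rewrite /cobd /trans /= mulgA. Qed.

Lemma almost_inv_trans g C : almost_inv C -> almost_inv (trans g C).
Proof.
move=> fC x; rewrite (_ : cobd _ x = mul g^-1 @^-1` cobd C x).
  by apply: finite_preimage (fC x) => u v _ _; exact: mulgI.
by apply/seteqP; split=> u; [move/cobd_trans|move=> uC; exact/cobd_trans].
Qed.

Lemma weight_trans g C x : almost_inv C -> weight (trans g C) x = weight C x.
Proof.
move=> fC; rewrite {2}/weight -(size_map (mul g)).
apply: card_fset_set_seq; first exact: almost_inv_trans.
  by rewrite map_inj_uniq ?fset_uniq //; exact: mulgI.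
move=> u; split=> [/mapP[v]|/cobd_trans uC].
  by rewrite in_fset_set // in_setE => vC ->; apply/cobd_trans; rewrite mulKg.
apply/mapP; exists (g^-1 * u); last by rewrite mulVKg.
by rewrite in_fset_set // in_setE.
Qed.

(* For almost invariant [C] and [h] of infinite order, either [C] or its
   complement contains almost all positive powers of [h]. *)
Definition limit C h := `[< exists N, forall n, (N <= n)%N -> C (h ^+ n) >].

Lemma finite_eventually_not (X : set G) h p : finite_set X -> ~ finite_order h ->
  exists N, forall n, (N <= n)%N -> ~ X (h ^+ n * p).
Proof.
move=> fX hinf; have fY : finite_set [set n | X (h ^+ n * p)].
  apply: (@finite_preimage _ _ X (fun n => h ^+ n * p)) => // m n _ _ /mulIg.
  exact: infinite_order_inj.
have [s Y] := (finite_seqP _).1 fY; exists (\max_(i <- s) i).+1 => n.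
move=> sn Xn; have : n \in s by have : [set` s] n by rewrite -Y.
by move=> /(leq_bigmax_seq (F := id)) /(_ isT); rewrite leqNgt sn.
Qed.

(** Only finitely many points h^n are separated by C from the next one or from the parallel point
    h^n p, so any parallel ray computes the limit. *)
Lemma limitP C h p : almost_inv C -> ~ finite_order h ->
  exists N, forall n, (N <= n)%N -> C (h ^+ n * p) = limit C h.
Proof.
move=> fC hinf.
have [N1 N1P] := finite_eventually_not p (fC (p^-1)) hinf.
have [N2 N2P] := finite_eventually_not 1 (fC h) hinf.
have step n : (N2 <= n)%N -> C (h ^+ n) = C (h ^+ n.+1).
  by move=> /N2P; rewrite /cobd /= mulg1 -expgSr => /negP; rewrite negbK => /eqP.
have eqp n : (N1 <= n)%N -> C (h ^+ n * p) = C (h ^+ n).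
  by move=> /N1P; rewrite /cobd /= mulgK => /negP; rewrite negbK => /eqP.
have const n : (N2 <= n)%N -> C (h ^+ n) = C (h ^+ N2).
  by move=> /subnK <-; elim: (n - N2)%N => // k IH; rewrite addSn -step ?IH ?leq_addl.
exists (maxn N1 N2) => n; rewrite geq_max => /andP[n1 n2].
rewrite eqp // const //; apply/idP/asboolP => [CN|[N CN]].
  by exists N2 => m /const ->.
by rewrite -(const (maxn N N2)) ?leq_maxr //; apply: CN; rewrite leq_maxl.
Qed.

Lemma limit_frequently C h p b : almost_inv C -> ~ finite_order h ->
  (forall N, exists2 n, (N <= n)%N & C (h ^+ n * p) = b) -> limit C h = b.
Proof.
move=> fC hinf H; have [N NP] := limitP p fC hinf.
by have [n /NP <-] := H N.
Qed.

Lemma limit_compl C h : almost_inv C -> ~ finite_order h ->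
  limit (compl C) h = ~~ limit C h.
Proof.
move=> fC hinf; have [N NP] := limitP 1 fC hinf.
apply: (limit_frequently (p := 1) (almost_inv_compl fC)) => // n.
by exists (maxn N n); rewrite ?leq_maxr // /compl NP ?leq_maxl.
Qed.

Lemma limit_sub C D h : (forall u, C u -> D u) -> limit C h -> limit D h.
Proof.
move=> CD /asboolP[N CN]; apply/asboolP; exists N => n /CN; exact: CD.
Qed.

Definition cutI C D : G -> bool := fun u => C u && D u.
Definition cutU C D : G -> bool := fun u => C u || D u.

Lemma almost_invI C D : almost_inv C -> almost_inv D -> almost_inv (cutI C D).
Proof.
move=> fC fD x; apply: (@sub_finite_set _ _ (cobd C x `|` cobd D x)).
  move=> u; rewrite /cobd /cutI /setU /=.
  by case: (C u) (D u) (C (u * x)) (D (u * x)) => [] [] [] [] //=; by [left|right].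
by rewrite finite_setU.
Qed.

Lemma almost_invU C D : almost_inv C -> almost_inv D -> almost_inv (cutU C D).
Proof.
move=> fC fD x; apply: (@sub_finite_set _ _ (cobd C x `|` cobd D x)).
  move=> u; rewrite /cobd /cutU /setU /=.
  by case: (C u) (D u) (C (u * x)) (D (u * x)) => [] [] [] [] //=; by [left|right].
by rewrite finite_setU.
Qed.

Lemma limitI C D h : almost_inv C -> almost_inv D -> ~ finite_order h ->
  limit (cutI C D) h = limit C h && limit D h.
Proof.
move=> fC fD hinf; have [N NP] := limitP 1 fC hinf; have [M MP] := limitP 1 fD hinf.
apply: (limit_frequently (p := 1) (almost_invI fC fD)) => // n.
exists (maxn N (maxn M n)); first by rewrite !leq_max leqnn !orbT.
by rewrite /cutI NP ?leq_maxl // MP // !leq_max leqnn orbT.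
Qed.

Lemma limitU C D h : almost_inv C -> almost_inv D -> ~ finite_order h ->
  limit (cutU C D) h = limit C h || limit D h.
Proof.
move=> fC fD hinf; have [N NP] := limitP 1 fC hinf; have [M MP] := limitP 1 fD hinf.
apply: (limit_frequently (p := 1) (almost_invU fC fD)) => // n.
exists (maxn N (maxn M n)); first by rewrite !leq_max leqnn !orbT.
by rewrite /cutU NP ?leq_maxl // MP // !leq_max leqnn orbT.
Qed.

Lemma limit_trans g C h : almost_inv C -> ~ finite_order h ->
  limit (trans g C) (h ^ g^-1) = limit C h.
Proof.
move=> fC hinf; have [N NP] := limitP g^-1 fC hinf.
apply: (@limit_frequently (trans g C) (h ^ g^-1) 1); first exact: almost_inv_trans.
  by move=> /finite_orderJV.
move=> n; exists (maxn N n); rewrite ?leq_maxr //.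
by rewrite /trans -conjXg conjgE invgK mulg1 !mulgA mulVg mul1g NP ?leq_maxl.
Qed.

Definition splits C h := limit C h != limit C h^-1.

Lemma infinite_orderV h : ~ finite_order h -> ~ finite_order h^-1.
Proof. by move=> hinf /finite_orderV; rewrite invgK. Qed.

Lemma splits_compl C h : almost_inv C -> ~ finite_order h ->
  splits C h -> splits (compl C) h.
Proof.
move=> fC hinf; rewrite /splits !limit_compl //; last exact: infinite_orderV.
by rewrite (inj_eq negb_inj).
Qed.

Lemma splits_trans g C h : almost_inv C -> ~ finite_order h ->
  splits C h -> splits (trans g C) (h ^ g^-1).
Proof.
move=> fC hinf; rewrite /splits -conjVg !limit_trans //; exact: infinite_orderV.
Qed.

Lemma splits_nontrivial C h : splits C h -> (exists u, C u) /\ (exists u, ~~ C u).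
Proof.
rewrite /splits => Ch; split; apply: contrapT => no; move/eqP: Ch; apply.
  have nC u : C u = false by apply/negP => Cu; apply: no; exists u.
  by rewrite /limit; congr `[< _ >]; apply/propext; split=> -[N /(_ _ (leqnn N))];
     rewrite nC.
have aC u : C u by apply: contrapT => /negP Cu; apply: no; exists u.
by rewrite /limit; congr `[< _ >]; apply/propext; split=> _; exists 0%N.
Qed.

Lemma weight_count C x (X : {fset G}) : cobd C x `<=` [set` X] ->
  weight C x = \sum_(u <- X) (C u != C (u * x)%g).
Proof.
move=> CX; have fC : finite_set (cobd C x) by apply: sub_finite_set CX _; exact: finite_fset.
rewrite -big_mkcond /= sum1_count -size_filter.
apply: card_fset_set_seq => //; first exact/filter_uniq/fset_uniq.
by move=> u; rewrite mem_filter; split=> [/andP[//]|uC]; apply/andP; split=> //; exact: CX.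
Qed.

Definition crossing C D x : set G :=
  [set u | [&& C u, ~~ D u, ~~ C (u * x) & D (u * x)]].

(** The count is made edge by edge. An edge from C \ D to D \ C counts twice on the right and not at
    all on the left, so equality excludes such edges. *)
Lemma weight_submodular C D x : almost_inv C -> almost_inv D ->
  (weight (cutI C D) x + weight (cutU C D) x <= weight C x + weight D x)%N /\
  ((weight (cutI C D) x + weight (cutU C D) x = weight C x + weight D x)%N ->
   crossing C D x = set0).
Proof.
move=> fC fD; pose Y := cobd C x `|` cobd D x.
have fY : finite_set Y by rewrite finite_setU.
have YX u : Y u -> u \in fset_set Y by rewrite in_fset_set // in_setE.
have sI : cobd (cutI C D) x `<=` [set` fset_set Y].
  move=> u uI; apply: YX; move: uI; rewrite /Y /cobd /cutI /setU /=.
  by case: (C u) (D u) (C (u * x)) (D (u * x)) => [] [] [] [] //=; by [left|right].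
have sU : cobd (cutU C D) x `<=` [set` fset_set Y].
  move=> u uI; apply: YX; move: uI; rewrite /Y /cobd /cutU /setU /=.
  by case: (C u) (D u) (C (u * x)) (D (u * x)) => [] [] [] [] //=; by [left|right].
have sC : cobd C x `<=` [set` fset_set Y] by move=> u uC; apply: YX; left.
have sD : cobd D x `<=` [set` fset_set Y] by move=> u uD; apply: YX; right.
rewrite (weight_count sI) (weight_count sU) (weight_count sC) (weight_count sD).
rewrite -!big_split /=.
pose c u : nat := [&& C u, ~~ D u, ~~ C (u * x) & D (u * x)].
have pointwise u : ((cutI C D u != cutI C D (u * x)%g) +
   (cutU C D u != cutU C D (u * x)%g) + c u <=
   (C u != C (u * x)%g) + (D u != D (u * x)%g))%N.
  by rewrite /c /cutI /cutU; case: (C u) (D u) (C (u * x)) (D (u * x)) => [] [] [] [].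
have := @leq_sum _ (fset_set Y) xpredT _ _ (fun u _ => pointwise u).
rewrite big_split /= => le_sum; split; first by apply: leq_trans le_sum; exact: leq_addr.
move=> eq_sum; apply/seteqP; split=> // u uc.
have uY : u \in fset_set Y.
  by apply: YX; left; move: uc; rewrite /crossing /cobd /= => /and4P[-> _ /negPf->].
move: le_sum; rewrite eq_sum -[X in (_ <= X)%N]addn0 leq_add2l leqn0.
rewrite (perm_big _ (perm_to_rem uY)) big_cons /c.
by move: uc; rewrite /crossing /= => ->.
Qed.

End Translates.

(** * Optimal cuts *)

Section OptimalCuts.
Variables (G : groupType) (Sigma : finType) (L : nat).
Variables (ev : seq Sigma -> G) (nf : G -> seq Sigma).
Hypothesis N : nf_system L ev nf.
Implicit Types (C D : G -> bool) (g h u v : G).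

Local Notation gen a := (ev [:: a]).

Definition cayley u v := [exists a : Sigma, v == u * gen a].

(* The coordinate 0 counts the boundary edges of [C] in the Cayley graph; the
   other ones make the submodularity of [wt] strict for crossing cuts. *)
Definition wt C i : nat :=
  if i is j.+1 then weight C (ev (odflt [::] (choice.unpickle j)))
  else \sum_(a : Sigma) weight C (gen a).

Lemma word_gen a w : ev (a :: w) = gen a * ev w.
Proof. exact: (nfs_cat N [:: a] w). Qed.

Lemma almost_inv_gen C : (forall a, finite_set (cobd C (gen a))) -> almost_inv C.
Proof.
move=> fC x; rewrite -(nfs_K N x); elim: (nf x) => [|a w IH].
  rewrite (_ : cobd _ _ = set0) //; apply/seteqP; split=> // u.
  by rewrite (nfs_nil N) /cobd /= mulg1 eqxx.
apply: (@sub_finite_set _ _ (cobd C (gen a) `|` (fun u => u * gen a) @^-1` cobd C (ev w))).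
  move=> u; rewrite word_gen /cobd /= mulgA.
  by case: (C u =P C (u * gen a)) => [->|/eqP]; [right|left].
rewrite finite_setU; split=> //.
by apply: finite_preimage IH => u v _ _; exact: mulIg.
Qed.

Lemma cayley_const C : (forall u v, cayley u v -> C u = C v) -> forall u v, C u = C v.
Proof.
move=> cC u v; suff H w x : C x = C (x * ev w).
  by rewrite (H (nf (u^-1 * v))) (nfs_K N) mulVKg.
elim: w x => [|a w IH] x; first by rewrite (nfs_nil N) mulg1.
rewrite word_gen mulgA -IH; apply: cC.
by apply/existsP; exists a.
Qed.

Lemma cayley_sym u v : cayley u v -> cayley v u.
Proof.
move=> /existsP[a /eqP->]; have [b ab] := nfs_inv N a.
by apply/existsP; exists b; rewrite -mulgA ab mulg1.
Qed.

Lemma wt_compl C : wt (compl C) =1 wt C.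
Proof. by case=> [|i] /=; [apply: eq_bigr => a _|]; rewrite weight_compl. Qed.

Lemma wt_trans g C : almost_inv C -> wt (trans g C) =1 wt C.
Proof.
by move=> fC [|i] /=; [apply: eq_bigr => a _|]; rewrite weight_trans.
Qed.

Lemma wt_submodular C D i : almost_inv C -> almost_inv D ->
  (wt (cutI C D) i + wt (cutU C D) i <= wt C i + wt D i)%N.
Proof.
move=> fC fD; case: i => [|i] /=; last first.
  by have [] := weight_submodular (ev (odflt [::] (choice.unpickle i))) fC fD.
rewrite -!big_split /=; apply: leq_sum => a _.
by have [] := weight_submodular (gen a) fC fD.
Qed.

(** If u lies in C \ D and v in D \ C, the coordinate of [wt] that belongs to u^-1 v is strictly
    submodular. *)
Lemma wt_modular_nested C D : almost_inv C -> almost_inv D ->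
  (forall i, wt (cutI C D) i + wt (cutU C D) i = wt C i + wt D i)%N ->
  (forall u, C u -> D u) \/ (forall u, D u -> C u).
Proof.
move=> fC fD e.
have [|/existsNP[u /not_implyP[Cu nDu]]] := pselect (forall u, C u -> D u); first by left.
have [|/existsNP[v /not_implyP[Dv nCv]]] := pselect (forall u, D u -> C u); first by right.
pose x := u^-1 * v.
have [_] := weight_submodular x fC fD.
have xE : ev (odflt [::] (choice.unpickle (choice.pickle (nf x)))) = x.
  by rewrite choice.pickleK /= (nfs_K N).
have := e (choice.pickle (nf x)).+1; rewrite /= xE => -> // /(_ erefl) c0.
have : crossing C D x u.
  rewrite /crossing /= /x mulVKg Cu Dv andbT /=.
  by apply/andP; split; apply/negP.
by rewrite c0.
Qed.

Lemma boundary_edges C : almost_inv C ->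
  exists s : seq (G * G), (size s <= wt C 0)%N /\
    forall u v, cayley u v -> C u != C v -> (u, v) \in s.
Proof.
move=> fC.
exists (flatten [seq [seq (u, u * gen a) | u <- fset_set (cobd C (gen a))] | a <- enum Sigma]).
split.
  rewrite size_flatten /shape -map_comp sumnE big_map big_enum /=.
  by apply: leq_sum => a _; rewrite size_map.
move=> u v /existsP[a /eqP ->] Cuv; apply/flattenP.
exists [seq (u, u * gen a) | u <- fset_set (cobd C (gen a))].
  by apply/mapP; exists a => //; rewrite mem_enum.
by apply/mapP; exists u => //; rewrite in_fset_set // in_setE.
Qed.

Definition head_cut (s : seq Sigma) : G -> bool := fun u => hd nf u == s.

(** If u and u x start with different letters, [hd_gap] bounds the length of u. *)
Lemma almost_inv_head_cut s : almost_inv (head_cut s).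
Proof.
move=> x; apply: (@sub_finite_set _ _ [set` ball ev (len nf x + gap L)]); last exact: finite_seq.
move=> u ux /=; apply: (mem_ball N).
have /(hd_gap N) : hd nf u <> hd nf (u * x).
  by move=> e; move: ux; rewrite /cobd /head_cut /= e eqxx.
by rewrite mulKg; apply: leq_trans; exact: leq_addr.
Qed.

Definition head_cut_bound := \max_(a : Sigma) wt (head_cut [:: a]) 0.

(** Positive powers of a straight x start with the first letter of x and negative ones with another
    letter, so a head cut separates the ends of x. Here x is conjugate by p to a power of h, so the
    translate by p separates the ends of h. *)
Lemma split_exists h : ~ finite_order h ->
  exists C, [/\ almost_inv C, splits C h & (wt C 0 <= head_cut_bound)%N].
Proof.
move=> hinf; have [i [p [i0 sx]]] := infinite_order_straight N hinf.
set x := _ ^ p in sx; have [xl xh] := sx.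
have [a xa] : exists a, hd nf x = [:: a].
  by move: xl; rewrite /hd /len; case: (nf x) => //= a w _; exists a; rewrite take0.
pose D := head_cut [:: a]; have fD : almost_inv D := @almost_inv_head_cut _.
have fC : almost_inv (trans p D) by exact: almost_inv_trans.
have xpow n : p * x ^+ n = h ^+ (i * n) * p.
  by rewrite /x -conjXg conjgE mulVKg expgnA.
exists (trans p D); split=> //; last first.
  rewrite wt_trans //; exact: (leq_bigmax a).
rewrite /splits (_ : limit _ h = true).
  rewrite (_ : limit _ h^-1 = false) //.
  apply: (@limit_frequently _ _ _ p) => //; first exact: infinite_orderV.
  move=> n; exists (i * n.+1)%N; first by rewrite (leq_trans (leqnSn n)) ?leq_pmull.
  rewrite expVgn -[X in _ * X]invgK -invgM.
  have -> : p^-1 * h ^+ (i * n.+1) = x ^+ n.+1 * p^-1.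
    by apply: (mulgI p); rewrite mulVKg mulgA xpow mulgK.
  rewrite invgM invgK /trans mulKg /D /head_cut -expVgn.
  have [-> _] := straight_pow N n (straightV N sx).
  by apply/eqP => e; apply: xh; rewrite xa e.
apply: (@limit_frequently _ _ _ p) => //.
move=> n; exists (i * n.+1)%N; first by rewrite (leq_trans (leqnSn n)) ?leq_pmull.
rewrite -xpow /trans mulKg /D /head_cut.
by have [-> _] := straight_pow N n sx; rewrite xa eqxx.
Qed.

(* If [D] is closed under adjacency in [C], then [C] is the disjoint union of two
   sets without edges between them, and the one that splits [h] has the whole
   boundary of [C]. *)
Lemma minimal_conn C h : almost_inv C -> ~ finite_order h -> splits C h ->
  (forall D, almost_inv D -> splits D h -> (wt C 0 <= wt D 0)%N) ->
  conn cayley C.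
Proof.
move=> fC hinf Ch minC D u Cu Du Dcl v Cv; apply/idP; apply: contrapT => nDv.
pose C1 := cutI C D; pose C2 := cutI C (compl D).
have cl a b : cayley a b -> C a -> C b -> D a = D b.
  move=> ab Ca Cb; apply/idP/idP; first exact: (Dcl a b).
  by apply: (Dcl b a) => //; exact: cayley_sym.
have cay w x : cayley w (w * gen x) by apply/existsP; exists x.
have sub1 x : cobd C1 (gen x) `<=` cobd C (gen x).
  move=> w; rewrite /cobd /C1 /cutI /= => e; apply/eqP => eC; move: e.
  rewrite -eC; case Cw : (C w) => //=.
  by rewrite (cl w (w * gen x)) ?eqxx // -eC.
have sub2 x : cobd C2 (gen x) `<=` cobd C (gen x).
  move=> w; rewrite /cobd /C2 /cutI /compl /= => e; apply/eqP => eC; move: e.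
  rewrite -eC; case Cw : (C w) => //=.
  by rewrite (cl w (w * gen x)) ?eqxx // -eC.
have f1 : almost_inv C1 by apply: almost_inv_gen => x; exact: sub_finite_set (fC _).
have f2 : almost_inv C2 by apply: almost_inv_gen => x; exact: sub_finite_set (fC _).
have CE w : C w = C1 w || C2 w.
  by rewrite /C1 /C2 /cutI /compl; case: (C w); case: (D w).
have CU : C = cutU C1 C2 by apply/funext => w; exact: CE.
have hinfV := infinite_orderV hinf.
(* By minimality the part that splits h has as many boundary edges as C, hence the same ones. *)
have key D1 : almost_inv D1 -> (forall x, cobd D1 (gen x) `<=` cobd C (gen x)) ->
    splits D1 h -> forall x, cobd D1 (gen x) = cobd C (gen x).
  move=> fD1 sD1 D1h x.
  have le y : (weight D1 (gen y) <= weight C (gen y))%N.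
    rewrite /weight; apply: fsubset_leq_card.
    by rewrite -(fset_set_sub (fD1 _) (fC _)); exact: sD1.
  have eqw : weight D1 (gen x) = weight C (gen x).
    apply/eqP; rewrite eqn_leq le /=; have := minC D1 fD1 D1h; rewrite /wt.
    rewrite (bigD1 x) //= [X in (_ <= X)%N](bigD1 x) //=.
    have := @leq_sum _ (index_enum Sigma) (fun y => y != x) _ _ (fun y _ => le y).
    by lia.
  apply: fset_set_inj => //; apply/eqP; rewrite eqEfcard.
  apply/andP; split; first by rewrite -(fset_set_sub (fD1 _) (fC _)); exact: sD1.
  by rewrite -/(weight _ _) -/(weight _ _) eqw.
(* Each boundary edge of C leaves the part D1, so D2 has no boundary and is constant; being disjoint
   from the nonempty D1, it is empty. *)
have excl D1 D2 : almost_inv D1 -> (forall x, cobd D1 (gen x) `<=` cobd C (gen x)) ->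
    splits D1 h -> (forall w, C w = D1 w || D2 w) -> (forall w, ~~ (D1 w && D2 w)) ->
    (forall x, cobd D2 (gen x) `<=` cobd C (gen x)) -> forall w, ~~ D2 w.
  move=> fD1 sD1 D1h CD12 disj sD2 w.
  have e := key _ fD1 sD1 D1h.
  have [[a D1a] _] := splits_nontrivial D1h.
  have cD2 : forall a b, D2 a = D2 b.
    apply: cayley_const => a' b /existsP[x /eqP->]; apply/eqP.
    apply: contrapT => /negP n2; have := sD2 x a' n2; rewrite -e.
    move: n2 (sD2 x a' n2); rewrite /cobd /= !CD12.
    have := disj a'; have := disj (a' * gen x).
    by case: (D1 a') (D2 a') (D1 (a' * gen x)) (D2 (a' * gen x)) => [] [] [] [].
  by rewrite (cD2 w a); have := disj a; rewrite D1a.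
have disj w : ~~ (C1 w && C2 w).
  by rewrite /C1 /C2 /cutI /compl; case: (C w); case: (D w).
have [s1|s2] : splits C1 h \/ splits C2 h.
  move: Ch; rewrite /splits CU !limitU //.
  by case: (limit C1 h) (limit C1 h^-1) (limit C2 h) (limit C2 h^-1) => [] [] [] []; auto.
- have := excl C1 C2 f1 sub1 s1 CE disj sub2 v.
  by rewrite /C2 /cutI /compl Cv /= negbK.
have CE' w : C w = C2 w || C1 w by rewrite CE orbC.
have disj' w : ~~ (C2 w && C1 w) by rewrite andbC.
by have := excl C2 C1 f2 sub2 s2 CE' disj' sub1 u; rewrite /C1 /cutI Cu Du.
Qed.

Definition tight_cut C := [/\ almost_inv C, conn cayley C, conn cayley (predC C),
  (wt C 0 <= head_cut_bound)%N & (exists u, C u) /\ (exists u, ~~ C u)].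

Lemma tight_cut_interval u v : finite_set [set C | [/\ tight_cut C, C u & ~~ C v]].
Proof.
apply: sub_finite_set (finite_tight cayley head_cut_bound u v) => C [[fC Cc Cc' Cb _] Cu Cv].
have [s [ss sC]] := boundary_edges fC; split=> //; exists s; split.
  exact: leq_trans Cb.
by move=> a b ab Ca Cb'; apply: sC => //; rewrite Ca eq_sym eqb_id.
Qed.

Lemma tight_cut_trans g C : tight_cut C -> tight_cut (trans g C).
Proof.
have connT D : conn cayley D -> conn cayley (trans g D).
  move=> Dc F u Du Fu Fcl v Dv.
  rewrite -(mulVKg g v); apply: (Dc (fun w => F (g * w)) (g^-1 * u)) => //.
    by rewrite mulVKg.
  move=> a b ab Da Db; apply: Fcl; rewrite ?/trans ?mulKg //.
  by have /existsP[x /eqP->] := ab; apply/existsP; exists x; rewrite mulgA.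
move=> [fC Cc Cc' Cb [[u Cu] [v Cv]]]; split.
- exact: almost_inv_trans.
- exact: connT.
- exact: (connT (predC C)).
- by rewrite wt_trans.
by split; [exists (g * u)|exists (g * v)]; rewrite /trans mulKg.
Qed.

(* Translate an edge of the boundary to an edge at 1. *)
Lemma tight_cut_orbits : exists R : seq (G -> bool),
  forall C, tight_cut C -> exists g, trans g C \in R.
Proof.
pose X := \bigcup_(a in [set: Sigma])
  ([set C | [/\ tight_cut C, C 1 & ~~ C (gen a)]] `|`
   [set C | [/\ tight_cut C, C (gen a) & ~~ C 1]]).
have [|R XR] := (finite_seqP X).1.
  apply: bigcup_finite => [|a _]; first exact: finite_finset.
  by rewrite finite_setU; split; exact: tight_cut_interval.
exists R => C tC; have [_ _ _ _ [[u Cu] [v Cv]]] := tC.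
have [w [a Cw]] : exists w a, C w != C (w * gen a).
  apply: contrapT => no; have : C u = C v.
    apply: cayley_const => x y /existsP[a /eqP->]; apply/eqP; apply: contrapT => /negP Cx.
    by apply: no; exists x, a.
  by rewrite Cu (negPf Cv).
exists w^-1; have : X (trans w^-1 C); last by rewrite XR.
have tC' := tight_cut_trans w^-1 tC.
have t1 : trans w^-1 C 1 = C w by rewrite /trans invgK mulg1.
have ta : trans w^-1 C (gen a) = C (w * gen a) by rewrite /trans invgK.
exists a => //; case Cw1 : (C w) Cw => /=.
  by rewrite eq_sym eqb_id => Cwa; left; split; rewrite ?t1 ?ta.
by rewrite eq_sym eqbF_neg negbK => Cwa; right; split; rewrite ?t1 ?ta ?Cw1.
Qed.

Definition optimal h C := [/\ almost_inv C, splits C h &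
  forall D, almost_inv D -> splits D h -> lexle (wt C) (wt D)].

(** Minimizing coordinate 0 first leaves tight cuts, and these have finitely many weight sequences,
    since translation preserves weights. *)
Lemma optimal_exists h : ~ finite_order h -> exists C, optimal h C.
Proof.
move=> hinf; have hinfV := infinite_orderV hinf.
pose P C := almost_inv C /\ splits C h.
pose Q n := `[< exists2 C, P C & wt C 0 = n >].
have exQ : exists n, Q n.
  have [C [fC Ch _]] := split_exists hinf.
  by exists (wt C 0); apply/asboolP; exists C.
case: (ex_minnP exQ) => n /asboolP[C0 [fC0 C0h] C0n] minn.
have min0 D : P D -> (n <= wt D 0)%N by move=> PD; apply: minn; apply/asboolP; exists D.
have nb : (n <= head_cut_bound)%N.
  have [C [fC Ch Cb]] := split_exists hinf.
  by apply: leq_trans (min0 C _) Cb.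
have tightP C : P C -> wt C 0 = n -> tight_cut C.
  move=> [fC Ch] Cn; split=> //; last exact: splits_nontrivial Ch.
  - by apply: (minimal_conn fC hinf Ch) => D fD Dh; rewrite Cn; exact: min0.
  - apply: (minimal_conn (almost_inv_compl fC) hinf); first exact: splits_compl.
    by move=> D fD Dh; rewrite -/(compl C) wt_compl Cn; exact: min0.
  - by rewrite Cn.
have [R HR] := tight_cut_orbits.
(* A representative in R need not split h; it only carries the weights of a cut that does. *)
pose P' D := exists C, [/\ P C, wt C 0 = n & wt C =1 wt D].
have [|D [[C [[fC Ch] Cn CD]] Dmin]] := @lexle_min _ wt P' R.
  have [g gR] := HR _ (tightP C0 (conj fC0 C0h) C0n).
  by exists (trans g C0) => //; exists C0; split=> // i; rewrite wt_trans.
exists C; split=> // B fB Bh i eqi.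
have [Bn|Bn] := eqVneq (wt B 0) n.
  have [g gR] := HR _ (tightP B (conj fB Bh) Bn).
  have := Dmin _ gR; rewrite /lexle; rewrite CD -(wt_trans g fB).
  apply; first by exists B; split=> // j; rewrite wt_trans.
  by move=> j ji; rewrite -CD eqi // wt_trans.
case: i eqi => [|i] eqi; first by rewrite Cn min0.
by move: Bn; rewrite -eqi // Cn eqxx.
Qed.

End OptimalCuts.

(** * Cut systems and their dual trees *)

Section CutSystems.
Variable G : groupType.
Implicit Types (C D P Q R : G -> bool) (F : set (G -> bool)) (g h u v : G).

Definition subcut P Q := forall u, P u -> Q u.
Definition nested P Q :=
  [\/ subcut P Q, subcut Q P, subcut P (compl Q) | subcut (compl Q) P].

Lemma subcut_refl P : subcut P P. Proof. by []. Qed.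

Lemma subcut_trans Q P R : subcut P Q -> subcut Q R -> subcut P R.
Proof. by move=> PQ QR u /PQ/QR. Qed.

Lemma subcut_anti P Q : subcut P Q -> subcut Q P -> P = Q.
Proof. by move=> PQ QP; apply/funext => u; apply/idP/idP => [/PQ|/QP]. Qed.

Lemma subcut_compl P Q : subcut P Q -> subcut (compl Q) (compl P).
Proof. by move=> PQ u; apply: contra => /PQ. Qed.

Lemma subcut_complr P Q : subcut P (compl Q) -> subcut Q (compl P).
Proof. by move=> /subcut_compl; rewrite complK. Qed.

Lemma subcut_compll P Q : subcut (compl P) Q -> subcut (compl Q) P.
Proof. by move=> /subcut_compl; rewrite complK. Qed.

Lemma subcut_transl g P Q : subcut (trans g P) (trans g Q) <-> subcut P Q.
Proof.
split=> PQ u; last exact: PQ.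
by move=> Pu; have := PQ (g * u); rewrite /trans mulKg; apply.
Qed.

Lemma trans_inj g : injective (trans g).
Proof. exact: can_inj (transK g). Qed.

Record cut_system F : Prop := CutSystem {
  cs_nontrivial : forall C, F C -> (exists u, C u) /\ (exists u, ~~ C u);
  cs_compl : forall C, F C -> F (compl C);
  cs_nested : forall C D, F C -> F D -> nested C D;
  cs_interval : forall u v, finite_set [set C | [/\ F C, C u & ~~ C v]];
  cs_stab : forall C g, F C -> trans g C = C -> finite_order g
}.

(** Every cut between P and Q contains a fixed point of P and misses a fixed point outside Q, so
    there are finitely many, and one strictly between leaves fewer on each side. The family need not
    be closed under complements: it may be the cuts that separate the ends of one element. *)
Lemma between_ind F (S : (G -> bool) -> (G -> bool) -> Prop) :
  (forall C, F C -> (exists u, C u) /\ (exists u, ~~ C u)) ->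
  (forall u v, finite_set [set C | [/\ F C, C u & ~~ C v]]) ->
  (forall P, F P -> S P P) ->
  (forall P Q, F P -> F Q -> subcut P Q -> P <> Q ->
     (forall R, F R -> subcut P R -> subcut R Q -> R = P \/ R = Q) -> S P Q) ->
  (forall P Q R, F P -> F Q -> F R -> S P Q -> S Q R -> S P R) ->
  forall P Q, F P -> F Q -> subcut P Q -> S P Q.
Proof.
move=> nt fin Srefl Scons Strans P Q FP FQ PQ.
have [[u Pu] _] := nt P FP; have [_ [v Qv]] := nt Q FQ.
have [s sE] := (finite_seqP _).1 (fin u v).
have : forall R, F R -> subcut P R -> subcut R Q -> R <> P -> R <> Q -> R \in s.
  move=> R FR PR RQ _ _; have : [set` s] R; last by [].
  by rewrite -sE; split=> //; [exact: PR|apply: contra Qv; exact: RQ].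
have [n] := ubnP (size s); elim: n P Q s FP FQ PQ {u v Pu Qv sE} => // n IH.
move=> P Q s FP FQ PQ sn sP.
have [->|/eqP neqPQ] := eqVneq P Q; first exact: Srefl.
have [[R [FR [PR RQ] [nRP nRQ]]]|no] := pselect (exists R,
    [/\ F R, subcut P R /\ subcut R Q & R <> P /\ R <> Q]); last first.
  apply: Scons => // R FR PR RQ.
  have [->|/eqP nRP] := eqVneq R P; first by left.
  have [->|/eqP nRQ] := eqVneq R Q; first by right.
  by case: no; exists R.
have Rs : R \in s by exact: sP.
have rs : (size (rem R s) < n)%N.
  by rewrite size_rem // prednK //; case: (s) Rs.
have mem_rs T : T \in s -> T <> R -> T \in rem R s.
  by move=> Ts /eqP TR; exact: rem_mem.
apply: (Strans P R Q) => //; apply: (IH _ _ (rem R s)) => // T FT h1 h2 n1 n2.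
  apply: mem_rs => //; apply: sP => //; first exact: subcut_trans RQ.
  by move=> TQ; apply: n2; apply: subcut_anti; rewrite // TQ.
apply: mem_rs => //; apply: sP => //; first exact: subcut_trans PR h1.
by move=> TP; apply: n1; apply: subcut_anti; rewrite // TP.
Qed.

(* Membership in [Q] of the vertex of the dual tree at which the edge [P] ends,
   just outside [P]. *)
Definition vertex P Q := (subcut P Q /\ P <> Q) \/ subcut (compl P) Q.

Lemma vertex_trans g P Q : vertex (trans g P) Q <-> vertex P (trans g^-1 Q).
Proof.
rewrite /vertex -{1 2 3}(transVK g Q) -trans_compl !subcut_transl.
split=> -[[PQ nPQ]|PQ]; try by right.
  by left; split=> // e; apply: nPQ; rewrite e.
by left; split=> // /trans_inj.
Qed.

Section Vertices.
Variable F : set (G -> bool).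
Hypothesis Fsys : cut_system F.

Let disjoint_absurd P Q : F P -> subcut P Q -> subcut P (compl Q) -> False.
Proof.
move=> /(cs_nontrivial Fsys)[[u Pu] _] PQ PQ'.
by have := PQ' u Pu; rewrite /compl PQ.
Qed.

Lemma vertex_self P : F P -> ~ vertex P P.
Proof.
move=> FP [[]|PP] //; apply: (disjoint_absurd (cs_compl Fsys FP) PP).
exact: subcut_refl.
Qed.

(** A vertex orients every edge: the four cases of nestedness decide on which side of Q the edge P
    ends. *)
Lemma vertex_compl P Q : F P -> F Q -> vertex P (compl Q) <-> ~ vertex P Q.
Proof.
move=> FP FQ; split=> [[[h1 n1]|h1] [[h2 n2]|h2]|nv].
- exact: (disjoint_absurd FP h2 h1).
- by apply: n1; apply: subcut_anti => //; exact: subcut_compll h2.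
- by apply: n2; apply: subcut_anti => //; move/subcut_compl: h1; rewrite !complK.
- exact: (disjoint_absurd (cs_compl Fsys FP) h2 h1).
have [h|h|h|h] := cs_nested Fsys FP FQ.
- have [->|/eqP n] := eqVneq P Q; first by right; exact: subcut_refl.
  by case: nv; left.
- by right; exact: subcut_compl.
- have [e|/eqP n] := eqVneq P (compl Q); last by left.
  by case: nv; right; rewrite e complK; exact: subcut_refl.
- by case: nv; right; exact: subcut_compll.
Qed.

Definition same_vertex P Q := forall R, F R -> vertex P R <-> vertex Q R.

Lemma same_vertex_sym P Q : same_vertex P Q -> same_vertex Q P.
Proof. by move=> PQ R FR; rewrite PQ. Qed.

Lemma same_vertex_trans Q P R :
  same_vertex P Q -> same_vertex Q R -> same_vertex P R.
Proof. by move=> PQ QR S FS; rewrite PQ ?QR. Qed.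

(** With no edge between them, P ends where Q starts, and the start of Q is the end of the reversed
    edge [compl Q]. *)
Lemma consecutive_vertex P Q : F P -> F Q -> subcut P Q -> P <> Q ->
  (forall R, F R -> subcut P R -> subcut R Q -> R = P \/ R = Q) ->
  same_vertex P (compl Q).
Proof.
move=> FP FQ PQ nPQ cons.
have FQ' := cs_compl Fsys FQ.
have imp R : F R -> vertex P R -> vertex (compl Q) R.
  move=> FR [[PR nPR]|PR].
    have [h|h|h|h] := cs_nested Fsys FR FQ.
    - have [e|->] := cons R FR PR h; first by case: nPR.
      by right; rewrite complK; exact: subcut_refl.
    - by right; rewrite complK.
    - by case: (disjoint_absurd FP PQ); exact: subcut_trans h.
    - left; split=> // e; apply: (disjoint_absurd FP PQ).
      by rewrite e.
  left; split; first exact: subcut_trans (subcut_compl PQ) PR.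
  move=> e; apply: nPQ; apply: subcut_anti => //.
  by move: PR; rewrite -e => /subcut_compl; rewrite !complK.
move=> R FR; split; first exact: imp.
move=> vQ; apply: contrapT => /(vertex_compl FP FR)/(imp _ (cs_compl Fsys FR)).
by move/(vertex_compl FQ' FR).
Qed.

Lemma same_vertex_disjoint P Q : F P -> F Q -> same_vertex P Q -> P <> Q ->
  subcut P (compl Q).
Proof.
move=> FP FQ PQ nPQ.
have nPQ' : ~ vertex P Q by move=> /(PQ _ FQ); exact: vertex_self.
have nQP : ~ vertex Q P by move=> /(PQ _ FP); exact: vertex_self.
have [h|h|//|h] := cs_nested Fsys FP FQ.
- by case: nPQ'; left.
- by case: nQP; left; split=> // /esym.
- by case: nQP; right.
Qed.

Section Stabilizer.
Variable H : set G.
Hypothesis sH : subgroup H.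
Hypothesis HF : forall h P, H h -> F P -> F (trans h P).

Definition vertex_stab P : set G := [set h | H h /\ same_vertex (trans h P) P].

Lemma same_vertex_transl h P Q : H h -> same_vertex P Q ->
  same_vertex (trans h P) (trans h Q).
Proof.
move=> Hh PQ R FR; rewrite !vertex_trans; apply: PQ.
by apply: HF => //; exact: subgroupV.
Qed.

Lemma subgroup_vertex_stab P : subgroup (vertex_stab P).
Proof.
split; first by split; [exact: sH.1|move=> R _; rewrite trans1].
move=> x y [Hx sx] [Hy sy]; split; first exact: sH.2.
have Hy' : H y^-1 by exact: subgroupV.
rewrite transM; apply: same_vertex_trans sx.
apply: same_vertex_transl => //.
by have := same_vertex_transl Hy' sy; rewrite transK => /same_vertex_sym.
Qed.

Lemma vertex_stab_same P Q : same_vertex P Q -> vertex_stab P = vertex_stab Q.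
Proof.
have imp P' Q' : same_vertex P' Q' -> vertex_stab P' `<=` vertex_stab Q'.
  move=> PQ h [Hh sh]; split=> //; apply: (same_vertex_trans _ PQ).
  apply: same_vertex_trans sh; apply: (same_vertex_transl Hh).
  exact: same_vertex_sym PQ.
by move=> PQ; apply/seteqP; split; apply: imp => //; exact: same_vertex_sym.
Qed.

Lemma vertex_stab_fix P h : H h -> trans h P = P -> vertex_stab P h.
Proof. by move=> Hh e; split=> // R FR; rewrite e. Qed.

(* Otherwise infinitely many translates of [Q] separate 1 from the vertex [P]. *)
Lemma fixed_vertex_side P Q D a : F P -> F Q -> vertex_stab P a ->
  ~ finite_order a -> almost_inv D -> splits D a -> ~ vertex P Q -> ~ subcut D Q.
Proof.
move=> FP FQ Pa ainf fD Da nPQ DQ.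
have [b [Pb binf Db]] : exists b, [/\ vertex_stab P b, ~ finite_order b & limit D b].
  move: Da; rewrite /splits; case Da : (limit D a); first by exists a.
  case Da' : (limit D a^-1) => // _; exists a^-1; split=> //.
    exact: (subgroupV (subgroup_vertex_stab P)).
  exact: infinite_orderV.
have /asboolP[N QN] := limit_sub DQ Db.
pose Qn n := trans (b ^+ (N + n))^-1 Q.
have Hbn n : H (b ^+ n)^-1.
  by apply/(subgroupV sH)/(subgroupX _ sH); have [] := Pb.
have FQn n : F (Qn n) by exact: HF.
have Qn1 n : Qn n 1 by rewrite /Qn /trans invgK mulg1; apply: QN; exact: leq_addr.
have vQn n : ~ vertex P (Qn n).
  move=> /(vertex_trans _ P Q); have [_ sb] : vertex_stab P (b ^+ (N + n)).
    exact: (subgroupX _ (subgroup_vertex_stab P)).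
  by move/(sb _ FQ).
have [[u Pu] [v Pv]] := cs_nontrivial Fsys FP.
(* Each translate [Qn n] contains 1, and being nested with P without containing its vertex it misses
   u or v. *)
pose K := [set C | [/\ F C, C 1 & ~~ C u]] `|` [set C | [/\ F C, C 1 & ~~ C v]].
have fK : finite_set K by rewrite finite_setU; split; exact: (cs_interval Fsys).
apply: (finite_set_not_inj fK (f := Qn)).
  move=> n; have [h|h|h|h] := cs_nested Fsys FP (FQn n).
  - right; split=> //; have [e|/eqP e] := eqVneq P (Qn n); first by rewrite -e.
    by case: (vQn n); left.
  - by right; split=> //; apply: contra Pv; exact: h.
  - by left; split=> //; exact: h.
  - by case: (vQn n); right; exact: subcut_compll.
move=> m n; wlog mn : m n / (m <= n)%N.
  by move=> W; have [|/ltnW] := leqP m n; [exact: W|move=> /W W' /esym/W'/esym].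
move=> e; apply/eqP; rewrite eqn_leq mn leqNgt; apply/negP => lt_mn.
(* Equal translates give a positive power of b that stabilizes Q. *)
have : finite_order (b ^+ (n - m)).
  apply: (cs_stab Fsys FQ); have eQ : trans (b ^+ (N + n)) (Qn m) = Q.
    by rewrite e transVK.
  rewrite -[RHS]eQ -transM -expgnFr ?leq_add2l // subnDl //.
by move=> /finite_order_root; rewrite subn_gt0 => /(_ lt_mn).
Qed.

End Stabilizer.
End Vertices.
End CutSystems.

(** * The optimal cuts form a cut system with finitely many orbits *)

Section OptimalFamily.
Variables (G : groupType) (Sigma : finType) (L : nat).
Variables (ev : seq Sigma -> G) (nf : G -> seq Sigma).
Hypothesis N : nf_system L ev nf.
Implicit Types (C D : G -> bool) (g h u v : G).
Local Notation wt := (wt ev).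
Local Notation optimal := (optimal ev).

Definition optimal_cuts : set (G -> bool) :=
  [set C | exists2 h, ~ finite_order h & optimal h C].

Lemma wt_complE C : wt (compl C) = wt C.
Proof. by apply/funext; exact: wt_compl. Qed.

Lemma wt_transE g C : almost_inv C -> wt (trans g C) = wt C.
Proof. by move=> fC; apply/funext; exact: wt_trans. Qed.

Lemma optimal_compl h C : ~ finite_order h -> optimal h C -> optimal h (compl C).
Proof.
move=> hinf [fC Ch minC]; split; first exact: almost_inv_compl.
  exact: splits_compl.
by rewrite wt_complE.
Qed.

Lemma optimal_trans g h C : ~ finite_order h -> optimal h C ->
  optimal (h ^ g^-1) (trans g C).
Proof.
move=> hinf [fC Ch minC]; split; first exact: almost_inv_trans.
  exact: splits_trans.
move=> D fD Dh; rewrite wt_transE // -(wt_transE g^-1 fD); apply: minC.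
  exact: almost_inv_trans.
rewrite -(conjgKV g h) -[X in _ ^ X]invgK; apply: splits_trans => //.
by move=> /finite_orderJV.
Qed.

Lemma optimal_minimal h C D : optimal h C -> almost_inv D -> splits D h ->
  (wt C 0 <= wt D 0)%N.
Proof. by move=> [_ _ minC] fD Dh; apply: (minC D). Qed.

Lemma optimal_tight h C : ~ finite_order h -> optimal h C -> tight_cut ev nf C.
Proof.
move=> hinf oC; have oC' := optimal_compl hinf oC.
have [fC Ch _] := oC; have [fC' Ch' _] := oC'.
split=> //; last exact: splits_nontrivial Ch.
- by apply: (minimal_conn N fC hinf Ch) => D; exact: optimal_minimal.
- by apply: (minimal_conn N fC' hinf Ch') => D; exact: optimal_minimal.
have [D [fD Dh Db]] := split_exists N hinf.
by apply: leq_trans Db; exact: (optimal_minimal oC).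
Qed.

Lemma modular_nested C D : almost_inv C -> almost_inv D ->
  (lexle (wt C) (wt (cutI C D)) /\ lexle (wt D) (wt (cutU C D))) \/
  (lexle (wt D) (wt (cutI C D)) /\ lexle (wt C) (wt (cutU C D))) ->
  subcut C D \/ subcut D C.
Proof.
move=> fC fD le; apply: (wt_modular_nested N fC fD) => i.
case: le => -[leI leU].
  by apply: lexle_sum_eq => // j; exact: wt_submodular.
rewrite [RHS]addnC; apply: (lexle_sum_eq leI leU) => j.
by rewrite [X in (_ <= X)%N]addnC; exact: wt_submodular.
Qed.

(* [ci] and [di] are the values of two cuts [C] and [D] at the four limit points
   of [h] (i = 1, 2) and [k] (i = 3, 4), where [C] splits [h] and [D] splits [k].
   Some pair of opposite corners can be compared with [C] and [D]; if both cuts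
   split both elements, they have the same weights and are interchangeable. *)
Lemma corners_split c1 c2 c3 c4 d1 d2 d3 d4 : c1 != c2 -> d3 != d4 ->
  let both := (c3 != c4) && (d1 != d2) in
  let leC (o : bool -> bool -> bool) :=
    (o c1 d1 != o c2 d2) || both && (o c3 d3 != o c4 d4) in
  let leD (o : bool -> bool -> bool) :=
    (o c3 d3 != o c4 d4) || both && (o c1 d1 != o c2 d2) in
  let I' c d := c && ~~ d in let U' c d := c || ~~ d in
  [|| leC andb && leD orb, leD andb && leC orb,
      leC I' && leD U' | leD I' && leC U'].
Proof. by case: c1 c2 c3 c4 d1 d2 d3 d4 => [] [] [] [] [] [] [] []. Qed.

Lemma optimal_nested h k C D : ~ finite_order h -> ~ finite_order k ->
  optimal h C -> optimal k D -> nested C D.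
Proof.
move=> hinf kinf [fC Ch minC] [fD Dk minD].
have hinfV := infinite_orderV hinf; have kinfV := infinite_orderV kinf.
have leC P : almost_inv P ->
    splits P h || (splits C k && splits D h) && splits P k -> lexle (wt C) (wt P).
  move=> fP /orP[Ph|/andP[/andP[Ck Dh] Pk]]; first exact: minC.
  by apply: lexle_trans (minC D _ _) (minD P _ _).
have leD P : almost_inv P ->
    splits P k || (splits C k && splits D h) && splits P h -> lexle (wt D) (wt P).
  move=> fP /orP[Pk|/andP[/andP[Ck Dh] Ph]]; first exact: minD.
  by apply: lexle_trans (minD C _ _) (minC P _ _).
have fD' := almost_inv_compl fD.
have fI := almost_invI fC fD; have fU := almost_invU fC fD.
have fI' := almost_invI fC fD'; have fU' := almost_invU fC fD'.
have nest P Q : subcut P Q \/ subcut Q P -> nested P Q by case; [exact: Or41|exact: Or42].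
have : nested C D \/ nested C (compl D).
  have := @corners_split _ _ (limit C k) (limit C k^-1)
            (limit D h) (limit D h^-1) _ _ Ch Dk.
  rewrite /= => /or4P[] /andP[h1 h2].
  - left; apply/nest/modular_nested => //; left; split; [apply: leC|apply: leD] => //;
      by rewrite /splits ?limitI ?limitU.
  - left; apply/nest/modular_nested => //; right; split; [apply: leD|apply: leC] => //;
      by rewrite /splits ?limitI ?limitU.
  - right; apply/nest/modular_nested => //; left.
    rewrite wt_complE; split; [apply: leC|apply: leD] => //;
      by rewrite /splits ?limitI ?limitU // !limit_compl.
  right; apply/nest/modular_nested => //; right.
  rewrite wt_complE; split; [apply: leD|apply: leC] => //;
    by rewrite /splits ?limitI ?limitU // !limit_compl.
case=> // -[s|s|s|s]; [exact: Or43|exact: Or44| |].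
  by rewrite complK in s; exact: Or41.
by rewrite complK in s; exact: Or42.
Qed.

Lemma optimal_cut_system : cut_system optimal_cuts.
Proof.
split.
- by move=> C [h hinf [_ /splits_nontrivial]].
- by move=> C [h hinf oC]; exists h => //; exact: optimal_compl.
- by move=> C D [h hinf oC] [k kinf oD]; exact: optimal_nested oC oD.
- move=> u v; apply: (sub_finite_set _ (tight_cut_interval ev nf u v)) => C.
  by move=> [[h hinf oC] Cu Cv]; split=> //; exact: optimal_tight oC.
(* A stabilizing g of infinite order would carry one coboundary element to infinitely many
   others. *)
move=> C g [h hinf oC] gC; apply: contrapT => ginf.
have [fC Ch _] := oC; have [[u Cu] [v Cv]] := splits_nontrivial Ch.
have [w [x Cw]] : exists w x, cobd C x w.
  exists u, (u^-1 * v); rewrite /cobd /= mulVKg Cu.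
  by rewrite (negPf Cv).
apply: (finite_set_not_inj (fC x) (f := fun n => g ^+ n * w)); last first.
  by move=> m n /mulIg; exact: infinite_order_inj.
move=> n; have gnC : trans (g ^+ n) C = C.
  by elim: n => [|n IH]; rewrite ?trans1 // expgS transM IH.
by rewrite -gnC; apply/cobd_trans; rewrite mulKg.
Qed.

Lemma optimal_cuts_trans g C : optimal_cuts C -> optimal_cuts (trans g C).
Proof.
move=> [h hinf oC]; exists (h ^ g^-1); first by move=> /finite_orderJV.
exact: optimal_trans.
Qed.

Lemma optimal_cuts_almost_inv C : optimal_cuts C -> almost_inv C.
Proof. by move=> [h _ []]. Qed.

Lemma optimal_cuts_orbits : exists R : seq (G -> bool),
  forall C, optimal_cuts C -> exists g, trans g C \in R.
Proof.
have [R HR] := tight_cut_orbits N; exists R => C [h hinf oC].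
by apply: HR; exact: optimal_tight oC.
Qed.

Lemma optimal_cuts_split h : ~ finite_order h ->
  exists2 C, optimal_cuts C & splits C h.
Proof.
move=> hinf; have [C oC] := optimal_exists N hinf; exists C; first by exists h.
by case: oC.
Qed.

End OptimalFamily.

(** * Cuts with trivial stabilizer suffice under (2) *)

Section TrivialStabilizers.
Variables (G : groupType) (Sigma : finType) (L : nat).
Variables (ev : seq Sigma -> G) (nf : G -> seq Sigma).
Hypothesis N : nf_system L ev nf.
Implicit Types (C D : G -> bool) (g h u v : G).
Local Notation cuts := (optimal_cuts ev).

Let Fsys := optimal_cut_system N.
Let sT : subgroup [set: G]. Proof. by []. Qed.
Let HF h C : [set: G] h -> cuts C -> cuts (trans h C).
Proof. by move=> _; exact: optimal_cuts_trans. Qed.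

Definition trivial_stab C := forall g, trans g C = C -> g = 1.

(** If x had infinite order, an optimal D would split it. One of D and its complement lies away from
    the fixed vertex, against [fixed_vertex_side] applied to this side itself. *)
Lemma vertex_stab_torsion C x : cuts C ->
  vertex_stab cuts [set: G] C x -> finite_order x.
Proof.
move=> FC Cx; apply: contrapT => xinf.
have [D FD Dx] := optimal_cuts_split N xinf.
have fD := optimal_cuts_almost_inv FD.
have [v|nv] := pselect (vertex C D); last first.
  exact: (fixed_vertex_side Fsys sT HF FC FD Cx xinf fD Dx nv).
have FD' := cs_compl Fsys FD.
apply: (fixed_vertex_side Fsys sT HF FC FD' Cx xinf (almost_inv_compl fD) _ _
  (subcut_refl (P := compl D))).
  exact: splits_compl.
by move/(vertex_compl Fsys FC FD).
Qed.

Lemma vertex_stab_finite C : cuts C ->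
  finite_subgroup (vertex_stab cuts [set: G] C).
Proof.
move=> FC; have sK := subgroup_vertex_stab sT HF C.
apply/finite_subgroupP; split=> //; apply: (torsion_subgroup_finite N sK) => x.
exact: vertex_stab_torsion.
Qed.

Hypothesis unique_max : forall g : G, nontrivial_torsion g ->
  exists! M : set G, maximal_finite_subgroup M /\ M g.

Definition same_max g h :=
  exists M : set G, [/\ maximal_finite_subgroup M, M g & M h].

Lemma same_max_trans h g k : nontrivial_torsion h ->
  same_max g h -> same_max h k -> same_max g k.
Proof.
move=> /unique_max[M0 [_ uM0]] [M [MM Mg Mh]] [M' [MM' M'h M'k]]; exists M; split=> //.
by rewrite -(uM0 M) // (uM0 M').
Qed.

Lemma finite_same_max (K : set G) g h : finite_subgroup K -> K g -> K h -> same_max g h.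
Proof.
move=> /(maximal_finite_exists N)[M MM KM] Kg Kh; exists M; split=> //; exact: KM.
Qed.

(* Otherwise the stabilizers of the cuts along the axis of [h] all lie in the
   same maximal finite subgroup, which is then normalized by [h]. *)
Lemma split_trivial_stab h : ~ finite_order h ->
  exists C, [/\ cuts C, splits C h & trivial_stab C].
Proof.
move=> hinf; apply: contrapT => no; have hinfV := infinite_orderV hinf.
pose Fh := [set C | [/\ cuts C, limit C h & ~~ limit C h^-1]].
have Fh_stab C : Fh C -> exists g, [/\ g <> 1, finite_order g & trans g C = C].
  move=> [FC Ch Ch']; apply: contrapT => nog; apply: no; exists C; split=> //.
    by rewrite /splits Ch (negPf Ch').
  move=> g gC; apply: contrapT => g1; apply: nog; exists g; split=> //.
  exact: (cs_stab Fsys FC gC).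
pose S C D := forall k k', k <> 1 -> k' <> 1 -> trans k C = C -> trans k' D = D ->
  same_max k k'.
have stabK C k : cuts C -> trans k C = C -> vertex_stab cuts [set: G] C k.
  by move=> FC; exact: vertex_stab_fix.
have Sbetween : forall C D, Fh C -> Fh D -> subcut C D -> S C D.
  apply: between_ind.
  - by move=> C [/(cs_nontrivial Fsys)].
  - move=> u v; apply: (sub_finite_set _ (cs_interval Fsys u v)) => C [[FC _ _] Cu Cv].
    by [].
  - move=> C [FC _ _] k k' _ _ kC k'C.
    by apply: (finite_same_max (vertex_stab_finite FC)); exact: stabK.
  - move=> C D [FC Ch Ch'] [FD Dh Dh'] CD nCD cons k k' _ _ kC k'D.
    have FD' := cs_compl Fsys FD.
    have CD' : same_vertex cuts C (compl D).
      apply: (consecutive_vertex Fsys) => // R FR CR RD; apply: cons => //.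
      split=> //; first exact: limit_sub CR Ch.
      by apply: contra Dh'; exact: limit_sub.
    apply: (finite_same_max (vertex_stab_finite FC)); first exact: stabK.
    rewrite (vertex_stab_same sT HF CD'); apply: stabK => //.
    by rewrite trans_compl k'D.
  (* The nontrivial stabilizer of the middle cut Q links the maximal subgroups of P and R. *)
  move=> P Q R FP FQ FR PQ QR k k' k1 k1' kP k'R.
  have [g [g1 fg gQ]] := Fh_stab Q FQ.
  by apply: (@same_max_trans g) => //; [exact: PQ|exact: QR].
have [C [FC Ch Ch']] : exists C, Fh C.
  have [C FC Ch] := optimal_cuts_split N hinf; have fC := optimal_cuts_almost_inv FC.
  move: Ch; rewrite /splits; case Ch : (limit C h); case Ch' : (limit C h^-1) => // _.
    by exists C; split; rewrite // Ch'.
  by exists (compl C); split; rewrite ?limit_compl ?Ch ?Ch' //; exact: cs_compl.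
have fC := optimal_cuts_almost_inv FC.
have limh k : commute h k -> ~ finite_order k -> limit (trans h C) k = limit C k.
  move=> hk kinf; have kk : k ^ h^-1 = k.
    by apply/conjg_fixP/commgP/commuteV/commute_sym.
  by rewrite -{1}kk limit_trans.
have FhC : Fh (trans h C).
  by split; [exact: optimal_cuts_trans|rewrite limh|rewrite limh //; apply: commuteV].
have [k [k1 fk kC]] := Fh_stab C (And3 FC Ch Ch').
have khC : trans (k ^ h^-1) (trans h C) = trans h C.
  by rewrite -transM conjgE invgK -mulgA mulgVK transM kC.
have k1' : k ^ h^-1 <> 1 by move/eqP; rewrite conjg_eq1 => /eqP.
(* Both C and its translate contain the positive end of h and miss the negative one, so only the two
   inclusions survive among the nested cases. *)
have Skh : same_max k (k ^ h^-1).
  have [s|s|s|s] := cs_nested Fsys FC (optimal_cuts_trans h FC).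
  - exact: (Sbetween C (trans h C)).
  - have [M [? ? ?]] := Sbetween (trans h C) C FhC (And3 FC Ch Ch') s _ _ k1' k1 khC kC.
    by exists M.
  - have : limit (compl (trans h C)) h by exact: limit_sub s Ch.
    by rewrite limit_compl ?limh ?Ch //; exact: almost_inv_trans.
  - have cV : commute h h^-1 by exact: commuteV.
    have ft := almost_inv_trans h fC.
    by have /negP := Ch'; case; apply: (limit_sub s); rewrite limit_compl // limh.
have [M [MM Mk Mkh]] := Skh.
have [MF Mmax] := MM; have [fM sM] := (finite_subgroupP M).1 MF.
(* This conjugate is again a maximal finite subgroup, and it contains k. *)
have Mh : conj_subgroup M h^-1 = M.
  have [M0 [_ uM0]] := unique_max (conj k1 fk).
  rewrite -[RHS](uM0 M (conj MM Mk)); apply/esym/uM0; split=> //.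
  split; first by apply/finite_subgroupP; split; [exact: finite_conj|exact: subgroup_conj].
  move=> K KF sub_K; apply/seteqP; split=> // x Kx.
  have [fK sK] := (finite_subgroupP K).1 KF.
  have <- : conj_subgroup K h = M.
    apply: Mmax; first by apply/finite_subgroupP; split; [exact: finite_conj|exact: subgroup_conj].
    by move=> y My; apply: sub_K; rewrite /conj_subgroup /= conjgK.
  by rewrite /conj_subgroup /= conjgKV.
have Mkn n : M (k ^ (h ^+ n)^-1).
  elim: n => [|n IH]; first by rewrite invg1 conjg1.
  rewrite expgS invgM conjgM.
  by have : conj_subgroup M h^-1 (k ^ (h ^+ n)^-1) by rewrite Mh.
(* Two conjugates of k by powers of h coincide in the finite M, so a positive power of h commutes
   with k. *)
apply: (finite_set_not_inj fM Mkn) => m n.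
wlog mn : m n / (m <= n)%N.
  by move=> W; have [|/ltnW] := leqP m n; [exact: W|move=> /W W' /esym/W'/esym].
move=> e; apply/eqP; rewrite eqn_leq mn leqNgt; apply/negP => lt_mn.
apply: (torsion_not_commute N (h := h ^+ (n - m)) (g := k)) => //.
  by move=> /finite_order_root; rewrite subn_gt0 => /(_ lt_mn).
have kd : k ^ (h ^+ (n - m))^-1 = k.
  apply: (@conjg_inj _ (h ^+ m)^-1); rewrite e -conjgM -invgM -expgnDr.
  by rewrite subnKC.
by rewrite -[h ^+ _]invgK; apply/commute_sym/commuteV/commgP/conjg_fixP.
Qed.

End TrivialStabilizers.

(** * Internal free products *)

Section InternalFreeProducts.
Variable G : groupType.

Section Family.
Variables (I : eqType) (Hs : I -> set G).
Implicit Types (w : seq (I * G)) (x : I * G).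

Definition wprod w : G := \prod_(x <- w) x.2.
Definition letters w := forall x, x \in w -> Hs x.1 x.2.
Definition alternating w := sorted (fun x y : I * G => x.1 != y.1) w.
Definition reduced w :=
  [/\ letters w, forall x, x \in w -> x.2 <> 1 & alternating w].

Definition free_family := forall w, reduced w -> w <> [::] -> wprod w <> 1.

Definition generated_by : set G := [set g | exists2 w, letters w & wprod w = g].

Definition decomposes (K : set G) :=
  [/\ forall i, subgroup (Hs i), generated_by = K & free_family].

Lemma wprod_cons x w : wprod (x :: w) = x.2 * wprod w.
Proof. exact: big_cons. Qed.

Lemma wprod_cat w1 w2 : wprod (w1 ++ w2) = wprod w1 * wprod w2.
Proof. exact: big_cat. Qed.

Lemma wprod1 x : wprod [:: x] = x.2.
Proof. exact: big_seq1. Qed.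

Lemma letters_cons x w : letters (x :: w) <-> Hs x.1 x.2 /\ letters w.
Proof.
split=> [l|[lx lw] y]; last by rewrite inE => /orP[/eqP->|/lw].
by split=> [|y yw]; apply: l; rewrite inE ?eqxx // yw orbT.
Qed.

Lemma letters_cat w1 w2 : letters (w1 ++ w2) <-> letters w1 /\ letters w2.
Proof.
split=> [l|[l1 l2] y]; last by rewrite mem_cat => /orP[/l1|/l2].
by split=> y yw; apply: l; rewrite mem_cat yw ?orbT.
Qed.

Lemma generated_letter i g : Hs i g -> generated_by g.
Proof.
move=> ig; exists [:: (i, g)]; last by rewrite wprod1.
by move=> x; rewrite inE => /eqP->.
Qed.

Lemma generated_min (K : set G) : subgroup K -> (forall i, Hs i `<=` K) ->
  generated_by `<=` K.
Proof.
move=> sK HK g [w lw <-]; elim: w lw => [|x w IH] lw.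
  by rewrite /wprod big_nil; exact: sK.1.
have [lx lw'] := (letters_cons x w).1 lw; rewrite wprod_cons.
by apply: subgroupM => //; [exact: HK lx|exact: IH].
Qed.

Lemma subgroup_generated : (forall i, subgroup (Hs i)) -> subgroup generated_by.
Proof.
move=> sH; split; first by exists [::] => //; rewrite /wprod big_nil.
move=> _ y [w1 l1 <-] [w2 l2 <-].
have [v lv ev] : generated_by (wprod w2)^-1.
  elim: w2 l2 => [|x w IH] l; first by exists [::]; rewrite // /wprod !big_nil invg1.
  have [lx lw] := (letters_cons x w).1 l; have [v lv ev] := IH lw.
  exists (v ++ [:: (x.1, x.2^-1)]).
    apply/letters_cat; split=> // z; rewrite inE => /eqP->.
    exact: subgroupV.
  by rewrite wprod_cat wprod1 wprod_cons ev invgM.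
by exists (w1 ++ v); [exact/letters_cat|rewrite wprod_cat ev].
Qed.

Definition head_neq x w := if w is y :: _ then x.1 != y.1 else true.

Lemma reduced_cons x w : reduced (x :: w) <->
  [/\ Hs x.1 x.2, x.2 <> 1, reduced w & head_neq x w].
Proof.
split.
  move=> [/letters_cons[lx lw] ne alt]; split=> //.
  - by apply: ne; rewrite inE eqxx.
  - split=> // [y yw|]; first by apply: ne; rewrite inE yw orbT.
    by case: w alt {lw ne} => //= y w /andP[].
  by case: w alt {lw ne} => //= y w /andP[].
move=> [lx nx [lw ne alt] xw]; split; first exact/letters_cons.
  by move=> y; rewrite inE => /orP[/eqP->|/ne].
by case: w xw alt {lw ne} => //= y w -> ->.
Qed.

End Family.

Lemma decomposes_unit (K : set G) : subgroup K -> decomposes (fun _ : unit => K) K.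
Proof.
move=> sK; split=> //.
  apply/seteqP; split; first by apply: generated_min => // i g.
  by move=> g; exact: (@generated_letter _ _ tt).
move=> [//|[[] g] [|[[] h] w]] /reduced_cons[/= _ g1 _ //] _ _.
by rewrite wprod1.
Qed.

Definition cyclic_set (t : G) : set G :=
  [set g | exists n, g = t ^+ n \/ g = (t ^+ n)^-1].

Lemma subgroup_cyclic_set t : subgroup (cyclic_set t).
Proof.
split; first by exists 0%N; left.
move=> x y [m xm] [n yn].
wlog le_nm : x y m n xm yn / (n <= m)%N.
  have [le_nm W|lt_mn W] := leqP n m; first exact: W xm yn le_nm.
  have [k xyk] := W _ _ _ _ yn xm (ltnW lt_mn).
  exists k; rewrite -[x * y^-1]invgK invgM invgK.
  by case: xyk => ->; [right|left; rewrite invgK].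
have tmn : t ^+ m = t ^+ (m - n) * t ^+ n by rewrite -expgnDr subnK.
have tmn' : t ^+ m = t ^+ n * t ^+ (m - n) by rewrite -expgnDr subnKC.
case: xm yn => -> [] ->.
- by exists (m - n)%N; left; rewrite tmn mulgK.
- by exists (m + n)%N; left; rewrite invgK expgnDr.
- by exists (m + n)%N; right; rewrite -invgM -expgnDr addnC.
- by exists (m - n)%N; right; rewrite invgK tmn' invgM mulgVK.
Qed.

Lemma cyclic_set_min (K : set G) t : subgroup K -> K t -> cyclic_set t `<=` K.
Proof.
move=> sK Kt _ [n [->|->]]; first exact: subgroupX.
by apply: subgroupV => //; exact: subgroupX.
Qed.

Lemma cyclic_set_id t : cyclic_set t t.
Proof. by exists 1%N; left. Qed.

Definition elementary (K : set G) := finite_subgroup K \/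
  exists2 t, ~ finite_order t & K = cyclic_set t.

Definition internally_plain (K : set G) := exists (I : finType) (Hs : I -> set G),
  (forall i, elementary (Hs i)) /\ decomposes Hs K.

Lemma elementary_subgroup K : elementary K -> subgroup K.
Proof.
by case=> [/finite_subgroupP[]//|[t _ ->]]; exact: subgroup_cyclic_set.
Qed.

Lemma elementary_plain K : elementary K -> internally_plain K.
Proof.
move=> eK; exists (unit : finType), (fun=> K); split=> //.
exact/decomposes_unit/elementary_subgroup.
Qed.

Definition pair_family (K1 K2 : set G) (b : bool) := if b then K1 else K2.

Section Compose.
Variables (I1 I2 : eqType) (H1 : I1 -> set G) (H2 : I2 -> set G).
Variables K1 K2 K : set G.
Hypothesis dec1 : decomposes H1 K1.
Hypothesis dec2 : decomposes H2 K2.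
Hypothesis dec : decomposes (pair_family K1 K2) K.

Definition sum_family (i : I1 + I2) :=
  match i with inl i1 => H1 i1 | inr i2 => H2 i2 end.

Definition is_left (x : (I1 + I2) * G) := if x.1 is inl _ then true else false.

Lemma side_nontrivial b (w : seq ((I1 + I2) * G)) : reduced sum_family w ->
  w <> [::] -> all (fun x => is_left x == b) w ->
  pair_family K1 K2 b (wprod w) /\ wprod w <> 1.
Proof.
have [sH1 gen1 free1] := dec1; have [sH2 gen2 free2] := dec2.
move=> rw w0 wb.
have [b1|b2] := boolP b.
  have {wb} [v wv] : exists v : seq (I1 * G), w = [seq (inl x.1, x.2) | x <- v].
    elim: w wb {rw w0} => [|[[i|i] g] w IH] /=; first by exists [::].
      by move=> /andP[_ /IH[v ->]]; exists ((i, g) :: v).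
    by rewrite b1 /is_left.
  have rv : reduced H1 v.
    move: rw; rewrite wv => -[lw ne alt]; split.
    - by move=> x xv; exact: (lw (inl x.1, x.2) (map_f _ xv)).
    - by move=> x xv; exact: (ne (inl x.1, x.2) (map_f _ xv)).
    - by move: alt; rewrite /alternating sorted_map.
  have wE : wprod w = wprod v by rewrite /wprod wv big_map.
  rewrite wE; split; last by apply: free1 => // v0; apply: w0; rewrite wv v0.
  by rewrite /pair_family -gen1; exists v => //; case: rv.
have {wb} [v wv] : exists v : seq (I2 * G), w = [seq (inr x.1, x.2) | x <- v].
  elim: w wb {rw w0} => [|[[i|i] g] w IH] /=; first by exists [::].
    by rewrite (negPf b2) /is_left.
  by move=> /andP[_ /IH[v ->]]; exists ((i, g) :: v).
have rv : reduced H2 v.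
  move: rw; rewrite wv => -[lw ne alt]; split.
  - by move=> x xv; exact: (lw (inr x.1, x.2) (map_f _ xv)).
  - by move=> x xv; exact: (ne (inr x.1, x.2) (map_f _ xv)).
  - by move: alt; rewrite /alternating sorted_map.
have wE : wprod w = wprod v by rewrite /wprod wv big_map.
rewrite wE; split; last by apply: free2 => // v0; apply: w0; rewrite wv v0.
by rewrite /pair_family -gen2; exists v => //; case: rv.
Qed.

(* [x :: u] is the first maximal block of letters on the same side. *)
Lemma first_block x (w : seq ((I1 + I2) * G)) : reduced sum_family (x :: w) ->
  exists u v, [/\ reduced sum_family (x :: u),
    all (fun y => is_left y == is_left x) (x :: u),
    reduced (pair_family K1 K2) ((is_left x, wprod (x :: u)) :: v) &
    wprod (x :: w) = wprod (x :: u) * wprod v].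
Proof.
elim: w x => [|y w IH] x rxw.
  have [||lx nx] := @side_nontrivial (is_left x) [:: x] rxw; [by []|by rewrite /= eqxx|].
  exists [::], [::]; split; rewrite /= ?eqxx // ?mulg1; last by rewrite /wprod big_nil mulg1.
  by apply/reduced_cons; split.
have [lx nx ryw xy] := (reduced_cons _ _ _).1 rxw.
have [u [v [ru au rv e]]] := IH y ryw.
have [_ _ rv' hv] := (reduced_cons _ _ _).1 rv.
have [yx|yx] := eqVneq (is_left y) (is_left x).
  exists (y :: u), v; rewrite -yx.
  have rxu : reduced sum_family (x :: y :: u) by apply/reduced_cons; split.
  have axu : all (fun z => is_left z == is_left y) (x :: y :: u).
    by apply/andP; split; [rewrite yx|exact: au].
  split=> //; last by rewrite wprod_cons e mulgA -wprod_cons.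
  have [//|l1 n1] := side_nontrivial rxu _ axu.
  by apply/reduced_cons; split.
have rx : reduced sum_family [:: x].
  apply/reduced_cons; split=> //.
exists [::], ((is_left y, wprod (y :: u)) :: v); split=> //.
- by rewrite /= eqxx.
- have [||l1 n1] := @side_nontrivial (is_left x) [:: x] rx; [by []|by rewrite /= eqxx|].
  by apply/reduced_cons; split=> //; rewrite /= eq_sym.
- by rewrite [LHS]wprod_cons wprod1 e [X in _ = _ * X]wprod_cons.
Qed.

(** Associativity of free products: grouping a reduced word into its maximal one-sided blocks gives
    a reduced word over K1 and K2. *)
Lemma decomposes_sum : decomposes sum_family K.
Proof.
have [sH1 gen1 free1] := dec1; have [sH2 gen2 free2] := dec2.
have [sK gen free] := dec.
have sS i : subgroup (sum_family i) by case: i.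
split=> //.
  have sG : subgroup (generated_by sum_family) := subgroup_generated sS.
  apply/seteqP; split.
    have sK' : subgroup K by rewrite -gen; exact: subgroup_generated.
    apply: generated_min => // -[i|i] g ig; rewrite -gen.
      apply: (@generated_letter _ _ true) => /=; rewrite -gen1.
      exact: (@generated_letter _ H1 i).
    apply: (@generated_letter _ _ false) => /=; rewrite -gen2.
    exact: (@generated_letter _ H2 i).
  rewrite -gen; apply: generated_min => // -[] /=.
    rewrite -gen1; apply: generated_min => // i g ig.
    exact: (@generated_letter _ _ (inl i)).
  rewrite -gen2; apply: generated_min => // i g ig.
  exact: (@generated_letter _ _ (inr i)).
move=> [//|x w] rw _; have [u [v [_ _ rv ->]]] := first_block rw.
by move=> e; apply: (free _ rv) => //; rewrite -e; exact: wprod_cons.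
Qed.

End Compose.

Lemma internally_plain_pair K1 K2 K : internally_plain K1 -> internally_plain K2 ->
  decomposes (pair_family K1 K2) K -> internally_plain K.
Proof.
move=> [I1 [H1 [e1 d1]]] [I2 [H2 [e2 d2]]] d.
exists ((I1 + I2)%type : finType), (sum_family H1 H2); split; first by case.
exact: (decomposes_sum d1 d2 d).
Qed.

Section PingPong.
Variables (K1 K2 : set G) (U W : G -> bool).
Hypothesis U_nonempty : exists u, U u.
Hypothesis W_nonempty : exists u, W u.
Hypothesis UW_disjoint : subcut U (compl W).
Hypothesis ping : forall g, K1 g -> g <> 1 -> subcut (trans g U) W /\ trans g U <> W.
Hypothesis pong : forall g, K2 g -> g <> 1 -> subcut (trans g W) U.

Let X (b : bool) := if b then U else W.

Lemma ping_pong_letter x : pair_family K1 K2 x.1 x.2 -> x.2 <> 1 ->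
  subcut (trans x.2 (X x.1)) (X (~~ x.1)).
Proof.
case: x => -[] g /= lg ng; last exact: pong.
by have [] := ping lg ng.
Qed.

Lemma ping_pong_word x w : reduced (pair_family K1 K2) (x :: w) ->
  subcut (trans (wprod (x :: w)) (X (last x w).1)) (trans x.2 (X x.1)).
Proof.
elim: w x => [|y w IH] x; first by rewrite wprod1; move=> u.
move=> /reduced_cons[lx nx ryw xy]; have [ly ny _ _] := (reduced_cons _ _ _).1 ryw.
rewrite wprod_cons transM; apply/subcut_transl.
apply: (subcut_trans (IH y ryw)).
have -> : x.1 = ~~ y.1 by move: xy; rewrite /head_neq; case: x.1 y.1 => [] [].
exact: ping_pong_letter.
Qed.

(** If a reduced word has product 1, the set of its last letter lies in the set opposite to its
    first letter. Ends in the same factor contradict disjointness; ends in different factors force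
    equality at the first letter from K1, against strictness in [ping]. Strictness is what admits
    factors of order 2. *)
Lemma ping_pong : free_family (pair_family K1 K2).
Proof.
move=> [//|x w] rw _ w1.
have [lx nx ryw xy] := (reduced_cons _ _ _).1 rw.
have := ping_pong_word rw; rewrite w1 trans1 => sub_x.
have sub_X := subcut_trans sub_x (ping_pong_letter lx nx).
have disj b : ~ subcut (X b) (X (~~ b)).
  case: b => /= s; first by have [u Uu] := U_nonempty; have := UW_disjoint Uu; rewrite /compl s.
  by have [u Wu] := W_nonempty; have := UW_disjoint (s _ Wu); rewrite /compl Wu.
have lastx : (last x w).1 = ~~ x.1.
  move: sub_X; case: (last x w).1 x.1 => [] [] //= s.
    by case: (disj true s).
  by case: (disj false s).
case x1 : x.1 lastx => /= lastx.
  have [s n] : subcut (trans x.2 U) W /\ trans x.2 U <> W.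
    by apply: ping => //; move: lx; rewrite x1.
  by apply: n; apply: subcut_anti => //; move: sub_x; rewrite x1 lastx.
case: w rw w1 ryw xy lastx {sub_x sub_X} => [|y w] rw w1 ryw xy lastx.
  by rewrite /= x1 in lastx.
have [ly ny _ _] := (reduced_cons _ _ _).1 ryw.
have y1 : y.1 = true by move: xy; rewrite /head_neq x1; case: y.1.
have [s n] : subcut (trans y.2 U) W /\ trans y.2 U <> W.
  by apply: ping => //; move: ly; rewrite y1.
have sW : subcut (trans x.2 W) U by apply: pong => //; move: lx; rewrite x1.
apply: n; apply: (@trans_inj _ x.2); apply: subcut_anti; first exact/subcut_transl.
apply: (subcut_trans sW); have := ping_pong_word ryw.
rewrite y1 (_ : (last y w).1 = true) // => sU.
by have := (subcut_transl x.2 _ _).2 sU; rewrite -transM -wprod_cons w1 trans1.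
Qed.

End PingPong.

End InternalFreeProducts.

(** * Splitting along an orbit of cuts *)

Section OneOrbit.
Variable G : groupType.
Implicit Types (C D P Q R : G -> bool) (g h u v : G).
Variable F0 : set (G -> bool).
Hypothesis F0sys : cut_system F0.
Hypothesis F0trivial : forall C, F0 C -> trivial_stab C.
Hypothesis F0trans : forall g C, F0 C -> F0 (trans g C).
Hypothesis F0ai : forall C, F0 C -> almost_inv C.
Variables (H : set G) (E : G -> bool).
Hypothesis sH : subgroup H.
Hypothesis F0E : F0 E.

Definition side (b : bool) := if b then E else compl E.
Definition orbit : set (G -> bool) :=
  [set C | exists2 h, H h & exists b, C = trans h (side b)].

Lemma side_compl b : side (~~ b) = compl (side b).
Proof. by case: b => //=; rewrite complK. Qed.

Lemma F0side b : F0 (side b).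
Proof. by case: b => //=; exact: cs_compl F0sys _ F0E. Qed.

Lemma orbit_F0 C : orbit C -> F0 C.
Proof. by move=> [h _ [b ->]]; apply: F0trans; exact: F0side. Qed.

Lemma orbit_trans h C : H h -> orbit C -> orbit (trans h C).
Proof.
move=> Hh [g Hg [b ->]]; exists (h * g); first exact: subgroupM.
by exists b; rewrite transM.
Qed.

Lemma orbit_side h b : H h -> orbit (trans h (side b)).
Proof. by move=> Hh; exists h => //; exists b. Qed.

Lemma orbit_side1 b : orbit (side b).
Proof. by rewrite -[side b]trans1; apply: orbit_side; exact: sH.1. Qed.

Lemma orbit_system : cut_system orbit.
Proof.
split.
- by move=> C /orbit_F0; exact: cs_nontrivial.
- move=> C [h Hh [b ->]]; exists h => //; exists (~~ b).
  by rewrite side_compl trans_compl.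
- by move=> C D /orbit_F0 FC /orbit_F0 FD; exact: cs_nested FC FD.
- move=> u v; apply: (sub_finite_set _ (cs_interval F0sys u v)) => C.
  by move=> [/orbit_F0 FC Cu Cv].
- by move=> C g /orbit_F0 FC; exact: (cs_stab F0sys FC).
Qed.

Local Notation Osys := orbit_system.
Local Notation "P ~~~ Q" := (same_vertex orbit P Q) (at level 70).

Let transl h P Q : H h -> P ~~~ Q -> trans h P ~~~ trans h Q.
Proof. by move=> Hh; apply: (same_vertex_transl sH _ Hh) => g P' Hg; exact: orbit_trans. Qed.

Let tr Q P R : P ~~~ Q -> Q ~~~ R -> P ~~~ R.
Proof. exact: same_vertex_trans. Qed.

Let sy P Q : P ~~~ Q -> Q ~~~ P.
Proof. exact: same_vertex_sym. Qed.

Definition vstab b := vertex_stab orbit H (side b).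

Lemma subgroup_vstab b : subgroup (vstab b).
Proof. by apply: subgroup_vertex_stab => // h P; exact: orbit_trans. Qed.

Lemma vstab_sub b : vstab b `<=` H.
Proof. by move=> g []. Qed.

(* Connectedness of the dual tree: consecutive edges between two given ones are
   joined by elements of [K]. *)
Lemma orbit_generated (K : set G) : subgroup K ->
  (forall b c g, H g -> trans g (side b) ~~~ side c -> K g) -> H `<=` K.
Proof.
move=> sK key.
pose S P Q := forall g1 g2 b c, H g1 -> H g2 -> P = trans g1 (side b) ->
  Q = trans g2 (side c) -> K (g1^-1 * g2).
have flip g1 g2 b c : H g1 -> H g2 -> trans g1 (side b) ~~~ trans g2 (side c) ->
    K (g1^-1 * g2).
  move=> H1 H2 e; have H1' := subgroupV sH H1.
  apply: (key c b); first exact: subgroupM.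
  by rewrite transM; apply: sy; have := transl H1' e; rewrite transK.
have Sbetween : forall P Q, orbit P -> orbit Q -> subcut P Q -> S P Q.
  apply: between_ind; first exact: cs_nontrivial Osys; first exact: cs_interval Osys.
  - move=> P FP g1 g2 b c H1 H2 e1 e2; apply: (flip _ _ b c) => //.
    by rewrite -e1 -e2.
  - move=> P Q FP FQ PQ nPQ cons g1 g2 b c H1 H2 e1 e2.
    apply: (flip _ _ b (~~ c)) => //; rewrite side_compl trans_compl -e1 -e2.
    exact: (consecutive_vertex Osys).
  move=> P Q R FP [g Hg [b ->]] FR PQ QR g1 g2 b1 b2 H1 H2 e1 e2.
  have -> : g1^-1 * g2 = (g1^-1 * g) * (g^-1 * g2) by rewrite mulgA mulgK.
  by apply: subgroupM => //; [apply: PQ e1 erefl|apply: QR erefl e2].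
move=> h Hh; have O1 b := orbit_side1 b; have Oh b := orbit_side b Hh.
have key2 b c : subcut (side b) (trans h (side c)) -> K h.
  move=> /(Sbetween _ _ (O1 b) (Oh c)) s.
  by have := s 1 h b c sH.1 Hh; rewrite trans1 invg1 mul1g; apply.
have [s|s|s|s] := cs_nested Osys (O1 true) (Oh true).
- exact: key2 s.
- have := Sbetween _ _ (Oh true) (O1 true) s h 1 true true Hh sH.1 erefl.
  rewrite trans1 mulg1 => /(_ erefl) Kh.
  by rewrite -[h]invgK; exact: subgroupV.
- by apply: (key2 true false).
- by apply: (key2 false true); exact: subcut_compll.
Qed.

Lemma vstab_disjoint b a : vstab b a -> a <> 1 ->
  subcut (trans a (side b)) (compl (side b)).
Proof.
move=> [Ha va] a1; apply: (same_vertex_disjoint Osys _ _ va); first exact: orbit_side.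
  exact: orbit_side1.
by move=> e; apply: a1; exact: (F0trivial (F0side b)).
Qed.

Lemma not_same_opposite b : ~ (side b ~~~ compl (side b)).
Proof.
move=> e; apply: (vertex_self Osys (orbit_side1 (~~ b))).
rewrite side_compl; apply/(e (compl (side b))).
  by rewrite -side_compl; exact: orbit_side1.
by right; exact: subcut_refl.
Qed.

Lemma vstab_strict b a : vstab b a -> trans a (side b) <> compl (side b).
Proof. by move=> [Ha va] e; apply: (@not_same_opposite b); apply: sy; rewrite -e. Qed.

(** The two ends of E lie in different orbits, so the quotient of the tree is a single edge with
    trivial stabilizer; ping-pong is played on E and its complement. *)
Lemma amalgam : (forall t, H t -> ~ (trans t E ~~~ compl E)) ->
  decomposes (pair_family (vstab true) (vstab false)) H.
Proof.
move=> no; have sV b : subgroup (pair_family (vstab true) (vstab false) b).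
  by case: b; exact: subgroup_vstab.
split=> //.
  apply/seteqP; split; first by apply: generated_min => // -[]; exact: vstab_sub.
  apply: orbit_generated; first exact: subgroup_generated.
  move=> [] [] g Hg e.
  - by apply: (@generated_letter _ _ _ true).
  - by case: (no g Hg e).
  - case: (no g^-1); first exact: subgroupV.
    by apply: sy; have := transl (subgroupV sH Hg) e; rewrite transK.
  - by apply: (@generated_letter _ _ _ false).
apply: (@ping_pong _ _ _ E (compl E)).
- exact: (cs_nontrivial F0sys F0E).1.
- exact: (cs_nontrivial F0sys F0E).2.
- by rewrite complK; exact: subcut_refl.
- move=> g Vg g1; split; first exact: (@vstab_disjoint true).
  exact: (@vstab_strict true).
move=> g Vg g1; rewrite -{2}[E]complK; exact: (@vstab_disjoint false).
Qed.

Section OneVertexOrbit.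
Variable t : G.
Hypothesis Ht : H t.
Hypothesis tE : trans t E ~~~ compl E.

(** The parameter b fixes the order of the factors: in [ping_pong] the vertex group comes first if t
    inverts E, and the cyclic group otherwise. *)
Lemma one_orbit_generated b :
  generated_by (pair_family (pair_family (vstab true) (cyclic_set t) b)
                         (pair_family (vstab true) (cyclic_set t) (~~ b))) = H.
Proof.
set Hs := pair_family _ _.
have sHs i : subgroup (Hs i).
  by case: i b @Hs => [] [] /=; exact: subgroup_vstab || exact: subgroup_cyclic_set.
have V g : vstab true g -> generated_by Hs g.
  by move=> Vg; apply: (@generated_letter _ _ _ b); rewrite /Hs; case: (b).
have T g : cyclic_set t g -> generated_by Hs g.
  by move=> Tg; apply: (@generated_letter _ _ _ (~~ b)); rewrite /Hs; case: (b).
have sG := subgroup_generated sHs.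
have Tt := T _ (cyclic_set_id t).
have Ht' := subgroupV sH Ht.
apply/seteqP; split.
  apply: generated_min => // i.
  suff H0 c : pair_family (vstab true) (cyclic_set t) c `<=` H.
    by case: i; exact: H0.
  by case: c => /=; [exact: vstab_sub|exact: cyclic_set_min].
apply: orbit_generated => // -[] [] g Hg e.
- exact: V.
- have : vstab true (t^-1 * g).
    split; first exact: subgroupM.
    by rewrite transM; have := transl Ht' (tr e (sy tE)); rewrite transK.
  by move=> /V Vg; rewrite -[g](mulVKg t); exact: subgroupM.
- have : vstab true (g * t).
    split; first exact: subgroupM.
    rewrite transM; exact: tr (transl Hg tE) e.
  by move=> /V Vg; rewrite -[g](mulgK t); apply: subgroupM => //; exact: subgroupV.
have : vstab true (t^-1 * (g * t)).
  split; first by do 2 apply: subgroupM => //.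
  rewrite !transM; have := transl Ht' (tr (tr (transl Hg tE) e) (sy tE)).
  by rewrite transK.
move=> /V Vg; have -> : g = t * (t^-1 * (g * t)) * t^-1 by rewrite mulVKg mulgK.
by apply: subgroupM => //; [exact: subgroupM|exact: subgroupV].
Qed.

Lemma t_neq1 : t <> 1.
Proof. by move=> t1; apply: (@not_same_opposite true); move: tE; rewrite t1 trans1. Qed.

Lemma inversion_square : trans t E = compl E -> t * t = 1.
Proof. by move=> e; apply: (F0trivial F0E); rewrite transM e trans_compl e complK. Qed.

Lemma inversion_cyclic g : trans t E = compl E -> cyclic_set t g -> g <> 1 -> g = t.
Proof.
move=> /inversion_square tt.
have tn n : t ^+ n = 1 \/ t ^+ n = t.
  elim: n => [|n [] IH]; first by left.
    by right; rewrite expgS IH mulg1.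
  by left; rewrite expgS IH.
have tV : t^-1 = t := mulg1_eq tt.
by move=> [n [->|->]]; case: (tn n) => ->; rewrite ?invg1 ?tV.
Qed.

Lemma inversion_amalgam : trans t E = compl E ->
  decomposes (pair_family (vstab true) (cyclic_set t)) H.
Proof.
move=> e; split; last 1 first.
- apply: (@ping_pong _ _ _ E (compl E)).
  + exact: (cs_nontrivial F0sys F0E).1.
  + exact: (cs_nontrivial F0sys F0E).2.
  + by rewrite complK; exact: subcut_refl.
  + move=> g Vg g1; split; first exact: (@vstab_disjoint true).
    exact: (@vstab_strict true).
  move=> g Tg g1; rewrite (inversion_cyclic e Tg g1) trans_compl e complK.
  exact: subcut_refl.
- by case; [exact: subgroup_vstab|exact: subgroup_cyclic_set].
exact: (one_orbit_generated true).
Qed.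

Section HNN.
Hypothesis no_inversion : forall s, H s -> trans s E <> compl E.

Lemma tE_sub : subcut (trans t E) E.
Proof.
rewrite -{2}[E]complK; apply: (same_vertex_disjoint Osys _ _ tE).
- exact: (@orbit_side _ true).
- exact: (@orbit_side1 false).
exact: no_inversion.
Qed.

Lemma tnE_sub n : subcut (trans (t ^+ n) E) E.
Proof.
elim: n => [|n IH]; first by rewrite trans1; exact: subcut_refl.
rewrite expgSr transM; apply: (subcut_trans _ IH); exact/subcut_transl/tE_sub.
Qed.

Lemma t_infinite : ~ finite_order t.
Proof.
move=> [[//|n] _ tn]; apply: t_neq1; apply: (F0trivial F0E).
apply: subcut_anti; first exact: tE_sub.
rewrite -{1}[E]trans1 -tn expgS transM; apply/subcut_transl; exact: tnE_sub.
Qed.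

Lemma tE'_sub : subcut (trans t^-1 (compl E)) (compl E).
Proof.
apply/(subcut_transl t); rewrite transVK; apply: subcut_compl; exact: tE_sub.
Qed.

Lemma tnE'_sub n : subcut (trans (t ^+ n)^-1 (compl E)) (compl E).
Proof.
apply/(subcut_transl (t ^+ n)); rewrite transVK; apply: subcut_compl; exact: tnE_sub.
Qed.

(** The two edges of the axis of t that end at the vertex of E have these sides. Powers of t move
    the complement of U into U, and the vertex group moves U off itself. *)
Let U := cutU E (trans t^-1 (compl E)).

(** Positive powers carry the complement of U into E and negative powers into
    [trans t^-1 (compl E)], each a proper part of U. *)
Lemma hnn_ping g : cyclic_set t g -> g <> 1 ->
  subcut (trans g (compl U)) U /\ trans g (compl U) <> U.
Proof.
have [[u Eu] [v Ev]] := cs_nontrivial F0sys F0E.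
have UE : subcut E U by move=> x Ex; rewrite /U /cutU Ex.
have UE' : subcut (trans t^-1 (compl E)) U by move=> x Ex; rewrite /U /cutU Ex orbT.
move=> [[|n] [->|->]] g1; rewrite ?invg1 // in g1 *.
  have s : subcut (trans (t ^+ n.+1) (compl U)) E.
    apply: (subcut_trans _ (@tnE_sub n)); rewrite expgSr transM; apply/subcut_transl.
    apply/(subcut_transl t^-1); rewrite transK; apply: subcut_compll.
    exact: UE'.
  split; first exact: subcut_trans s UE.
  move=> e; move: s; rewrite e => s; have := s (t^-1 * v).
  have tv : trans t^-1 (compl E) (t^-1 * v) by rewrite /trans mulKg.
  move=> /(_ (UE' _ tv)) Etv.
  by have := tE'_sub tv; rewrite /compl Etv.
have s : subcut (trans (t ^+ n.+1)^-1 (compl U)) (trans t^-1 (compl E)).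
  rewrite expgSr invgM transM; apply/subcut_transl.
  apply: (subcut_trans _ (@tnE'_sub n)); apply/subcut_transl; exact: subcut_compl.
split; first exact: subcut_trans s UE'.
move=> e; move: s; rewrite e => s; have := tE'_sub (s _ (UE _ Eu)).
by rewrite /compl Eu.
Qed.

(** The edges E and E' and their translates by g end at one vertex. Trivial stabilizers and the
    absence of inversions make the translates different from E and E', hence disjoint from them. *)
Lemma hnn_pong g : vstab true g -> g <> 1 -> subcut (trans g U) (compl U).
Proof.
move=> Vg g1; have [Hg vg] := Vg.
have Ht' := subgroupV sH Ht; have Hg' := subgroupV sH Hg.
pose E' := trans t^-1 (compl E).
have E'v : E' ~~~ E by apply: sy; have := transl Ht' tE; rewrite transK.
have OE : orbit E := orbit_side1 true.
have OE' : orbit E' := orbit_side false Ht'.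
have OgE : orbit (trans g E) := orbit_side true Hg.
have OgE' : orbit (trans g E') := orbit_trans Hg OE'.
have gE' : trans g E' ~~~ E by exact: tr (transl Hg E'v) vg.
have d1 : subcut (trans g E) (compl E) by exact: (@vstab_disjoint true).
have d2 : subcut (trans g E) (compl E').
  apply: (same_vertex_disjoint Osys OgE OE' (tr vg (sy E'v))) => e.
  apply: (@no_inversion (t * g)); first exact: subgroupM.
  by rewrite transM e /E' transVK.
have d3 : subcut (trans g E') (compl E).
  apply: (same_vertex_disjoint Osys OgE' OE gE') => e.
  apply: (@no_inversion (t * g^-1)); first exact: subgroupM.
  by rewrite transM -{1}e transK /E' transVK.
have d4 : subcut (trans g E') (compl E').
  apply: (same_vertex_disjoint Osys OgE' OE' (tr gE' (sy E'v))) => e.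
  by apply: g1; apply: (F0trivial (orbit_F0 OE')).
move=> x; rewrite /trans /U /cutU /compl negb_or => /orP[gx|gx].
  by apply/andP; split; [exact: d1|exact: d2].
by apply/andP; split; [exact: d3|exact: d4].
Qed.

Lemma hnn_free : free_family (pair_family (cyclic_set t) (vstab true)).
Proof.
have [[u Eu] _] := cs_nontrivial F0sys F0E; have Uu : U u by rewrite /U /cutU Eu.
(* A nontrivial g in the vertex group gives a point outside U. Without one, all letters are powers
   of t and reduced words have at most one letter. *)
have [[g [Vg g1]]|no] := pselect (exists g, vstab true g /\ g <> 1).
  apply: (@ping_pong _ _ _ (compl U) U).
  + by exists (g * u); apply: (hnn_pong Vg g1); rewrite /trans mulKg.
  + by exists u.
  + exact: subcut_refl.
  + exact: hnn_ping.
  exact: hnn_pong.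
have only_t x : pair_family (cyclic_set t) (vstab true) x.1 x.2 -> x.2 <> 1 -> x.1 = true.
  by case: x => -[] //= g Vg g1; case: no; exists g.
move=> [//|x [|y w]] /reduced_cons[lx nx ryw xy] _; first by rewrite wprod1.
have [ly ny _ _] := (reduced_cons _ _ _).1 ryw.
by move: xy; rewrite /head_neq (only_t x) // (only_t y).
Qed.

Lemma hnn : decomposes (pair_family (cyclic_set t) (vstab true)) H.
Proof.
split; last exact: hnn_free.
  by case; [exact: subgroup_cyclic_set|exact: subgroup_vstab].
exact: (one_orbit_generated false).
Qed.

End HNN.
End OneVertexOrbit.

Definition essential (K : set G) : set (G -> bool) :=
  [set C | F0 C /\ exists h, [/\ K h, ~ finite_order h & splits C h]].

Definition few_orbits n (K : set G) := exists R : seq (G -> bool), (size R <= n)%N /\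
  forall C, essential K C -> exists2 g, K g & trans g C \in R.

Lemma essential_side b C Q : essential (vstab b) C -> orbit Q ->
  ~ vertex (side b) Q -> ~ subcut C Q /\ ~ subcut (compl C) Q.
Proof.
move=> [FC [a [Va ainf Ca]]] OQ nv.
have stab D : almost_inv D -> splits D a -> ~ subcut D Q.
  move=> fD Da; apply: (fixed_vertex_side Osys sH _ (orbit_side1 b) OQ Va) => //.
  by move=> h P; exact: orbit_trans.
have fC := F0ai FC; split; first exact: stab.
by apply: stab; [exact: almost_inv_compl|exact: splits_compl].
Qed.

Lemma essential_not_orbit b C : essential (vstab b) C -> ~ orbit C.
Proof.
move=> eC OC; have [v|nv] := pselect (vertex (side b) C).
  have OC' := cs_compl Osys OC.
  have /(essential_side eC OC')[_] : ~ vertex (side b) (compl C).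
    by move/(vertex_compl Osys (orbit_side1 b) OC).
  by apply; exact: subcut_refl.
by have [+ _] := essential_side eC OC nv; apply; exact: subcut_refl.
Qed.

(* The vertex can be recovered from an essential cut of its stabilizer, which is
   why inequivalent cuts of the stabilizer stay inequivalent in [H]. *)
Lemma essential_vertex b C Q : essential (vstab b) C -> orbit Q ->
  vertex (side b) Q <-> ~ (subcut Q C \/ subcut Q (compl C)).
Proof.
move=> eC OQ; have [FC _] := eC; split=> [v|no].
  have OQ' := cs_compl Osys OQ.
  have /(essential_side eC OQ')[n1 n2] : ~ vertex (side b) (compl Q).
    by move/(vertex_compl Osys (orbit_side1 b) OQ).
  by case=> [s|s]; [apply: n2; exact: subcut_compl|apply: n1; exact: subcut_complr].
apply: contrapT => /(essential_side eC OQ)[n1 n2]; apply: no.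
have [s|s|s|s] := cs_nested F0sys (orbit_F0 OQ) FC; [by left|by []|by right|by []].
Qed.

Lemma essential_same_vstab b C g : H g -> essential (vstab b) C ->
  essential (vstab b) (trans g C) -> vstab b g.
Proof.
move=> Hg eC egC; split=> // Q OQ; rewrite vertex_trans.
have OQ' := orbit_trans (subgroupV sH Hg) OQ.
rewrite (essential_vertex eC OQ') (essential_vertex egC OQ).
rewrite -(subcut_transl g (trans g^-1 Q)) -(subcut_transl g (trans g^-1 Q) (compl C)).
by rewrite transVK trans_compl.
Qed.

(** The orbit of E contributes nothing to the vertex group, and each other orbit at most one orbit,
    by [essential_same_vstab]. The map f moves a representative to a cut essential for the vertex
    group, if its orbit has one. *)
Lemma vstab_fewer_orbits b n : essential H E -> few_orbits n.+1 H ->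
  few_orbits n (vstab b).
Proof.
move=> eE [R [Rn RH]]; have [g0 Hg0 r0R] := RH _ eE.
pose good r r' := essential (vstab b) r' /\ exists2 g, H g & trans g r = r'.
pose f r := if pselect (exists r', good r r') is left e then sval (cid e) else r.
exists (map f (rem (trans g0 E) R)); split.
  by rewrite size_map size_rem // -ltnS prednK //; case: (R) r0R.
move=> C eC; have eHC : essential H C.
  by have [FC [h [[Hh _] hinf Ch]]] := eC; split=> //; exists h.
have [g Hg gCR] := RH _ eHC.
have gCr0 : trans g C != trans g0 E.
  apply/eqP => e; apply: (essential_not_orbit eC).
  rewrite -(transK g C) e -transM; apply: (@orbit_side _ true).
  by apply: subgroupM => //; exact: subgroupV.
have : good (trans g C) (f (trans g C)).
  rewrite /f; case: pselect => [e|[]]; first exact: svalP.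
  by exists C; split=> //; exists g^-1; [exact: subgroupV|rewrite transK].
move=> [er' [g' Hg' e]]; exists (g' * g).
  apply: (@essential_same_vstab b C) => //; first exact: subgroupM.
  by rewrite transM e.
by rewrite transM e; apply: map_f; exact: rem_mem.
Qed.

End OneOrbit.

(** * Induction on the number of orbits of essential cuts *)

Section Splitting.
Variable G : groupType.
Variable F0 : set (G -> bool).
Hypothesis F0sys : cut_system F0.
Hypothesis F0trivial : forall C, F0 C -> trivial_stab C.
Hypothesis F0trans : forall g C, F0 C -> F0 (trans g C).
Hypothesis F0ai : forall C, F0 C -> almost_inv C.
Hypothesis F0split : forall h : G, ~ finite_order h -> exists2 C, F0 C & splits C h.
Hypothesis torsion_finite : forall K : set G, subgroup K ->
  (forall x, K x -> finite_order x) -> finite_set K.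

(** The ends of an essential E decide the case: in different orbits, K is the product of two vertex
    groups; exchanged by an inversion, the second factor has order 2; otherwise it is infinite
    cyclic. *)
Lemma few_orbits_plain n (K : set G) : subgroup K -> few_orbits F0 n K ->
  internally_plain K.
Proof.
elim: n K => [|n IH] K sK fewK;
  (have [[E eE]|no] := pselect (exists E, essential F0 K E); last first).
(* Without essential cuts K has no element of infinite order, so it is finite. *)
1,3: apply/elementary_plain; left; apply/finite_subgroupP; split=> //;
     apply: torsion_finite => // x Kx; apply: contrapT => xinf;
     have [C FC Cx] := F0split xinf; apply: no; exists C; split=> //; by exists x.
  have [R [R0 RK]] := fewK; have [g _] := RK _ eE.
  by case: (R) R0.
have FE : F0 E by case: eE.
have fewer b := vstab_fewer_orbits F0sys F0trans F0ai sK FE b eE fewK.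
have plainV b : internally_plain (vstab K E b).
  by apply: IH; [exact: subgroup_vstab|exact: fewer].
have [[t [Kt tE]]|no] := pselect (exists t, K t /\
    same_vertex (orbit K E) (trans t E) (compl E)); last first.
  apply: (internally_plain_pair (plainV true) (plainV false)).
  by apply: (amalgam F0sys F0trivial F0trans sK FE) => t Kt tE; apply: no; exists t.
have [[s [Ks sE]]|noinv] := pselect (exists s, K s /\ trans s E = compl E).
  have sE' : same_vertex (orbit K E) (trans s E) (compl E) by rewrite sE.
  apply: (internally_plain_pair (plainV true)).
    apply: elementary_plain; left; apply/finite_subgroupP.
    split; last exact: subgroup_cyclic_set.
    apply: (@sub_finite_set _ _ [set` [:: 1; s]]); last exact: finite_seq.
    move=> g sg /=; rewrite !inE; have [//|/eqP g1 /=] := eqVneq g 1.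
    by rewrite (inversion_cyclic F0trivial FE sE sg g1).
  exact: (inversion_amalgam F0sys F0trivial F0trans sK FE Ks sE').
have noinv' s : K s -> trans s E <> compl E by move=> Ks sE; apply: noinv; exists s.
apply: (internally_plain_pair _ (plainV true)); last first.
  exact: (hnn F0sys F0trivial F0trans sK FE Kt tE).
apply: elementary_plain; right; exists t => //.
exact: (t_infinite F0sys F0trivial F0trans sK FE Kt tE).
Qed.

End Splitting.

(** * Torsion in free products *)

Section TorsionInFreeProducts.
Variables (G : groupType) (I : eqType) (Hs : I -> set G).
Hypothesis sH : forall i, subgroup (Hs i).
Hypothesis free : free_family Hs.
Hypothesis gen : generated_by Hs = [set: G].
Implicit Types (w : seq (I * G)) (x y : I * G).
Local Notation reduced := (reduced Hs).

Lemma reduced_cat w1 x w2 : reduced (rcons w1 x) -> reduced w2 ->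
  head_neq x w2 -> reduced (rcons w1 x ++ w2).
Proof.
elim: w1 => [|z w1 IH] /= r1 r2 xw2.
  have [lx nx _ _] := (reduced_cons _ _ _).1 r1.
  by apply/reduced_cons; split.
have [lz nz r zw] := (reduced_cons _ _ _).1 r1.
apply/reduced_cons; split=> //; first exact: IH.
by case: w1 zw {IH r r1}.
Qed.

Lemma reduced_catl w1 w2 : reduced (w1 ++ w2) -> reduced w1.
Proof.
elim: w1 => [//|x w1 IH] /reduced_cons[lx nx r xw].
apply/reduced_cons; split=> //; first exact: IH.
by case: w1 xw {IH r}.
Qed.

Lemma reduced_catr w1 w2 : reduced (w1 ++ w2) -> reduced w2.
Proof. by elim: w1 => [//|x w1 IH] /reduced_cons[_ _ /IH]. Qed.

Lemma reduced_rconsl w x : reduced (rcons w x) -> reduced w.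
Proof. by rewrite -cats1; exact: reduced_catl. Qed.

Lemma reduced_rconsr w x : reduced (rcons w x) -> Hs x.1 x.2 /\ x.2 <> 1.
Proof. by rewrite -cats1 => /reduced_catr/reduced_cons[]. Qed.

Lemma reduced_rcons_subst w x y : x.1 = y.1 -> reduced (rcons w y) ->
  Hs x.1 x.2 -> x.2 <> 1 -> reduced (rcons w x).
Proof.
move=> xy r lx nx; elim: w r => [|z w IH] /=.
  by move=> _; apply/reduced_cons.
move=> /reduced_cons[lz nz r zw]; apply/reduced_cons; split=> //; first exact: IH.
by case: w zw {IH r} => //=; rewrite /head_neq /= xy.
Qed.

Lemma reduced_exists g : exists2 w, reduced w & wprod w = g.
Proof.
have : generated_by Hs g by rewrite gen.
move=> [w lw <-]; elim: w lw => [|x w IH] lw; first by exists [::].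
have [lx lw'] := (letters_cons _ x w).1 lw; have [v rv ev] := IH lw'.
rewrite wprod_cons -ev.
have [x1|/eqP x1] := eqVneq x.2 1; first by exists v; rewrite // x1 mul1g.
case: v rv {ev} => [|y v] rv.
  by exists [:: x]; rewrite ?wprod_cons //; apply/reduced_cons; split.
have [ly ny rv' yv] := (reduced_cons _ _ _).1 rv.
have [xy|xy] := eqVneq x.1 y.1; last first.
  by exists (x :: y :: v); rewrite ?wprod_cons //; apply/reduced_cons; split.
have [e|/eqP e] := eqVneq (x.2 * y.2) 1.
  by exists v; rewrite // wprod_cons mulgA e mul1g.
exists ((x.1, x.2 * y.2) :: v); last by rewrite !wprod_cons mulgA.
apply/reduced_cons; split=> //=; last by rewrite xy.
by apply: subgroupM => //; rewrite xy.
Qed.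

(** Powers of such a word are reduced as they stand. *)
Lemma cyclically_reduced_infinite x w y : reduced (x :: rcons w y) -> x.1 != y.1 ->
  ~ finite_order (wprod (x :: rcons w y)).
Proof.
move=> r xy [n n0].
have rn : reduced (flatten (nseq n (x :: rcons w y))).
  elim: n {n0} => //= n IH; rewrite -cat_cons -rcons_cons; apply: reduced_cat => //.
  by case: n {IH} => //= n; rewrite /head_neq eq_sym.
have wn k : wprod (flatten (nseq k (x :: rcons w y))) = wprod (x :: rcons w y) ^+ k.
  by elim: k => [|k IH]; rewrite ?expgS -?IH -?wprod_cat // /wprod big_nil.
by rewrite -wn; apply: free => //; case: n n0 {rn}.
Qed.

(** Conjugation by the first letter merges it with the last one if both are in the same factor; if
    they are not, the word is cyclically reduced and has infinite order. *)
Lemma torsion_conjugate g : g <> 1 -> finite_order g ->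
  exists z x, [/\ Hs x.1 x.2, x.2 <> 1 & g = x.2 ^ z].
Proof.
have [w rw <-] := reduced_exists g; have [n] := ubnP (size w).
elim: n w rw => // n IH [|x w] rw wn; first by rewrite /wprod big_nil.
move=> ne fin; have [lx nx rw' xw] := (reduced_cons _ _ _).1 rw.
case/lastP: w => [|w y] in rw wn ne fin rw' xw *.
  by exists 1, x; rewrite wprod1 conjg1.
have [xy|xy] := eqVneq x.1 y.1; last by case: (cyclically_reduced_infinite rw xy).
have conj_x : wprod (x :: rcons w y) ^ x.2 = wprod (rcons w (x.1, y.2 * x.2)).
  by rewrite conjgE wprod_cons mulgA mulKg -!cats1 !wprod_cat !wprod1 mulgA.
suff [v [rv vn ev]] : exists v, [/\ reduced v, (size v < n)%N &
    wprod (x :: rcons w y) ^ x.2 = wprod v].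
  have [||z [t [lt nt e]]] := IH v rv vn.
  - by rewrite -ev => /eqP; rewrite conjg_eq1 => /eqP.
  - by rewrite -ev; exact: finite_orderJ.
  by exists (z * x.2^-1), t; split=> //; rewrite conjgM -e -ev conjgK.
have rwl := reduced_rconsl rw'.
have szw : (size w < n)%N by move: wn; rewrite /= size_rcons; lia.
have [e|/eqP e] := eqVneq (y.2 * x.2) 1.
  by exists w; split=> //; rewrite conj_x -cats1 wprod_cat wprod1 /= e mulg1.
exists (rcons w (x.1, y.2 * x.2)); split=> //.
  have [ly ny] := reduced_rconsr rw'.
  apply: (reduced_rcons_subst (y := y)) => //=.
  by rewrite xy; apply: subgroupM => //; rewrite -xy.
by rewrite size_rcons; move: wn; rewrite /= size_rcons; lia.
Qed.

Definition winv w := rev [seq (x.1, x.2^-1) | x <- w].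

Lemma wprod_winv w : wprod (winv w) = (wprod w)^-1.
Proof.
elim: w => [|x w IH]; first by rewrite /wprod !big_nil invg1.
by rewrite /winv /= rev_cons -cats1 wprod_cat -/(winv w) IH wprod1 wprod_cons invgM.
Qed.

Lemma reduced_winv w : reduced w -> reduced (winv w).
Proof.
move=> [l ne alt]; split.
- move=> x; rewrite mem_rev => /mapP[y yw ->] /=.
  by apply: subgroupV => //; exact: l.
- move=> x; rewrite mem_rev => /mapP[y yw ->] /= /(congr1 inv).
  by rewrite invgK invg1; exact: ne.
rewrite /alternating /winv rev_sorted sorted_map.
by apply: sub_sorted alt => x y /=; rewrite eq_sym.
Qed.

(** A first letter of u in factor i is absorbed by conjugating a, a last letter in factor j by
    conjugating y. When neither exists and u is nonempty, a u y u^-1 is cyclically reduced. *)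
Lemma factor_torsion_product i j (a y u : G) : Hs i a -> a <> 1 -> Hs j y -> y <> 1 ->
  finite_order (a * y ^ u^-1) -> Hs i (y ^ u^-1).
Proof.
have [w rw <-] := reduced_exists u; have [n] := ubnP (size w).
elim: n w rw a y => // n IH w rw a y wn ia a1 jy y1 fin.
case: w rw wn fin => [|x w] rw wn.
  rewrite /wprod big_nil invg1 conjg1 => fin.
  have [->//|ij] := eqVneq i j.
  have r : reduced (@cons (I * G) (i, a) (rcons [::] (j, y))).
    apply/reduced_cons; split=> //.
    by apply/reduced_cons; split.
  case: (cyclically_reduced_infinite r ij).
  by rewrite /= !wprod_cons /= /wprod big_nil mulg1.
have [lx nx rw' xw] := (reduced_cons _ _ _).1 rw.
have [xi|xi] := eqVneq x.1 i.
  move=> fin; have ex : y ^ (wprod (x :: w))^-1 = (y ^ (wprod w)^-1) ^ x.2^-1.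
    by rewrite -conjgM -invgM -wprod_cons.
  rewrite ex in fin *; rewrite xi in lx; have lV := subgroupV (sH _) lx.
  apply: subgroupJ => //; apply: (IH w rw' (a ^ x.2)) => //.
  - exact: subgroupJ.
  - by move/eqP; rewrite conjg_eq1 => /eqP.
  by have := finite_orderJ x.2 fin; rewrite conjMg conjgKV.
have [[v [t [wE tj]]]|not_last] := pselect (exists v t, x :: w = rcons v t /\ t.1 = j).
  rewrite wE in rw wn *; have [lt nt] := reduced_rconsr rw.
  have -> : wprod (rcons v t) = wprod v * t.2 by rewrite -cats1 wprod_cat wprod1.
  rewrite invgM conjgM; apply: IH => //.
  - exact: reduced_rconsl rw.
  - by move: wn; rewrite size_rcons.
  - rewrite tj in lt; have lV := subgroupV (sH _) lt.
    exact: subgroupJ.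
  by move/eqP; rewrite conjg_eq1 => /eqP.
move=> fin; case: (@cyclically_reduced_infinite (i, a)
  (rcons (x :: w) (j, y) ++ winv w) (x.1, x.2^-1)).
- have rV := reduced_winv rw.
  apply/reduced_cons; split=> //; last by rewrite /head_neq /= eq_sym.
  have -> : rcons (rcons (x :: w) (j, y) ++ winv w) (x.1, x.2^-1) =
            rcons (x :: w) (j, y) ++ winv (x :: w).
    by rewrite rcons_cat /winv /= rev_cons.
  have [v [t wE]] : exists v t, x :: w = rcons v t.
    by exists (belast x w), (last x w); exact: lastI.
  have tj : t.1 != j by apply/eqP => e; apply: not_last; exists v, t.
  rewrite wE in rw rV *.
  apply: reduced_cat => //; last first.
    by rewrite /winv map_rcons rev_rcons /= /head_neq /= eq_sym.
  rewrite -cats1; apply: reduced_cat => //; apply/reduced_cons; split=> //.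
- by rewrite /= eq_sym.
have -> : wprod ((i, a) :: rcons (rcons (x :: w) (j, y) ++ winv w) (x.1, x.2^-1)) =
   a * y ^ (wprod (x :: w))^-1.
  rewrite wprod_cons -cats1 wprod_cat wprod_cat -cats1 wprod_cat !wprod1 wprod_winv /=.
  by rewrite conjgE invgK wprod_cons invgM !mulgA.
exact: fin.
Qed.

Hypothesis torsion_closed : forall i g h, Hs i g -> Hs i h ->
  finite_order g -> finite_order h -> finite_order (g * h).

Lemma free_product_torsion_transitive :
  transitive_on (@nontrivial_torsion G) (@torsion_rel G).
Proof.
move=> a b c [a1 fa] [b1 fb] [c1 fc]; rewrite /torsion_rel => ab bc.
have [z [x [lx nx bE]]] := torsion_conjugate b1 fb.
have inX g : g <> 1 -> finite_order g -> finite_order (b * g) -> Hs x.1 (g ^ z^-1).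
  move=> g1 fg bg.
  have [||v [y [ly ny gE]]] := @torsion_conjugate (g ^ z^-1).
  - by move/eqP; rewrite conjg_eq1 => /eqP.
  - exact: finite_orderJ.
  rewrite gE -[v]invgK; apply: (factor_torsion_product lx nx ly ny).
  rewrite invgK -gE; have := finite_orderJ z^-1 bg.
  by rewrite conjMg {1}bE conjgK.
have ha := inX a a1 fa (finite_order_mulC ab).
have hc := inX c c1 fc bc.
apply: (@finite_orderJV _ _ z^-1); rewrite conjMg.
by apply: (torsion_closed ha hc); exact: finite_orderJ.
Qed.

End TorsionInFreeProducts.

(** * Recognition of plain groups *)

Section FreeProductNormalForm.
Variables (I : choiceType) (H : I -> groupType).
Local Notation letter := (fp_letter H).
Local Notation rels := (fp_relations H).
Implicit Types (a b : letter) (s w : seq letter).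

(** Van der Waerden's method: letters act on reduced words, and the defining relations act trivially
    by [push1] and [pushM], so normal forms are invariant under rewriting. *)
Definition push a s : seq letter :=
  if tagged a == 1 then s else
  if s is b :: s' then
    if tag b == tag a then
      let c := tagged a * tagged_as a b in
      if c == 1 then s' else Tagged H c :: s'
    else a :: s
  else [:: a].

Fixpoint reduced_word s := if s is a :: s' then
  [&& tagged a != 1, reduced_word s' & if s' is b :: _ then tag b != tag a else true]
  else true.

Lemma push1 i s : push (Tagged H (1 : H i)) s = s.
Proof. by rewrite /push /= eqxx. Qed.

Lemma push_reduced a s : reduced_word s -> reduced_word (push a s).
Proof.
rewrite /push; case: eqP => // a1; case: s => [|b s'] /=.
  by rewrite andbT => _; apply/eqP.
move=> /and3P[b1 rs bs]; case: eqP => ba; last first.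
  by rewrite /= rs b1 bs !andbT; apply/andP; split; apply/eqP.
case: eqP => //= c1; rewrite rs /=; apply/andP; split; first exact/eqP.
by case: s' bs {rs} => //= d s'; rewrite -ba.
Qed.

Lemma pushE i (x z : H i) s : push (Tagged H x) (Tagged H z :: s) =
  if x == 1 then Tagged H z :: s else
  if x * z == 1 then s else Tagged H (x * z) :: s.
Proof. by rewrite /push /= eqxx tagged_asE. Qed.

Lemma push_other i (x : H i) s :
  (if s is b :: _ then tag b != i else true) ->
  push (Tagged H x) s = if x == 1 then s else Tagged H x :: s.
Proof. by rewrite /push /=; case: s => //= b s /negPf->. Qed.

Lemma pushM i (x y : H i) s : reduced_word s ->
  push (Tagged H x) (push (Tagged H y) s) = push (Tagged H (x * y)) s.
Proof.
case: s => [|[j z] s] rs; last first.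
  have [ji|ji] := eqVneq j i.
    subst j; case/and3P: rs => /= z1 rs sz; rewrite !pushE.
    have [->|y1] := eqVneq y 1; first by rewrite pushE mulg1.
    have [yz|yz] := eqVneq (y * z) 1.
      rewrite push_other // -mulgA yz mulg1.
      have [->|x1] := eqVneq x 1; first by rewrite mul1g (negPf y1).
      have [xy|xy] := eqVneq (x * y) 1 => //.
      suff -> : x = z by [].
      by apply: (mulIg y); rewrite xy -(mulg1_eq yz) mulVg.
    rewrite pushE mulgA.
    have [->|x1] := eqVneq x 1; first by rewrite !mul1g (negPf y1) (negPf yz).
    have [xy|//] := eqVneq (x * y) 1.
    by rewrite xy mul1g (negPf z1).
  rewrite (push_other y) // (push_other (x * y)) //.
  have [->|y1] := eqVneq y 1; first by rewrite mulg1 push_other.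
  rewrite pushE; have [->|x1] := eqVneq x 1; first by rewrite mul1g (negPf y1).
  by [].
rewrite (push_other y) // (push_other (x * y)) //.
have [->|y1] := eqVneq y 1; first by rewrite mulg1 push_other.
rewrite pushE; have [->|x1] := eqVneq x 1; first by rewrite mul1g (negPf y1).
by [].
Qed.

Definition nf_word w := foldr push [::] w.

Lemma nf_word_reduced w : reduced_word (nf_word w).
Proof. by elim: w => //= a w; exact: push_reduced. Qed.

Lemma nf_word_step w w' : rw_step rels w w' -> nf_word w = nf_word w'.
Proof.
move=> [u [v [l [r [lr -> ->]]]]]; rewrite /nf_word !foldr_cat; congr (foldr _ _ u).
case: lr => [[i [-> ->]]|[i [x [y [-> ->]]]]] /=; first exact: push1.
by apply: pushM; exact: nf_word_reduced.
Qed.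

Lemma nf_word_equiv w w' : rw_equiv rels w w' -> nf_word w = nf_word w'.
Proof.
by elim=> {w w'} [w w' /nf_word_step|w|w w' _|w w' w'' _ -> _ ->].
Qed.

Lemma nf_word_id w : reduced_word w -> nf_word w = w.
Proof.
elim: w => //= -[i x] w IH /= /and3P[x1 rw hw].
by rewrite IH // push_other // (negPf x1).
Qed.

Local Notation P := (free_product H).

Definition fp_val (a : letter) : P := word_class rels [:: a].

Lemma word_class_cat u v :
  word_class rels (u ++ v) = word_class rels u * word_class rels v :> P.
Proof. exact/esym/presented_mulE. Qed.

Lemma word_class_prod w : word_class rels w = \prod_(a <- w) fp_val a :> P.
Proof.
elim: w => [|a w IH]; first by rewrite big_nil.
by rewrite big_cons -IH -word_class_cat.
Qed.

Lemma fp_val1 i : fp_val (Tagged H (1 : H i)) = 1.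
Proof.
apply/word_classP; apply: rst_step.
by exists [::], [::], [:: Tagged H (1 : H i)], [::]; split=> //; left; exists i.
Qed.

Lemma fp_valM i (x y : H i) :
  fp_val (Tagged H x) * fp_val (Tagged H y) = fp_val (Tagged H (x * y)).
Proof.
rewrite -word_class_cat; apply/word_classP; apply: rst_step.
exists [::], [::], [:: Tagged H x; Tagged H y], [:: Tagged H (x * y)].
by split=> //; right; exists i, x, y.
Qed.

Definition factor i : set P := [set g | exists x : H i, g = fp_val (Tagged H x)].

Lemma factor_subgroup i : subgroup (factor i).
Proof.
split; first by exists 1; rewrite fp_val1.
move=> _ _ [x ->] [y ->]; exists (x * y^-1); rewrite -fp_valM; congr (_ * _).
by apply: mulg1_eq; rewrite fp_valM mulgV fp_val1.
Qed.

Lemma factor_generated : generated_by factor = [set: P].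
Proof.
apply/seteqP; split=> // g _; have [w <-] : exists w, word_class rels w = g.
  by exists (generic_quotient.repr g); exact: word_class_repr.
rewrite word_class_prod; exists [seq (tag a, fp_val a) | a <- w].
  by move=> _ /mapP[[i x] _ ->]; exists x.
by rewrite /wprod big_map.
Qed.

Lemma factor_free : free_family factor.
Proof.
move=> w rw w0 w1.
have [v [rv vw ev]] : exists v, [/\ reduced_word v, [seq tag a | a <- v] = [seq x.1 | x <- w] &
    word_class rels v = wprod w].
  elim: w rw {w0 w1} => [|x w IH] rw; first by exists [::]; rewrite /wprod big_nil.
  have [[y xy] nx rw' xw] := (reduced_cons _ _ _).1 rw.
  have [v [rv vw ev]] := IH rw'.
  exists (Tagged H y :: v); split.
  - apply/and3P; split=> //=.
      by apply/eqP => y1; apply: nx; rewrite xy y1 fp_val1.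
    case: v vw {rv ev} => // b v; case: w xw {IH rw rw'} => // z w.
    by rewrite /head_neq /= eq_sym => h [-> _].
  - by rewrite /= vw.
  by rewrite wprod_cons -ev xy -word_class_cat.
have : rw_equiv rels v [::].
  by apply/word_classP; rewrite ev w1.
move=> /nf_word_equiv; rewrite nf_word_id //= => v0.
by apply: w0; case: w vw {rw w1 ev}; rewrite v0.
Qed.

Lemma reduced_word_exists (g : P) : exists2 w, reduced_word w & word_class rels w = g.
Proof.
exists (nf_word (generic_quotient.repr g)); first exact: nf_word_reduced.
rewrite -[RHS]word_class_repr; apply/word_classP.
elim: (generic_quotient.repr g) => [|a w IH] /=; first exact: rst_refl.
apply: (@rst_trans _ _ _ ([:: a] ++ nf_word w)); last first.
  exact: rw_equiv_cat (rst_refl _ _ [:: a]) IH.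
apply/word_classP; case: a => i x; rewrite word_class_cat.
case: (nf_word w) => [|[j z] s]; rewrite ?pushE; last first.
  have [ji|ji] := eqVneq j i; last first.
    rewrite push_other //; case: eqP => [->|_]; last by rewrite -word_class_cat.
    by rewrite -/(fp_val _) fp_val1 mul1g.
  subst j; rewrite pushE -(cat1s (Tagged H z)).
  case: eqP => [->|_]; first by rewrite -/(fp_val _) fp_val1 mul1g.
  rewrite word_class_cat mulgA -!/(fp_val _) fp_valM.
  by case: eqP => [->|_]; rewrite ?fp_val1 ?mul1g // -word_class_cat.
rewrite push_other //; case: eqP => [->|_]; last by rewrite -word_class_cat.
by rewrite -/(fp_val _) fp_val1 mul1g.
Qed.

Variable G : groupType.
Variable iota : forall i, H i -> G.
Hypothesis iotaM : forall i (x y : H i), iota (x * y) = iota x * iota y.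
Hypothesis iota_inj : forall i, injective (@iota i).

Definition image_family i : set G := [set g | exists x : H i, g = iota x].
Hypothesis image_generated : generated_by image_family = [set: G].
Hypothesis image_free : free_family image_family.

Let iota1 i : iota (1 : H i) = 1.
Proof. by apply: (mulgI (iota (1 : H i))); rewrite -iotaM !mulg1. Qed.

Definition fp_eval w : G := \prod_(a <- w) iota (tagged a).

Lemma fp_eval_cat u v : fp_eval (u ++ v) = fp_eval u * fp_eval v.
Proof. exact: big_cat. Qed.

Lemma fp_eval_equiv w w' : rw_equiv rels w w' -> fp_eval w = fp_eval w'.
Proof.
elim=> {w w'} [w w'|w|w w' _|w w' w'' _ -> _ ->] //.
move=> [u [v [l [r [lr -> ->]]]]]; rewrite !fp_eval_cat; congr (_ * (_ * _)).
case: lr => [[i [-> ->]]|[i [x [y [-> ->]]]]]; rewrite /fp_eval !big_cons !big_nil /=.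
  by rewrite iota1 mulg1.
by rewrite !mulg1 iotaM.
Qed.

Definition fp_hom (g : P) : G := fp_eval (generic_quotient.repr g).

Lemma fp_hom_class w : fp_hom (word_class rels w) = fp_eval w.
Proof. by apply: fp_eval_equiv; exact: repr_word_class. Qed.

Lemma fp_homM : {morph fp_hom : x y / x * y}.
Proof.
move=> x y; rewrite -[x]word_class_repr -[y]word_class_repr.
by rewrite -word_class_cat !fp_hom_class fp_eval_cat.
Qed.

Lemma fp_hom_ker g : fp_hom g = 1 -> g = 1.
Proof.
have [w rw <-] := reduced_word_exists g; rewrite fp_hom_class => w1.
suff -> : w = [::] by [].
apply: contrapT => w0; apply: (@image_free [seq (tag a, iota (tagged a)) | a <- w]).
- elim: w rw {w0 w1} => // a w IH /= /and3P[a1 rw aw].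
  apply/reduced_cons; split=> /=.
  + by exists (tagged a).
  + move=> e; move/eqP: a1; apply; apply: (@iota_inj (tag a)).
    by rewrite e iota1.
  + exact: IH.
  by case: w aw {IH rw} => //= b w; rewrite /head_neq /= eq_sym.
- by case: (w) w0.
by rewrite /wprod big_map.
Qed.

Lemma fp_hom_bij : bijective fp_hom.
Proof.
have inj : injective fp_hom.
  move=> x y e; apply: divg1_eq; apply: fp_hom_ker; rewrite fp_homM e -fp_homM mulgV.
  by rewrite [LHS](fp_hom_class [::]) /fp_eval big_nil.
have surj g : exists x, fp_hom x = g.
  have : generated_by image_family g by rewrite image_generated.
  move=> [w lw <-]; elim: w lw => [|x w IH] lw.
    by exists (word_class rels [::]); rewrite fp_hom_class /fp_eval /wprod !big_nil.
  have [[y xy] lw'] := (letters_cons _ x w).1 lw; have [z ez] := IH lw'.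
  exists (fp_val (Tagged H y) * z); rewrite fp_homM ez wprod_cons; congr (_ * _).
  by rewrite fp_hom_class /fp_eval big_seq1 /= xy.
pose psi g := sval (cid (surj g)); have psiK g : fp_hom (psi g) = g := svalP (cid (surj g)).
by exists psi => // x; apply: inj; rewrite psiK.
Qed.

Lemma free_product_recognition : exists f : {multiplicative G -> P}, bijective f.
Proof.
have [psi K1 K2] := fp_hom_bij.
have psiM : {morph psi : x y / x * y}.
  by move=> x y; apply: (can_inj K1); rewrite fp_homM !K2.
pose f : {multiplicative G -> P} := HB.pack psi (isMultiplicative.Build G P psi psiM).
by exists f; exists fp_hom.
Qed.

End FreeProductNormalForm.

(** * Finite subgroups and infinite cyclic subgroups as abstract groups *)

Section FiniteSubgroupType.
Variables (G : groupType) (X : {fset G}).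
Hypothesis sX : subgroup [set` X].

(** The proof is an argument of the type so that a canonical group structure can depend on it. *)
Definition fset_group of subgroup [set` X] : Type := X.
Local Notation T := (fset_group sX).

HB.instance Definition _ := Finite.on T.

Definition fset_group_val (x : T) : G := fsval x.

Lemma fset_group_val_inj : injective fset_group_val.
Proof. exact: val_inj. Qed.

Lemma fset_group_mem (x : T) : [set` X] (fset_group_val x).
Proof. exact: fsvalP. Qed.

Definition fset_group_one : T := FSetSub (sX.1 : 1 \in X).
Definition fset_group_mul (x y : T) : T :=
  FSetSub (subgroupM sX (fset_group_mem x) (fset_group_mem y) : _ \in X).
Definition fset_group_inv (x : T) : T :=
  FSetSub (subgroupV sX (fset_group_mem x) : _ \in X).

Fact fset_group_mulA : associative fset_group_mul.
Proof. by move=> x y z; apply: val_inj; exact: mulgA. Qed.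
Fact fset_group_mul1 : left_id fset_group_one fset_group_mul.
Proof. by move=> x; apply: val_inj; exact: mul1g. Qed.
Fact fset_group_mulr1 : right_id fset_group_one fset_group_mul.
Proof. by move=> x; apply: val_inj; exact: mulg1. Qed.
Fact fset_group_mulV : left_inverse fset_group_one fset_group_inv fset_group_mul.
Proof. by move=> x; apply: val_inj; exact: mulVg. Qed.
Fact fset_group_mulrV : right_inverse fset_group_one fset_group_inv fset_group_mul.
Proof. by move=> x; apply: val_inj; exact: mulgV. Qed.

HB.instance Definition _ := isGroup.Build T fset_group_mulA fset_group_mul1
  fset_group_mulr1 fset_group_mulV fset_group_mulrV.

Lemma fset_group_valM (x y : T) :
  fset_group_val (x * y) = fset_group_val x * fset_group_val y.
Proof. by []. Qed.

End FiniteSubgroupType.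

Lemma finite_group_model (G : groupType) (K : set G) : finite_subgroup K ->
  exists (F : finGroupType) (iota : F -> G),
    [/\ {morph iota : x y / x * y}, injective iota & forall g, K g <-> exists x, g = iota x].
Proof.
move=> /finite_subgroupP[fK sK]; have [X XK] := finite_fsetP.1 fK.
rewrite XK in sK *.
exists (fset_group sK), (@fset_group_val _ _ sK); split.
- exact: fset_group_valM.
- exact: fset_group_val_inj.
move=> g; split=> [Xg|[x ->]]; last exact: fset_group_mem.
by exists (FSetSub (Xg : g \in X)).
Qed.

Section IntegerPowers.
Variables (G : groupType) (t : G).

Definition zpow (z : int_group) : G :=
  match z with Posz n => t ^+ n | Negz n => (t ^+ n.+1)^-1 end.

(** Differences of naturals avoid a case analysis on signs in [zpowM]. *)
Lemma zpow_sub m n : zpow (Posz m - Posz n)%R = t ^+ m * (t ^+ n)^-1.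
Proof.
have [nm|/ltnW mn] := leqP n m.
  by rewrite subzn //= expgnFr.
have -> : (Posz m - Posz n)%R = (- Posz (n - m))%R by rewrite -subzn // GRing.opprB.
have -> : t ^+ n = t ^+ (n - m) * t ^+ m by rewrite -expgnDr subnK.
rewrite invgM mulVKg.
by case: (n - m)%N => [|k] //=; rewrite invg1.
Qed.

Lemma zpowM (x y : int_group) : zpow (x * y) = zpow x * zpow y.
Proof.
have repr (z : int) : exists m n, z = (Posz m - Posz n)%R.
  by case: z => n; [exists n, 0%N; rewrite GRing.subr0|exists 0%N, n.+1; rewrite GRing.sub0r NegzE].
have [m [n ->]] := repr x; have [m' [n' ->]] := repr y.
have -> : ((Posz m - Posz n)%R : int_group) * (Posz m' - Posz n')%R =
    (Posz (m + m') - Posz (n' + n))%R :> int_group.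
  have arith : ((Posz m - Posz n) + (Posz m' - Posz n'))%R =
      (Posz (m + m') - Posz (n' + n))%R by lia.
  exact: arith.
rewrite !zpow_sub !expgnDr invgM -!mulgA; congr (_ * _).
have comm k l : commute (t ^+ k) (t ^+ l) by apply/commuteX2/commute_refl.
by rewrite !mulgA (commuteV (comm m' n)).
Qed.

Lemma zpow_inj : ~ finite_order t -> injective zpow.
Proof.
move=> tinf.
have zpow0 z : zpow z = 1 -> z = 0%R.
  case: z => [[//|n]|n] /= e; case: tinf; exists n.+1 => //.
  by apply: invg_inj; rewrite e invg1.
move=> x y e; apply: divg1_eq; apply: zpow0.
by apply: (mulIg (zpow y)); rewrite -zpowM mulgVK mul1g.
Qed.

Lemma zpow_cyclic g : cyclic_set t g <-> exists z, g = zpow z.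
Proof.
split=> [[n [->|->]]|[[n|n] ->]].
- by exists (Posz n).
- by exists (- Posz n)%R; case: n => [|n] //=; rewrite invg1.
- by exists n; left.
- by exists n.+1; right.
Qed.

End IntegerPowers.

Lemma decomposes_reindex (G : groupType) (I J : eqType) (Hs : I -> set G)
    (K : set G) (sigma : J -> I) :
  bijective sigma -> decomposes Hs K -> decomposes (Hs \o sigma) K.
Proof.
move=> [tau sigmaK tauK] [sH gen free]; split.
- by move=> j; exact: sH.
- rewrite -gen; apply/seteqP; split; apply: generated_min.
  + exact: subgroup_generated.
  + by move=> j g jg; exact: (@generated_letter _ _ _ (sigma j)).
  + by apply: subgroup_generated => j; exact: sH.
  + by move=> i g ig; apply: (@generated_letter _ _ _ (tau i)); rewrite /= tauK.
move=> w rw w0.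
have <- : wprod [seq (sigma x.1, x.2) | x <- w] = wprod w by rewrite /wprod big_map.
apply: free; last by case: (w) w0.
case: rw => l ne alt; split.
- by move=> _ /mapP[x xw ->]; exact: l.
- by move=> _ /mapP[x xw ->]; exact: ne.
rewrite /alternating sorted_map; apply: sub_sorted alt => x y /=.
by rewrite (can_eq sigmaK).
Qed.

Lemma internally_plain_plain (G : groupType) :
  internally_plain [set: G] -> plain G.
Proof.
move=> [I [Hs [elem dec]]].
(* Sorting the factors by finiteness gives the index type of [plain_factor]. *)
pose fin := [pred i | `[< finite_subgroup (Hs i) >]].
pose m := #|fin|; pose n := #|predC fin|.
pose sigma (j : 'I_m + 'I_n) : I :=
  match j with inl k => enum_val k | inr k => enum_val k end.
have sigma_fin k : finite_subgroup (Hs (sigma (inl k))).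
  by have := enum_valP k; move=> /asboolP.
have sigma_inf k : exists2 t, ~ finite_order t & Hs (sigma (inr k)) = cyclic_set t.
  by have := enum_valP k; move=> /asboolPn; case: (elem (sigma (inr k))).
have sigma_inj : injective sigma.
  have disj k l : sigma (inl k) <> sigma (inr l).
    move=> e; have [t tinf tE] := sigma_inf l.
    have [fK sK] := (finite_subgroupP _).1 (sigma_fin k).
    apply: tinf; apply: (finite_subgroup_torsion fK sK).
    by rewrite e tE; exact: cyclic_set_id.
  move=> [k|k] [l|l] /= e; first by rewrite (enum_val_inj e).
  - by case: (disj k l).
  - by case: (disj l k).
  by rewrite (enum_val_inj e).
have sigma_bij : bijective sigma.
  apply: (inj_card_bij sigma_inj).
  by rewrite card_sum !card_ord /m /n cardC.
have [F Fmodel] : exists F : 'I_m -> finGroupType, forall k, exists iota : F k -> G,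
    [/\ {morph iota : x y / x * y}, injective iota &
      forall g, Hs (sigma (inl k)) g <-> exists x, g = iota x].
  have := fun k => cid (finite_group_model (sigma_fin k)) => S.
  by exists (fun k => sval (S k)) => k; exact: svalP (S k).
have [iotaF iotaFP] : exists iota : forall k, F k -> G, forall k,
    [/\ {morph iota k : x y / x * y}, injective (iota k) &
      forall g, Hs (sigma (inl k)) g <-> exists x, g = iota k x].
  have S := fun k => cid (Fmodel k).
  by exists (fun k => sval (S k)) => k; exact: svalP (S k).
have [t tP] : exists t : 'I_n -> G, forall k,
    ~ finite_order (t k) /\ Hs (sigma (inr k)) = cyclic_set (t k).
  have S k : exists t, ~ finite_order t /\ Hs (sigma (inr k)) = cyclic_set t.
    by have [t ? ?] := sigma_inf k; exists t.
  by exists (fun k => sval (cid (S k))) => k; exact: svalP (cid (S k)).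
pose iota (i : 'I_m + 'I_n) : plain_factor (n := n) F i -> G :=
  match i with inl k => iotaF k | inr k => zpow (t k) end.
have iotaM i (x y : plain_factor (n := n) F i) : iota i (x * y) = iota i x * iota i y.
  by case: i x y => k x y; [have [H _ _] := iotaFP k; exact: H|exact: zpowM].
have iota_inj i : injective (iota i).
  by case: i => k; [have [_ H _] := iotaFP k|apply: zpow_inj; have [] := tP k].
have imageE : image_family iota = Hs \o sigma.
  apply/funext => -[k|k]; apply/seteqP; split=> g /=.
  - by move=> [x ->]; have [_ _ H] := iotaFP k; apply/H; exists x.
  - by have [_ _ H] := iotaFP k; move/H.
  - by move=> [x ->]; have [_ ->] := tP k; apply/zpow_cyclic; exists x.
  - by have [_ ->] := tP k; move/zpow_cyclic.
have [_ gen free] := decomposes_reindex sigma_bij dec.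
exists m, n, F; apply: (free_product_recognition iotaM iota_inj).
  by rewrite imageE.
by rewrite imageE.
Qed.

(** * The implications of the theorem *)

Lemma morph_finite_order (G K : groupType) (f : G -> K) (g : G) :
  {morph f : x y / x * y} -> injective f -> finite_order (f g) <-> finite_order g.
Proof.
move=> fM f_inj; have f1 : f 1 = 1 by apply: (mulgI (f 1)); rewrite -fM !mulg1.
have fX n : f (g ^+ n) = f g ^+ n by elim: n => [|n IH]; rewrite ?expgS ?fM ?IH.
split=> -[n n0 gn]; exists n => //; last by rewrite -fX gn f1.
by apply: f_inj; rewrite fX gn f1.
Qed.

Lemma fp_val_inj (I : choiceType) (H : I -> groupType) i :
  injective (fun x : H i => fp_val (Tagged H x)).
Proof.
have ker (x : H i) : fp_val (Tagged H x) = 1 -> x = 1.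
  move=> e; apply/eqP; apply: contrapT => /negP x1.
  have : rw_equiv (fp_relations H) [:: Tagged H x] [::] by exact/word_classP.
  by move=> /nf_word_equiv; rewrite nf_word_id //= x1.
move=> x y /= e; apply: divg1_eq; apply: ker.
apply: (mulIg (fp_val (Tagged H y))).
by rewrite fp_valM mulgVK mul1g.
Qed.

Lemma plain_torsion_transitive (G : groupType) : plain G ->
  transitive_on (@nontrivial_torsion G) (@torsion_rel G).
Proof.
move=> [m [n [F [f f_bij]]]].
pose P := free_product (plain_factor (n := n) F).
have fM : {morph f : x y / x * y} by exact: gmulfM.
have f_inj := bij_inj f_bij.
have f1 : f 1 = 1 by apply: (mulgI (f 1)); rewrite -fM !mulg1.
suff tP : transitive_on (@nontrivial_torsion P) (@torsion_rel P).
  have nt g : nontrivial_torsion g -> nontrivial_torsion (f g).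
    move=> [g1 fg]; split; first by rewrite -f1 => /f_inj.
    exact/(morph_finite_order _ fM f_inj).
  move=> a b c /nt a1 /nt b1 /nt c1 ab bc.
  apply/(morph_finite_order _ fM f_inj); rewrite fM; apply: (tP _ (f b)) => //.
    by rewrite /torsion_rel -fM; exact/(morph_finite_order _ fM f_inj).
  by rewrite /torsion_rel -fM; exact/(morph_finite_order _ fM f_inj).
apply: (free_product_torsion_transitive (@factor_subgroup _ (plain_factor (n := n) F))
  (@factor_free _ _) (@factor_generated _ _)).
(* In a finite factor every element is torsion; in a copy of the integers only the identity is. *)
move=> [k|k] _ _ [x ->] [y ->] fx fy; rewrite fp_valM.
  apply/(morph_finite_order _ (fun x y => esym (fp_valM x y)) (@fp_val_inj _ _ _)).
  exists #[x * y : F k]; [exact: order_gt0|exact: expg_order].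
have val_torsion z := morph_finite_order z (fun x y => esym (fp_valM x y))
  (@fp_val_inj _ (plain_factor (n := n) F) (inr k)).
have int_torsion (z : int_group) : finite_order z -> z = 1.
  move=> [q q0 zq]; have expE r : z ^+ r = ((z : int) *+ r)%R.
    by elim: r => [//|r IH]; rewrite expgS GRing.mulrS IH.
  by move/eqP: zq; rewrite expE Num.Theory.mulrn_eq0 eqn0Ngt q0 => /eqP.
have /int_torsion -> := (val_torsion x).1 fx.
by rewrite mul1g.
Qed.

Lemma unique_maximal_plain (G : groupType) (Sigma : finType) (L : nat)
    (ev : seq Sigma -> G) (nf : G -> seq Sigma) : nf_system L ev nf ->
  (forall g : G, nontrivial_torsion g ->
     exists! M : set G, maximal_finite_subgroup M /\ M g) ->
  plain G.
Proof.
move=> N unique_max; pose F0 := [set C | optimal_cuts ev C /\ trivial_stab C].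
have F0sys : cut_system F0.
  have S := optimal_cut_system N; split.
  - by move=> C [oC _]; exact: (cs_nontrivial S).
  - move=> C [oC tC]; split; first exact: (cs_compl S).
    move=> g gC; apply: tC; apply/funext => u.
    by apply: negb_inj; exact: (congr1 (fun D : G -> bool => D u) gC).
  - by move=> C D [oC _] [oD _]; exact: (cs_nested S).
  - move=> u v; apply: sub_finite_set (cs_interval S u v).
    by move=> C [[oC _] Cu Cv].
  by move=> C g [oC _]; exact: (cs_stab S).
have F0trans g C : F0 C -> F0 (trans g C).
  move=> [oC tC]; split; first exact: optimal_cuts_trans.
  move=> h hC; apply/eqP; rewrite -(conjg_eq1 h g); apply/eqP; apply: tC.
  by rewrite conjgE !transM hC transK.
apply: internally_plain_plain.
have [R RP] := optimal_cuts_orbits N.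
apply: (@few_orbits_plain _ F0 F0sys _ F0trans _ _ _ (size R)).
- by move=> C [].
- by move=> C [/optimal_cuts_almost_inv].
- by move=> h /(split_trivial_stab N unique_max)[C [oC hC tC]]; exists C.
- by move=> K sK tK; exact: (torsion_subgroup_finite N).
- by [].
by exists R; split=> // C [[/RP[g gR] _] _]; exists g.
Qed.

Lemma geodesic_length_le (G : groupType) (A : Type) (ev : A -> G) (w : seq A) :
  (geodesic_length ev (\prod_(a <- w) ev a) <= size w)%N.
Proof.
set g := \prod_(a <- w) ev a.
have wg : signed_word_value ev (map inl w) = g by rewrite /signed_word_value big_map.
(* The default value 0 satisfies the bound as well. *)
rewrite /geodesic_length; case: xgetP => [n _ [_ min_n]|none].
  by have := min_n _ wg; rewrite size_map.
by [].
Qed.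

Theorem theoremB (G : groupType) (Sigma : finType)
    (T : set (seq Sigma * seq Sigma))
    (Sigma_nonempty : (0 < #|Sigma|)%N)
    (T_length_reducing : length_reducing T)
    (T_finite : finite_set T)
    (T_convergent : convergent T)
    (T_inverse_closed : inverse_closed T)
    (phi : {multiplicative presented T -> G})
    (phi_bij : bijective phi) :
  [<-> plain G;
       forall g : G, nontrivial_torsion g ->
         exists! M : set G, maximal_finite_subgroup M /\ M g;
       transitive_on (@nontrivial_torsion G) (@torsion_rel G);
       transitive_on
         (fun g : G => nontrivial_torsion g /\
            (geodesic_length (fun a : Sigma => phi (word_class T [:: a])) g
               <= 11 * max_lhs T)%N)
         (@torsion_rel G)].
Proof.
have N := rw_nf_system T_length_reducing T_finite T_convergent T_inverse_closed
  Sigma_nonempty phi_bij.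
(* Elements with short normal forms have short geodesic length, so (4) yields the transitivity that
   [unique_maximal_finite] expects. *)
have geodesic_le g : (geodesic_length (fun a => phi (word_class T [:: a])) g
    <= size (rw_nf phi g))%N.
  rewrite -{1}(nfs_K N g); suff -> : rw_eval phi (rw_nf phi g) =
      \prod_(a <- rw_nf phi g) phi (word_class T [:: a]) by exact: geodesic_length_le.
  elim: (rw_nf phi g) => [|a w IH]; first by rewrite big_nil (nfs_nil N).
  by rewrite big_cons -IH -cat1s (nfs_cat N).
have h21 := unique_maximal_plain N.
set P1 := plain G in h21 *; set P2 := (X in X -> P1) in h21 *.
set P3 := transitive_on _ _; set P4 := transitive_on _ _.
have h13 : P1 -> P3 by exact: plain_torsion_transitive.
have h34 : P3 -> P4 by move=> h a b c [ta _] [tb _] [tc _]; exact: h.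
have h42 : P4 -> P2.
  move=> h; apply: (unique_maximal_finite N) => a b c [ta la] [tb lb] [tc lc].
  by apply: h; split=> //; apply: leq_trans (geodesic_le _) _.
by tfae; [move/h13/h34/h42|move/h21/h13|exact: h34|move/h42/h21].
Qed.
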